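(* Let $p,q\ge 3$, let $\alpha$ be a Hamiltonian cycle in $\widetilde{K}_p$ and let $\beta$ be a Hamiltonian cycle in $\widetilde{K}_q$. Then $\widetilde{K}_{p+q+1}$ contains a Hamiltonian cycle that is ambient isotopic to a connected sum $\alpha\#\beta$ of the knots $\alpha$ and $\beta$.
   Context: Canonical book representation $\widetilde{K}_n$: label the vertices of the complete graph $K_n$ by $1,\dots,n$ and place them in this cyclic order on a round circle $C$ in a plane $P\subset\mathbb{R}^3$. The ''sheets'' $S_1,\dots,S_k$ are topological disks in $\mathbb{R}^3$ with common boundary $C$ and pairwise disjoint interiors, stacked so that, in the projection to $P$, $S_a$ lies above $S_b$ whenever $a<b$. Each edge $\{i,j\}$ is embedded as a chord with endpoints $i,j$ inside exactly one sheet, chords in a common sheet being disjoint except at shared endpoints; the resulting spatial graph is determined up to ambient isotopy by the assignment of edges to sheets. If $n=2m$ there are $m$ sheets, and for $1\le i\le m$ sheet $S_i$ contains the edges $\{i,i+j\}$ for $1\le j\le m$ and $\{i+m,(i+m+j)\bmod 2m\}$ for $1\le j\le m-1$. If $n=2m+1$ there are $m+1$ sheets; for $1\le i\le m$ sheet $S_i$ contains the edges $\{i,i+j\}$ and $\{i+m+1,(i+m+j+1)\bmod(2m+1)\}$ for $1\le j\le m$, and $S_{m+1}$ contains the edges $\{m+1,m+1+j\}$ for $1\le j\le m$. Residues mod $n$ are taken in $\{1,\dots,n\}$. A cycle $(\alpha_1,\dots,\alpha_r)$ of distinct vertices denotes the closed curve formed by the embedded edges $\{\alpha_1,\alpha_2\},\dots,\{\alpha_{r-1},\alpha_r\},\{\alpha_r,\alpha_1\}$,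 regarded as a knot in $\mathbb{R}^3$; it is Hamiltonian if it uses all vertices of the graph. *)

(* Defs.v *)
From Stdlib Require Import Reals Lra Arith List.
Import ListNotations.
Open Scope R_scope.

Definition pt : Type := (R * R * R)%type.
Definition px (p : pt) : R := fst (fst p).
Definition py (p : pt) : R := snd (fst p).
Definition pz (p : pt) : R := snd p.
Definition dist3 (p q : pt) : R :=
  sqrt ((px p - px q)^2 + (py p - py q)^2 + (pz p - pz q)^2).

(** A subset of R^3 (a knot is regarded as its image set). *)
Definition pset := pt -> Prop.

Definition continuous3 (f : pt -> pt) : Prop :=
  forall x eps, 0 < eps -> exists del, 0 < del /\
    forall y, dist3 x y < del -> dist3 (f x) (f y) < eps.

Definition continuous_isotopy (H : R -> pt -> pt) : Prop :=
  forall t x eps, 0 <= t <= 1 -> 0 < eps -> exists del, 0 < del /\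
    forall s y, 0 <= s <= 1 -> Rabs (s - t) < del -> dist3 x y < del ->
      dist3 (H t x) (H s y) < eps.

Definition homeomorphism3 (f : pt -> pt) : Prop :=
  continuous3 f /\ exists g, continuous3 g /\
    (forall x, g (f x) = x) /\ (forall y, f (g y) = y).

Definition ambient_isotopic (A B : pset) : Prop :=
  exists H : R -> pt -> pt,
    continuous_isotopy H /\
    (forall x, H 0 x = x) /\
    (forall t, 0 <= t <= 1 -> homeomorphism3 (H t)) /\
    (forall y, B y <-> exists x, A x /\ H 1 x = y).

Definition lerp (P Q : pt) (t : R) : pt :=
  (((1 - t) * px P + t * px Q, (1 - t) * py P + t * py Q),
    (1 - t) * pz P + t * pz Q).
Definition seg (P Q : pt) (z : pt) : Prop :=
  exists t, 0 <= t <= 1 /\ z = lerp P Q t.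
Definition open_seg (P Q : pt) (z : pt) : Prop :=
  exists t, 0 < t < 1 /\ z = lerp P Q t.

Definition conn_sum (K1 K2 K : pset) : Prop :=
  exists (K1' K2' : pset) (P Q : pt),
    ambient_isotopic K1 K1' /\ ambient_isotopic K2 K2' /\
    (forall z, K1' z -> px z <= 0) /\ (forall z, K2' z -> 0 <= px z) /\
    px P = 0 /\ px Q = 0 /\ P <> Q /\
    (forall z, (K1' z /\ px z = 0) <-> seg P Q z) /\
    (forall z, (K2' z /\ px z = 0) <-> seg P Q z) /\
    (forall z, K z <-> ((K1' z \/ K2' z) /\ ~ open_seg P Q z)).

Definition md (n x : nat) : nat :=
  if Nat.eqb (x mod n) 0 then n else x mod n.

Definition sameEdge (u v x y : nat) : Prop :=
  (u = x /\ v = y) \/ (u = y /\ v = x).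

Definition inSheet (n a u v : nat) : Prop :=
  let m := Nat.div2 n in
  if Nat.even n then
    (1 <= a <= m /\
      ((exists j, 1 <= j <= m /\ sameEdge u v a (md n (a + j))) \/
       (exists j, 1 <= j <= m - 1 /\ sameEdge u v (a + m) (md n (a + m + j)))))%nat
  else
    ((1 <= a <= m /\ exists j, 1 <= j <= m /\
        (sameEdge u v a (md n (a + j)) \/
         sameEdge u v (a + m + 1) (md n (a + m + j + 1)))) \/
     (a = m + 1 /\ exists j, 1 <= j <= m /\ sameEdge u v (m + 1) (m + 1 + j)))%nat.

Definition vangle (n i : nat) : R := 2 * PI * INR (i - 1) / INR n.
Definition vx (n i : nat) : R := cos (vangle n i).
Definition vy (n i : nat) : R := sin (vangle n i).

(** Concrete sheets: S_a = { z = (n - a) (1 - x^2 - y^2), x^2 + y^2 <= 1 }.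
    They share the boundary C, have disjoint interiors, and S_a lies above S_b
    for a < b.  The edge {u,v} in sheet S_a is the lift to S_a of the straight
    chord from vertex u to vertex v. *)
Definition edge_set (n u v : nat) (z : pt) : Prop :=
  exists (a : nat) (t : R), inSheet n a u v /\ 0 <= t <= 1 /\
    px z = (1 - t) * vx n u + t * vx n v /\
    py z = (1 - t) * vy n u + t * vy n v /\
    pz z = INR (n - a) * (1 - px z ^ 2 - py z ^ 2).

Definition cycle_edges (c : list nat) : list (nat * nat) :=
  combine c (tl c ++ firstn 1 c).

Definition cycle_knot (n : nat) (c : list nat) : pset :=
  fun z => exists e, In e (cycle_edges c) /\ edge_set n (fst e) (snd e) z.

Definition hamiltonian (n : nat) (c : list nat) : Prop :=
  NoDup c /\ length c = n /\ (forall i, In i c -> (1 <= i <= n)%nat).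

(* Main.v *)
(* The only isotopies needed, besides rotations, are pushes along a coordinate
   axis.  A real function on a subset of space which is Lipschitz in the passive
   coordinates and increasing with slopes in [[1/C, C]] in the active one extends
   to all of space with the same bounds (McShane's formula for a non-symmetric
   gauge), and linear interpolation with the identity is then an isotopy.  Hence
   two lifts of one plane graph with the same order at the crossings are isotopic.

   A projective map sends the circle, cut between two vertices, to the parabola
   y = x^2 and chords to chords.  Seen along the y-axis the vertices may then be
   moved as long as their order is kept, and a vertex of valency two next to its
   right neighbour may be removed.

   Number the vertices alternately on the two halves of the circle, and give the
   edge between the levels k and l the level min k l if k and l have the same
   parity, max k l otherwise; its sheet is half its level, rounded up.  In the
   book of p + q + 1 vertices put alpha, minus the vertex of level p - 1, on the
   levels 1, ..., p - 2, p, and beta, minus the vertex of level 2, on the levels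
   p + 2 and p + 4, ..., p + q + 1, and join the resulting paths through the
   vertices c of level p + 1, d of level p - 1 and c' of level p + 3.  The arc of
   alpha then runs from c to c' through d, the arc of beta from c' to c.  All
   edges of the first arc lie above all those of the second where they cross, so
   a surface separates the arcs and meets them only at c and c'.  Closing an arc
   with the chord c c' and removing the additional vertices of valency two gives
   back alpha and beta. *)
Require Import Defs.
From Stdlib Require Import Reals Lra Lia Psatz List Permutation Classical.
Import ListNotations.
Open Scope R_scope.


(** * Ambient isotopies of space *)

(** The vertex [d] is the price for keeping the arc of alpha above that of beta. The split vertex of
    alpha must reappear at both ends of the first arc. At [c] its edge has level at most [p + 1]; a
    direct edge from the other neighbour to [c'] could have level [p + 3], below edges of beta. The
    detour through [d] has level at most [p], since [d] and [c'] have the same parity. Edges of the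
    second arc have level at least [p + 1], and crossing edges never have equal levels. The levels
    [p - 1] and 2 are split because, with the circle cut just behind them, replacing them by [p + 1]
    and 0 for one of the two edges changes no crossing. Cutting the sum just behind [c'] makes [d],
    [c], [c'] the last vertices, so the closing chord crosses nothing. Moving vertices makes plane
    chords sweep across each other's crossings, and a push along y is possible only where z holds
    them apart. Hence the curved sheets are first flattened to trapezoids: off the ends, crossing
    chords then lie at distinct constant heights, and near the ends the order of the vertices alone
    decides which chord is on which side. *)

Lemma pt_ext (p q : pt) : px p = px q -> py p = py q -> pz p = pz q -> p = q.
Proof.
  destruct p as [[x y] z], q as [[x' y'] z']. unfold px, py, pz; simpl.
  intros; subst; reflexivity.
Qed.

Definition dist1 (p q : pt) : R :=
  Rabs (px p - px q) + Rabs (py p - py q) + Rabs (pz p - pz q).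

Lemma dist3_le_dist1 (p q : pt) : dist3 p q <= dist1 p q.
Proof.
  unfold dist3, dist1.
  set (a := px p - px q). set (b := py p - py q). set (c := pz p - pz q).
  pose proof (Rabs_pos a). pose proof (Rabs_pos b). pose proof (Rabs_pos c).
  rewrite <- (sqrt_pow2 (Rabs a + Rabs b + Rabs c)) by lra.
  apply sqrt_le_1_alt.
  rewrite <- (pow2_abs a), <- (pow2_abs b), <- (pow2_abs c). nra.
Qed.

Lemma dist1_le_dist3 (p q : pt) : dist1 p q <= 3 * dist3 p q.
Proof.
  unfold dist3, dist1.
  set (a := px p - px q). set (b := py p - py q). set (c := pz p - pz q).
  assert (H : forall u, u ^ 2 <= a ^ 2 + b ^ 2 + c ^ 2 ->
                Rabs u <= sqrt (a ^ 2 + b ^ 2 + c ^ 2)).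
  { intros u Hu. rewrite <- (sqrt_pow2 (Rabs u)) by apply Rabs_pos.
    apply sqrt_le_1_alt. rewrite pow2_abs. exact Hu. }
  pose proof (H a ltac:(nra)). pose proof (H b ltac:(nra)).
  pose proof (H c ltac:(nra)). lra.
Qed.

Lemma dist1_pos (p q : pt) : 0 <= dist1 p q.
Proof.
  unfold dist1. pose proof (Rabs_pos (px p - px q)).
  pose proof (Rabs_pos (py p - py q)). pose proof (Rabs_pos (pz p - pz q)). lra.
Qed.

Lemma continuous3_lipschitz (f : pt -> pt) (C : R) :
  (forall p q, dist1 (f p) (f q) <= C * dist1 p q) -> continuous3 f.
Proof.
  intros H x eps He.
  pose proof (Rabs_pos C). pose proof (Rle_abs C).
  exists (eps / (3 * (Rabs C + 1))). split.
  { apply Rdiv_lt_0_compat; lra. }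
  intros y Hy. apply Rle_lt_trans with (1 := dist3_le_dist1 _ _).
  apply Rle_lt_trans with (1 := H _ _).
  pose proof (dist1_le_dist3 x y). pose proof (dist1_pos x y).
  assert (dist3 x y * (3 * (Rabs C + 1)) < eps).
  { apply Rmult_lt_reg_r with (/ (3 * (Rabs C + 1))).
    - apply Rinv_0_lt_compat; lra.
    - rewrite Rmult_assoc, Rinv_r by lra. unfold Rdiv in Hy. lra. }
  nra.
Qed.

Lemma continuous3_id : continuous3 (fun p => p).
Proof. apply continuous3_lipschitz with 1. intros; lra. Qed.

Lemma continuous3_comp (f g : pt -> pt) :
  continuous3 f -> continuous3 g -> continuous3 (fun p => f (g p)).
Proof.
  intros Hf Hg x eps He.
  destruct (Hf (g x) eps He) as [d1 [Hd1 H1]].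
  destruct (Hg x d1 Hd1) as [d2 [Hd2 H2]]. eauto.
Qed.

Lemma homeomorphism3_comp (f g : pt -> pt) :
  homeomorphism3 f -> homeomorphism3 g -> homeomorphism3 (fun p => f (g p)).
Proof.
  intros [Hf [f' [Hf' [Hf1 Hf2]]]] [Hg [g' [Hg' [Hg1 Hg2]]]].
  split; [now apply continuous3_comp|].
  exists (fun p => g' (f' p)). split; [now apply continuous3_comp|].
  split; intros.
  - now rewrite Hf1, Hg1.
  - now rewrite Hg2, Hf2.
Qed.

Lemma ambient_isotopic_refl (A : pset) : ambient_isotopic A A.
Proof.
  exists (fun _ p => p). split; [|split; [|split]].
  - intros t x eps Ht He. exists eps. split; [exact He|]. auto.
  - reflexivity.
  - intros t Ht. split; [apply continuous3_id|].
    exists (fun p => p). split; [apply continuous3_id|]. auto.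
  - intros y. split; [intros H; exists y; auto|]. intros [x [H1 H2]]. now subst.
Qed.

Lemma ambient_isotopic_ext (A A' B B' : pset) :
  (forall z, A z <-> A' z) -> (forall z, B z <-> B' z) ->
  ambient_isotopic A B -> ambient_isotopic A' B'.
Proof.
  intros HA HB [H [H1 [H2 [H3 H4]]]]. exists H. repeat split; try assumption.
  - apply H3; assumption.
  - apply H3; assumption.
  - intros Hy. apply HB, H4 in Hy. destruct Hy as [x [Hx E]].
    exists x. split; [now apply HA|exact E].
  - intros [x [Hx E]]. apply HB, H4. exists x. split; [now apply HA|exact E].
Qed.

(* The inverse isotopy is run backwards, [H (1 - t) o (H 1)^-1], so that joint
   continuity of [(t, x) |-> (H t)^-1 x] is never needed. *)
Lemma ambient_isotopic_sym (A B : pset) :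
  ambient_isotopic A B -> ambient_isotopic B A.
Proof.
  intros [H [Hc [H0 [Hh HB]]]].
  assert (H01 : 0 <= 1 <= 1) by lra.
  destruct (Hh 1 H01) as [Hc1 [g [Hg [Hg1 Hg2]]]].
  exists (fun t p => H (1 - t) (g p)). split; [|split; [|split]].
  - intros t x eps Ht He.
    destruct (Hc (1 - t) (g x) eps ltac:(lra) He) as [d [Hd K]].
    destruct (Hg x d Hd) as [d' [Hd' K']].
    exists (Rmin d d'). split; [now apply Rmin_glb_lt|].
    intros s y Hs Hst Hxy. apply K.
    + lra.
    + replace (1 - s - (1 - t)) with (- (s - t)) by ring. rewrite Rabs_Ropp.
      apply Rlt_le_trans with (1 := Hst). apply Rmin_l.
    + apply K'. apply Rlt_le_trans with (1 := Hxy). apply Rmin_r.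
  - intros x. rewrite Rminus_0_r. apply Hg2.
  - intros t Ht. apply (homeomorphism3_comp (H (1 - t)) g).
    + apply Hh; lra.
    + split; [exact Hg|]. exists (H 1). auto.
  - intros y. rewrite Rminus_diag. split.
    + intros Hy. exists (H 1 y). split; [apply HB; eauto|]. now rewrite Hg1, H0.
    + intros [x [Hx E]]. apply HB in Hx. destruct Hx as [w [Hw E']].
      subst x y. now rewrite Hg1, H0.
Qed.

Lemma ambient_isotopic_trans (A B C : pset) :
  ambient_isotopic A B -> ambient_isotopic B C -> ambient_isotopic A C.
Proof.
  intros [H [Hc [H0 [Hh HB]]]] [K [Kc [K0 [Kh KC]]]].
  (* Two clamped clocks: [u] runs during the first half of the time and [v] during the second. Both
     are Lipschitz, so no gluing argument is needed at time 1/2. *)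
  set (u := fun t => Rmin 1 (2 * t)). set (v := fun t => Rmax 0 (2 * t - 1)).
  assert (Hu : forall t, 0 <= t <= 1 -> 0 <= u t <= 1).
  { intros t Ht. unfold u, Rmin. destruct (Rle_dec 1 (2 * t)); lra. }
  assert (Hv : forall t, 0 <= t <= 1 -> 0 <= v t <= 1).
  { intros t Ht. unfold v, Rmax. destruct (Rle_dec 0 (2 * t - 1)); lra. }
  assert (Lu : forall s t, Rabs (u s - u t) <= 2 * Rabs (s - t)).
  { intros s t. unfold u, Rmin, Rabs.
    destruct (Rle_dec 1 (2 * t)), (Rle_dec 1 (2 * s));
      repeat destruct Rcase_abs; lra. }
  assert (Lv : forall s t, Rabs (v s - v t) <= 2 * Rabs (s - t)).
  { intros s t. unfold v, Rmax, Rabs.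
    destruct (Rle_dec 0 (2 * t - 1)), (Rle_dec 0 (2 * s - 1));
      repeat destruct Rcase_abs; lra. }
  exists (fun t p => K (v t) (H (u t) p)). split; [|split; [|split]].
  - intros t x eps Ht He.
    destruct (Kc (v t) (H (u t) x) eps (Hv t Ht) He) as [d1 [Hd1 K1]].
    destruct (Hc (u t) x d1 (Hu t Ht) Hd1) as [d2 [Hd2 K2]].
    exists (Rmin (d1 / 2) (d2 / 2)). split; [apply Rmin_glb_lt; lra|].
    intros s y Hs Hst Hxy.
    pose proof (Rmin_l (d1 / 2) (d2 / 2)). pose proof (Rmin_r (d1 / 2) (d2 / 2)).
    apply K1; [now apply Hv| |apply K2; [now apply Hu| |]].
    + pose proof (Lv s t). lra.
    + pose proof (Lu s t). lra.
    + lra.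
  - intros x. unfold u, v, Rmin, Rmax.
    destruct (Rle_dec 1 (2 * 0)); [lra|]. destruct (Rle_dec 0 (2 * 0 - 1)); [lra|].
    now rewrite Rmult_0_r, H0, K0.
  - intros t Ht. apply (homeomorphism3_comp (K (v t)) (H (u t))); auto.
  - intros y.
    assert (E1 : u 1 = 1) by (unfold u, Rmin; destruct (Rle_dec 1 (2 * 1)); lra).
    assert (E2 : v 1 = 1) by (unfold v, Rmax; destruct (Rle_dec 0 (2 * 1 - 1)); lra).
    rewrite E1, E2. split.
    + intros Hy. apply KC in Hy. destruct Hy as [w [Hw E]].
      apply HB in Hw. destruct Hw as [x [Hx E']]. subst. eauto.
    + intros [x [Hx E]]. apply KC. exists (H 1 x). split; [|exact E].
      apply HB. eauto.
Qed.

(** The conjugated isotopy starts at the identity even if [phi] reverses orientation. So the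
    coordinate swaps turn pushes along z into pushes along y or x. *)
Lemma ambient_isotopic_conj (phi : pt -> pt) (A B : pset) :
  (forall p, phi (phi p) = p) ->
  (forall p q, dist1 (phi p) (phi q) = dist1 p q) ->
  ambient_isotopic A B ->
  ambient_isotopic (fun p => A (phi p)) (fun p => B (phi p)).
Proof.
  intros Hinv Hiso [H [Hc [H0 [Hh HB]]]].
  assert (Cphi : continuous3 phi).
  { apply continuous3_lipschitz with 1. intros. rewrite Hiso. lra. }
  exists (fun t p => phi (H t (phi p))). split; [|split; [|split]].
  - intros t x eps Ht He.
    destruct (Cphi (H t (phi x)) eps He) as [d0 [Hd0 K0]].
    destruct (Hc t (phi x) d0 Ht Hd0) as [d1 [Hd1 K1]].
    destruct (Cphi x d1 Hd1) as [d2 [Hd2 K2]].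
    exists (Rmin d1 d2). split; [now apply Rmin_glb_lt|].
    intros s y Hs Hst Hxy. apply K0, K1; [exact Hs| |apply K2].
    + apply Rlt_le_trans with (1 := Hst). apply Rmin_l.
    + apply Rlt_le_trans with (1 := Hxy). apply Rmin_r.
  - intros x. now rewrite H0, Hinv.
  - intros t Ht.
    assert (Hphi : homeomorphism3 phi).
    { split; [exact Cphi|]. exists phi. auto. }
    apply (homeomorphism3_comp phi (fun p => H t (phi p)) Hphi).
    apply (homeomorphism3_comp (H t) phi); auto.
  - intros y. split.
    + intros Hy. apply HB in Hy. destruct Hy as [x [Hx E]].
      exists (phi x). rewrite Hinv. split; [exact Hx|]. now rewrite E, Hinv.
    + intros [x [Hx E]]. apply HB. exists (phi x). split; [exact Hx|].
      now rewrite <- E, Hinv.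
Qed.

Definition swap_yz (p : pt) : pt := (px p, pz p, py p).
Definition swap_xz (p : pt) : pt := (pz p, py p, px p).

Lemma swap_yz_involutive (p : pt) : swap_yz (swap_yz p) = p.
Proof. now destruct p as [[x y] z]. Qed.

Lemma swap_xz_involutive (p : pt) : swap_xz (swap_xz p) = p.
Proof. now destruct p as [[x y] z]. Qed.

Lemma swap_yz_dist1 (p q : pt) : dist1 (swap_yz p) (swap_yz q) = dist1 p q.
Proof. unfold dist1, swap_yz, px, py, pz; simpl. lra. Qed.

Lemma swap_xz_dist1 (p q : pt) : dist1 (swap_xz p) (swap_xz q) = dist1 p q.
Proof. unfold dist1, swap_xz, px, py, pz; simpl. lra. Qed.

Definition rot (th : R) (p : pt) : pt :=
  (cos th * px p - sin th * py p, sin th * px p + cos th * py p, pz p).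

Lemma rot_inv (th : R) (p : pt) : rot (- th) (rot th p) = p.
Proof.
  destruct p as [[x y] z]. unfold rot, px, py, pz; simpl.
  rewrite cos_neg, sin_neg. pose proof (sin2_cos2 th) as E. unfold Rsqr in E.
  apply pt_ext; unfold px, py, pz; simpl; [| |reflexivity].
  - transitivity ((sin th * sin th + cos th * cos th) * x); [ring|rewrite E; ring].
  - transitivity ((sin th * sin th + cos th * cos th) * y); [ring|rewrite E; ring].
Qed.

Lemma rot_inv' (th : R) (p : pt) : rot th (rot (- th) p) = p.
Proof. rewrite <- (Ropp_involutive th) at 1. apply rot_inv. Qed.

Lemma sin_lipschitz (a b : R) : Rabs (sin a - sin b) <= Rabs (a - b).
Proof.
  assert (H : forall a b, a < b -> Rabs (sin b - sin a) <= b - a).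
  { clear. intros a b Hab.
    destruct (MVT_cor2 sin cos a b Hab) as [c [Hc _]].
    - intros; apply derivable_pt_lim_sin.
    - rewrite Hc, Rabs_mult, (Rabs_right (b - a)) by lra.
      assert (Rabs (cos c) <= 1) by (apply Rabs_le; pose proof (COS_bound c); lra).
      nra. }
  destruct (Rtotal_order a b) as [L|[L|L]].
  - rewrite Rabs_minus_sym, (Rabs_minus_sym a), (Rabs_right (b - a)) by lra. auto.
  - subst. rewrite !Rminus_diag. lra.
  - rewrite (Rabs_right (a - b)) by lra. auto.
Qed.

Lemma cos_lipschitz (a b : R) : Rabs (cos a - cos b) <= Rabs (a - b).
Proof.
  rewrite !cos_sin. replace (a - b) with (PI / 2 + a - (PI / 2 + b)) by ring.
  apply sin_lipschitz.
Qed.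

Lemma rot_lipschitz (th : R) (p q : pt) : dist1 (rot th p) (rot th q) <= 2 * dist1 p q.
Proof.
  unfold dist1, rot, px, py, pz. destruct p as [[x y] z], q as [[x' y'] z']; simpl.
  pose proof (SIN_bound th). pose proof (COS_bound th).
  assert (Hs : Rabs (sin th) <= 1) by (apply Rabs_le; lra).
  assert (Hc : Rabs (cos th) <= 1) by (apply Rabs_le; lra).
  assert (M : forall u v, Rabs u <= 1 -> Rabs (u * v) <= Rabs v).
  { intros u v Hu. rewrite Rabs_mult. pose proof (Rabs_pos v). nra. }
  replace (cos th * x - sin th * y - (cos th * x' - sin th * y'))
    with (cos th * (x - x') + (- (sin th * (y - y')))) by ring.
  replace (sin th * x + cos th * y - (sin th * x' + cos th * y'))
    with (sin th * (x - x') + cos th * (y - y')) by ring.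
  pose proof (Rabs_triang (cos th * (x - x')) (- (sin th * (y - y')))) as T1.
  pose proof (Rabs_triang (sin th * (x - x')) (cos th * (y - y'))) as T2.
  rewrite Rabs_Ropp in T1.
  pose proof (M _ (x - x') Hs). pose proof (M _ (x - x') Hc).
  pose proof (M _ (y - y') Hs). pose proof (M _ (y - y') Hc).
  pose proof (Rabs_pos (z - z')). lra.
Qed.

Lemma rot_angle_lipschitz (s t : R) (p : pt) :
  dist1 (rot s p) (rot t p) <= 2 * (Rabs (px p) + Rabs (py p)) * Rabs (s - t).
Proof.
  unfold dist1, rot, px, py, pz. destruct p as [[x y] z]; simpl.
  replace (cos s * x - sin s * y - (cos t * x - sin t * y))
    with ((cos s - cos t) * x + (- ((sin s - sin t) * y))) by ring.
  replace (sin s * x + cos s * y - (sin t * x + cos t * y))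
    with ((sin s - sin t) * x + (cos s - cos t) * y) by ring.
  rewrite Rminus_diag, Rabs_R0.
  pose proof (Rabs_triang ((cos s - cos t) * x) (- ((sin s - sin t) * y))) as T1.
  pose proof (Rabs_triang ((sin s - sin t) * x) ((cos s - cos t) * y)) as T2.
  rewrite Rabs_Ropp in T1. rewrite !Rabs_mult in T1, T2.
  pose proof (sin_lipschitz s t). pose proof (cos_lipschitz s t).
  pose proof (Rabs_pos x). pose proof (Rabs_pos y). nra.
Qed.

Lemma dist1_triang (p q r : pt) : dist1 p r <= dist1 p q + dist1 q r.
Proof.
  unfold dist1.
  pose proof (Rabs_triang (px p - px q) (px q - px r)).
  pose proof (Rabs_triang (py p - py q) (py q - py r)).
  pose proof (Rabs_triang (pz p - pz q) (pz q - pz r)).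
  replace (px p - px r) with (px p - px q + (px q - px r)) by ring.
  replace (py p - py r) with (py p - py q + (py q - py r)) by ring.
  replace (pz p - pz r) with (pz p - pz q + (pz q - pz r)) by ring. lra.
Qed.

Lemma rot_isotopic (th : R) (A : pset) :
  ambient_isotopic A (fun p => A (rot (- th) p)).
Proof.
  exists (fun t p => rot (t * th) p). split; [|split; [|split]].
  - intros t x eps Ht He.
    (* A rotation moves points at a speed proportional to their distance from the axis, so [del] has
       to depend on [x]; the summand 1 keeps [B] positive. *)
    set (B := 2 * (Rabs (px x) + Rabs (py x)) * Rabs th + 1).
    assert (HB : 0 < B).
    { unfold B. pose proof (Rabs_pos (px x)). pose proof (Rabs_pos (py x)).
      pose proof (Rabs_pos th). nra. }
    exists (Rmin (eps / (2 * B)) (eps / 12)). split.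
    { apply Rmin_glb_lt; [apply Rdiv_lt_0_compat|]; lra. }
    intros s y Hs Hst Hxy.
    apply Rle_lt_trans with (1 := dist3_le_dist1 _ _).
    apply Rle_lt_trans with (1 := dist1_triang _ (rot (s * th) x) _).
    pose proof (rot_angle_lipschitz (t * th) (s * th) x) as E1.
    pose proof (rot_lipschitz (s * th) x y) as E2.
    pose proof (dist1_le_dist3 x y).
    pose proof (Rmin_l (eps / (2 * B)) (eps / 12)).
    pose proof (Rmin_r (eps / (2 * B)) (eps / 12)).
    replace (t * th - s * th) with (- ((s - t) * th)) in E1 by ring.
    rewrite Rabs_Ropp, Rabs_mult in E1.
    assert (Rabs (s - t) * B < eps / 2).
    { apply Rmult_lt_reg_r with (/ B); [now apply Rinv_0_lt_compat|].
      rewrite Rmult_assoc, Rinv_r by lra.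
      replace (eps / 2 * / B) with (eps / (2 * B)) by (field; lra). lra. }
    unfold B in *. pose proof (Rabs_pos (s - t)). nra.
  - intros x. rewrite Rmult_0_l. destruct x as [[x y] z].
    unfold rot, px, py, pz; simpl. rewrite cos_0, sin_0.
    apply pt_ext; unfold px, py, pz; simpl; ring.
  - intros t Ht. split.
    + apply continuous3_lipschitz with 2. apply rot_lipschitz.
    + exists (rot (- (t * th))). split.
      * apply continuous3_lipschitz with 2. apply rot_lipschitz.
      * split; intros; [apply rot_inv|apply rot_inv'].
  - intros y. rewrite Rmult_1_l. split.
    + intros Hy. exists (rot (- th) y). split; [exact Hy|apply rot_inv'].
    + intros [x [Hx E]]. subst y. now rewrite rot_inv.
Qed.


(** * Pushes along a coordinate axis *)

(* The gauge of slopes in [[1/C, C]]: [g (x + u) - g x <= nu C u] for all [u]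
   says that [g] is increasing with slopes between [1/C] and [C]. *)
Definition nu (C w : R) : R := Rmax (w / C) (C * w).

Lemma nu_pos (C w : R) : 1 <= C -> 0 <= w -> nu C w = C * w.
Proof.
  intros HC Hw. unfold nu. apply Rmax_right. unfold Rdiv.
  assert (/ C <= 1) by (rewrite <- Rinv_1; apply Rinv_le_contravar; lra). nra.
Qed.

Lemma nu_neg (C w : R) : 1 <= C -> w <= 0 -> nu C w = w / C.
Proof.
  intros HC Hw. unfold nu. apply Rmax_left. unfold Rdiv.
  assert (/ C <= 1) by (rewrite <- Rinv_1; apply Rinv_le_contravar; lra). nra.
Qed.

Lemma nu_0 (C : R) : nu C 0 = 0.
Proof. unfold nu, Rdiv. rewrite Rmult_0_l, Rmult_0_r. apply Rmax_left. lra. Qed.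

Lemma nu_add (C v w : R) : nu C (v + w) <= nu C v + nu C w.
Proof.
  unfold nu. replace ((v + w) / C) with (v / C + w / C) by (unfold Rdiv; ring).
  rewrite Rmult_plus_distr_l.
  pose proof (Rmax_l (v / C) (C * v)). pose proof (Rmax_r (v / C) (C * v)).
  pose proof (Rmax_l (w / C) (C * w)). pose proof (Rmax_r (w / C) (C * w)).
  apply Rmax_lub; lra.
Qed.

Lemma nu_le_abs (C w : R) : 1 <= C -> nu C w <= C * Rabs w.
Proof.
  intros HC. destruct (Rle_dec 0 w).
  - rewrite nu_pos, Rabs_right by lra. lra.
  - rewrite nu_neg, Rabs_left by lra. unfold Rdiv.
    assert (0 < / C) by (apply Rinv_0_lt_compat; lra). nra.
Qed.

Lemma nu_lipschitz (C v w : R) : 1 <= C -> nu C v <= nu C w + C * Rabs (v - w).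
Proof.
  intros HC. pose proof (nu_add C w (v - w)). pose proof (nu_le_abs C (v - w) HC).
  replace (w + (v - w)) with v in H by ring. lra.
Qed.

Lemma nu_mono (C D w : R) : 1 <= C -> C <= D -> nu C w <= nu D w.
Proof.
  intros HC HD. destruct (Rle_dec 0 w).
  - rewrite !nu_pos by lra. nra.
  - rewrite !nu_neg by lra. unfold Rdiv.
    assert (/ D <= / C) by (apply Rinv_le_contravar; lra). nra.
Qed.

Lemma nu_1 (w : R) : nu 1 w = w.
Proof. unfold nu. replace (w / 1) with (1 * w) by field. rewrite Rmax_left; lra. Qed.

(* McShane extension; the gauge [N] need not be symmetric. *)
Lemma gauge_extension (P I : Type) (N : P -> P -> R) (D : I -> Prop) (i0 : I)
  (a : I -> P) (v : I -> R) :
  (forall p, N p p = 0) -> (forall p q r, N p r <= N p q + N q r) -> D i0 ->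
  (forall i j, D i -> D j -> v i - v j <= N (a i) (a j)) ->
  exists psi : P -> R,
    (forall p q, psi p - psi q <= N p q) /\ (forall i, D i -> psi (a i) = v i).
Proof.
  intros N0 Nt Hi0 Hv.
  (* The extension is the infimum over [i] of [v i + N p (a i)]. It is taken as minus a supremum,
     the form in which completeness is available. *)
  set (E := fun p r => exists i, D i /\ r = - (v i + N p (a i))).
  assert (HE : forall p, {m | is_lub (E p) m}).
  { intros p. apply completeness.
    - exists (N (a i0) p - v i0). intros r [i [Hi ->]].
      pose proof (Hv i0 i Hi0 Hi). pose proof (Nt (a i0) p (a i)). lra.
    - exists (- (v i0 + N p (a i0))), i0. auto. }
  exists (fun p => - proj1_sig (HE p)). split.
  - intros p q. destruct (HE p) as [m [Hm1 Hm2]], (HE q) as [n [Hn1 Hn2]]; simpl.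
    assert (n <= m + N p q); [|lra]. apply Hn2. intros r [i [Hi ->]].
    assert (- (v i + N p (a i)) <= m) by (apply Hm1; exists i; auto).
    pose proof (Nt p q (a i)). lra.
  - intros i Hi. destruct (HE (a i)) as [m [Hm1 Hm2]]; simpl.
    apply Rle_antisym.
    + assert (- (v i + N (a i) (a i)) <= m) by (apply Hm1; exists i; auto).
      rewrite N0 in H. lra.
    + assert (m <= - v i); [|lra]. apply Hm2. intros r [j [Hj ->]].
      pose proof (Hv i j Hi Hj). lra.
Qed.

(** Slopes in [[1/C, C]] invert to slopes in the same interval. The lower bound makes [f] unbounded
    on both sides, and continuity then gives surjectivity. The sigma type allows the inverse to be
    formed on all vertical lines at once. *)
Lemma increasing_inverse (f : R -> R) (C : R) :
  1 <= C -> (forall x y, f x - f y <= nu C (x - y)) ->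
  {g : R -> R | (forall x, g (f x) = x) /\ (forall y, f (g y) = y) /\
    (forall x y, g x - g y <= nu C (x - y))}.
Proof.
  intros HC Hf.
  assert (Hlow : forall x y, y <= x -> (x - y) / C <= f x - f y).
  { intros x y H. pose proof (Hf y x). rewrite nu_neg in H0 by lra.
    replace ((x - y) / C) with (- ((y - x) / C)) by (unfold Rdiv; ring). lra. }
  assert (Hup : forall x y, y <= x -> f x - f y <= C * (x - y)).
  { intros x y H. pose proof (Hf x y). rewrite nu_pos in H0 by lra. lra. }
  assert (Hc : continuity f).
  { intros x e He. exists (e / (C + 1)). split; [apply Rdiv_lt_0_compat; lra|].
    intros y [_ Hy]. simpl in *. unfold Rdist in *.
    assert (K : Rabs (f y - f x) <= C * Rabs (y - x)).
    { destruct (Rle_dec x y).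
      - pose proof (Hup y x r). pose proof (Hlow y x r).
        assert (0 <= (y - x) / C).
        { apply Rmult_le_pos; [lra|]. left; apply Rinv_0_lt_compat; lra. }
        rewrite !Rabs_right by lra. lra.
      - pose proof (Hup x y ltac:(lra)). pose proof (Hlow x y ltac:(lra)).
        assert (0 <= (x - y) / C).
        { apply Rmult_le_pos; [lra|]. left; apply Rinv_0_lt_compat; lra. }
        rewrite Rabs_minus_sym, (Rabs_minus_sym y), !Rabs_right by lra. lra. }
    apply Rle_lt_trans with (1 := K).
    assert (Rabs (y - x) * (C + 1) < e).
    { apply Rmult_lt_reg_r with (/ (C + 1)); [apply Rinv_0_lt_compat; lra|].
      rewrite Rmult_assoc, Rinv_r by lra. unfold Rdiv in Hy. lra. }
    pose proof (Rabs_pos (y - x)). nra. }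
  assert (Hs : forall y, {x | f x = y}).
  (* Over a distance [B] a slope of at least [1/C] produces a change of at least [B / C], which
     exceeds the distance from [f 0] to [y] by 1; so [f - y] changes sign on [[-B, B]]. *)
  { intros y. set (B := C * (Rabs (y - f 0) + 1)).
    assert (HB : Rabs (y - f 0) + 1 <= B).
    { unfold B. pose proof (Rabs_pos (y - f 0)). nra. }
    pose proof (Rabs_pos (y - f 0)).
    pose proof (Rle_abs (y - f 0)). pose proof (Rle_abs (- (y - f 0))) as Hneg. rewrite Rabs_Ropp in Hneg.
    destruct (IVT (fun x => f x - y) (- B) B) as [x [_ Hx]].
    - intros x. apply continuity_pt_minus; [apply Hc|].
      apply continuity_pt_const. intros ? ?; reflexivity.
    - lra.
    - pose proof (Hlow 0 (- B) ltac:(lra)) as K.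
      replace ((0 - - B) / C) with (Rabs (y - f 0) + 1) in K by (unfold B; field; lra).
      lra.
    - pose proof (Hlow B 0 ltac:(lra)) as K.
      replace ((B - 0) / C) with (Rabs (y - f 0) + 1) in K by (unfold B; field; lra).
      lra.
    - exists x. lra. }
  exists (fun y => proj1_sig (Hs y)).
  assert (Hinj : forall x y, f x = f y -> x = y).
  { intros x y E. apply Rle_antisym; apply Rnot_lt_le; intros L.
    - pose proof (Hlow x y ltac:(lra)).
      assert (0 < (x - y) / C) by (apply Rdiv_lt_0_compat; lra). lra.
    - pose proof (Hlow y x ltac:(lra)).
      assert (0 < (y - x) / C) by (apply Rdiv_lt_0_compat; lra). lra. }
  split; [|split].
  - intros x. destruct (Hs (f x)) as [x' Hx']; simpl. auto.
  - intros y. destruct (Hs y) as [x Hx]; simpl. exact Hx.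
  - intros x y. destruct (Hs x) as [x' <-], (Hs y) as [y' <-]; simpl.
    assert (0 < C) by lra.
    destruct (Rle_dec y' x').
    + pose proof (Hlow _ _ r).
      assert (0 <= (x' - y') / C).
      { apply Rmult_le_pos; [lra|]. left; apply Rinv_0_lt_compat; lra. }
      rewrite nu_pos by lra.
      replace (x' - y') with (C * ((x' - y') / C)) by (field; lra). nra.
    + pose proof (Hup y' x' ltac:(lra)). pose proof (Hlow y' x' ltac:(lra)).
      assert (0 <= (y' - x') / C).
      { apply Rmult_le_pos; [lra|]. left; apply Rinv_0_lt_compat; lra. }
      rewrite nu_neg by lra.
      apply Rmult_le_reg_l with C; [lra|].
      replace (C * ((f x' - f y') / C)) with (f x' - f y') by (field; lra). lra.
Qed.

Definition set_z (p : pt) (z : R) : pt := (px p, py p, z).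

Lemma dist1_set_z (p q : pt) (z w : R) :
  dist1 (set_z p z) (set_z q w) =
  Rabs (px p - px q) + Rabs (py p - py q) + Rabs (z - w).
Proof. reflexivity. Qed.

(** Every vertical line is mapped to itself and inverted separately. The inverse is Lipschitz across
    the lines as well: changing the line alters [G] by at most [C] times the distance, and inverting
    on a fixed line costs another factor [C]. *)
Lemma set_z_homeomorphism (G : pt -> R) (C : R) :
  1 <= C ->
  (forall p q, Rabs (G p - G q) <= C * dist1 p q) ->
  (forall p z z', G (set_z p z) - G (set_z p z') <= nu C (z - z')) ->
  homeomorphism3 (fun p => set_z p (G p)).
Proof.
  intros HC HG Hm.
  split.
  - apply continuous3_lipschitz with (C + 1). intros p q.
    rewrite dist1_set_z. pose proof (HG p q). unfold dist1 in *. pose proof (Rabs_pos (pz p - pz q)). lra.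
  - set (inv := fun xy : R * R => increasing_inverse (fun z => G (fst xy, snd xy, z)) C HC
      (fun z z' => Hm (fst xy, snd xy, 0) z z')).
    set (g := fun xy => proj1_sig (inv xy)).
    assert (Hg : forall xy, (forall z, g xy (G (fst xy, snd xy, z)) = z) /\
        (forall w, G (fst xy, snd xy, g xy w) = w) /\
        (forall w w', g xy w - g xy w' <= nu C (w - w'))).
    { intros xy. exact (proj2_sig (inv xy)). }
    clearbody g. clear inv.
    exists (fun p => set_z p (g (px p, py p) (pz p))). split; [|split].
    + apply continuous3_lipschitz with (C + 1 + C * C). intros p q.
      destruct p as [[x y] w], q as [[x' y'] w'].
      destruct (Hg (x, y)) as [_ [H2 H3]]. destruct (Hg (x', y')) as [_ [H2' _]].
      unfold dist1, set_z, px, py, pz; simpl in *.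
      specialize (H2 w). specialize (H2' w').
      set (u := g (x, y) w) in *. set (u' := g (x', y') w') in *.
      (* The second preimage is read on the line over [(x, y)], so that both points can be compared
         by the inverse on a single line. *)
      assert (E : u' = g (x, y) (G (x, y, u'))).
      { symmetry. apply (Hg (x, y)). }
      assert (L : Rabs (u - u') <= C * Rabs (w - G (x, y, u'))).
      { pose proof (H3 w (G (x, y, u'))). pose proof (H3 (G (x, y, u')) w).
        rewrite <- E in *. fold u in H. fold u in H0.
        pose proof (nu_le_abs C (w - G (x, y, u')) HC).
        pose proof (nu_le_abs C (G (x, y, u') - w) HC).
        rewrite (Rabs_minus_sym (G (x, y, u'))) in H4.
        apply Rabs_le. lra. }
      pose proof (HG (x', y', u') (x, y, u')) as K. rewrite H2' in K.
      unfold dist1, px, py, pz in K; simpl in K. rewrite Rminus_diag, Rabs_R0 in K.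
      pose proof (Rabs_triang (w - w') (w' - G (x, y, u'))) as T.
      replace (w - w' + (w' - G (x, y, u'))) with (w - G (x, y, u')) in T by ring.
      rewrite (Rabs_minus_sym x'), (Rabs_minus_sym y') in K.
      pose proof (Rabs_pos (x - x')). pose proof (Rabs_pos (y - y')).
      pose proof (Rabs_pos (w - w')).
      assert (C * Rabs (w - G (x, y, u')) <=
              C * (Rabs (w - w') + C * (Rabs (x - x') + Rabs (y - y') + 0))).
      { apply Rmult_le_compat_l; lra. }
      nra.
    + intros [[x y] z]. unfold set_z, px, py, pz; simpl.
      destruct (Hg (x, y)) as [H1 _]. simpl in H1. now rewrite H1.
    + intros [[x y] z]. unfold set_z, px, py, pz; simpl.
      destruct (Hg (x, y)) as [_ [H1 _]]. simpl in H1. now rewrite H1.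
Qed.

(** The gauge inequality is required on the given set only. Where [f i = f j], read in both
    directions, it forces [v i = v j], so the new heights are a function on the set. The old heights
    satisfy the gauge too, and gauge inequalities are convex, so every stage of the interpolation is
    a homeomorphism. *)
Lemma push_z (I : Type) (D : I -> Prop) (f : I -> pt) (v : I -> R) (C : R) :
  1 <= C ->
  (forall i j, D i -> D j ->
     v i - v j <= C * (Rabs (px (f i) - px (f j)) + Rabs (py (f i) - py (f j)))
                  + nu C (pz (f i) - pz (f j))) ->
  ambient_isotopic (fun p => exists i, D i /\ p = f i)
                   (fun p => exists i, D i /\ p = set_z (f i) (v i)).
Proof.
  intros HC Hv.
  destruct (classic (exists i, D i)) as [[i0 Hi0]|Hno].
  2:{ apply ambient_isotopic_ext with (A := fun _ => False) (B := fun _ => False).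
      - intros z; split; [tauto|intros [i [Hi _]]; eauto].
      - intros z; split; [tauto|intros [i [Hi _]]; eauto].
      - apply ambient_isotopic_refl. }
  destruct (gauge_extension pt I
    (fun p q => C * (Rabs (px p - px q) + Rabs (py p - py q)) + nu C (pz p - pz q))
    D i0 f v) as [psi [Hpsi Hext]]; auto.
  { intros p. rewrite !Rminus_diag, Rabs_R0, nu_0. lra. }
  { intros p q r.
    pose proof (Rabs_triang (px p - px q) (px q - px r)).
    pose proof (Rabs_triang (py p - py q) (py q - py r)).
    pose proof (nu_add C (pz p - pz q) (pz q - pz r)).
    replace (px p - px r) with (px p - px q + (px q - px r)) by ring.
    replace (py p - py r) with (py p - py q + (py q - py r)) by ring.
    replace (pz p - pz r) with (pz p - pz q + (pz q - pz r)) by ring. nra. }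
  assert (Lpsi : forall p q, Rabs (psi p - psi q) <= C * dist1 p q).
  { assert (K : forall p q, psi p - psi q <= C * dist1 p q).
    { intros p q. pose proof (Hpsi p q). pose proof (nu_le_abs C (pz p - pz q) HC).
      unfold dist1. lra. }
    intros p q. apply Rabs_le. pose proof (K p q). pose proof (K q p).
    replace (dist1 q p) with (dist1 p q) in H0; [lra|].
    unfold dist1. now rewrite (Rabs_minus_sym (px p)), (Rabs_minus_sym (py p)),
      (Rabs_minus_sym (pz p)). }
  exists (fun t p => set_z p ((1 - t) * pz p + t * psi p)). split; [|split; [|split]].
  - intros t x eps Ht He.
    set (B := C + 2 + Rabs (psi x - pz x)).
    assert (HB : 2 <= B) by (unfold B; pose proof (Rabs_pos (psi x - pz x)); lra).
    exists (eps / (6 * B)). split; [apply Rdiv_lt_0_compat; lra|].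
    intros s y Hs Hst Hxy.
    apply Rle_lt_trans with (1 := dist3_le_dist1 _ _).
    pose proof (dist1_le_dist3 x y). pose proof (dist1_pos x y).
    pose proof (Lpsi x y) as Lp.
    assert (Hd : dist1 x y < eps / (2 * B)).
    { replace (eps / (2 * B)) with (3 * (eps / (6 * B))) by (field; lra). lra. }
    rewrite dist1_set_z.
    replace ((1 - t) * pz x + t * psi x - ((1 - s) * pz y + s * psi y))
      with ((1 - s) * (pz x - pz y) + s * (psi x - psi y) + - ((s - t) * (psi x - pz x)))
      by ring.
    pose proof (Rabs_triang ((1 - s) * (pz x - pz y) + s * (psi x - psi y))
                  (- ((s - t) * (psi x - pz x)))) as T1.
    pose proof (Rabs_triang ((1 - s) * (pz x - pz y)) (s * (psi x - psi y))) as T2.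
    rewrite Rabs_Ropp in T1. rewrite Rabs_mult in T1. rewrite !Rabs_mult in T2.
    rewrite (Rabs_right s), (Rabs_right (1 - s)) in T2 by lra.
    assert (Hpz : Rabs (pz x - pz y) <= dist1 x y).
    { unfold dist1. pose proof (Rabs_pos (px x - px y)).
      pose proof (Rabs_pos (py x - py y)). lra. }
    assert (Hpxy : Rabs (px x - px y) + Rabs (py x - py y) <= dist1 x y).
    { unfold dist1. pose proof (Rabs_pos (pz x - pz y)). lra. }
    pose proof (Rabs_pos (pz x - pz y)). pose proof (Rabs_pos (psi x - psi y)).
    pose proof (Rabs_pos (psi x - pz x)). pose proof (Rabs_pos (s - t)).
    assert (A1 : (1 - s) * Rabs (pz x - pz y) <= dist1 x y) by nra.
    assert (A2 : s * Rabs (psi x - psi y) <= C * dist1 x y) by nra.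
    assert (A3 : Rabs (s - t) * Rabs (psi x - pz x) <= eps / (6 * B) * Rabs (psi x - pz x)) by nra.
    assert (A4 : dist1 x y * (2 * B) < eps).
    { apply Rmult_lt_reg_r with (/ (2 * B)); [apply Rinv_0_lt_compat; lra|].
      rewrite Rmult_assoc, Rinv_r by lra. unfold Rdiv in Hd. lra. }
    assert (A5 : eps / (6 * B) * Rabs (psi x - pz x) <= eps / 6).
    { replace (eps / 6) with (eps / (6 * B) * B) by (field; lra).
      apply Rmult_le_compat_l; [left; apply Rdiv_lt_0_compat; lra|]. unfold B. lra. }
    assert (A6 : (C + 2) * dist1 x y <= B * dist1 x y).
    { apply Rmult_le_compat_r; [lra|]. unfold B. lra. }
    nra.
  - intros p. destruct p as [[x y] z]. unfold set_z, px, py, pz; simpl. f_equal. ring.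
  - intros t Ht. apply set_z_homeomorphism with C; [exact HC| |].
    + intros p q.
      replace ((1 - t) * pz p + t * psi p - ((1 - t) * pz q + t * psi q))
        with ((1 - t) * (pz p - pz q) + t * (psi p - psi q)) by ring.
      pose proof (Rabs_triang ((1 - t) * (pz p - pz q)) (t * (psi p - psi q))) as T.
      rewrite !Rabs_mult, (Rabs_right t), (Rabs_right (1 - t)) in T by lra.
      assert (Hpz : Rabs (pz p - pz q) <= C * dist1 p q).
      { pose proof (dist1_pos p q). assert (Rabs (pz p - pz q) <= dist1 p q); [|nra].
        unfold dist1. pose proof (Rabs_pos (px p - px q)).
        pose proof (Rabs_pos (py p - py q)). lra. }
      pose proof (Lpsi p q). nra.
    + intros p z z'. pose proof (Hpsi (set_z p z) (set_z p z')) as K.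
      unfold set_z, px, py, pz in *; simpl in *.
      rewrite !Rminus_diag, Rabs_R0 in K.
      assert (z - z' <= nu C (z - z')).
      { rewrite <- (nu_1 (z - z')) at 1. apply nu_mono; lra. }
      nra.
  - intros y. split.
    + intros [i [Hi ->]]. exists (f i). split; [eauto|]. rewrite Hext by exact Hi.
      unfold set_z. f_equal. ring.
    + intros [x [[i [Hi ->]] <-]]. exists i. split; [exact Hi|].
      rewrite Hext by exact Hi. unfold set_z. f_equal. ring.
Qed.

Lemma push_y (I : Type) (D : I -> Prop) (f : I -> pt) (v : I -> R) (C : R) :
  1 <= C ->
  (forall i j, D i -> D j ->
     v i - v j <= C * (Rabs (px (f i) - px (f j)) + Rabs (pz (f i) - pz (f j)))
                  + nu C (py (f i) - py (f j))) ->
  ambient_isotopic (fun p => exists i, D i /\ p = f i)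
                   (fun p => exists i, D i /\ p = (px (f i), v i, pz (f i))).
Proof.
  intros HC Hv.
  pose proof (ambient_isotopic_conj swap_yz _ _ swap_yz_involutive swap_yz_dist1
    (push_z I D (fun i => swap_yz (f i)) v C HC Hv)) as K.
  refine (ambient_isotopic_ext _ _ _ _ _ _ K); intros z; split;
    intros [i [Hi E]]; exists i; (split; [exact Hi|]).
  - rewrite <- (swap_yz_involutive z), E. apply swap_yz_involutive.
  - now rewrite E.
  - rewrite <- (swap_yz_involutive z), E. reflexivity.
  - rewrite E. reflexivity.
Qed.

Lemma push_x (I : Type) (D : I -> Prop) (f : I -> pt) (v : I -> R) (C : R) :
  1 <= C ->
  (forall i j, D i -> D j ->
     v i - v j <= C * (Rabs (pz (f i) - pz (f j)) + Rabs (py (f i) - py (f j)))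
                  + nu C (px (f i) - px (f j))) ->
  ambient_isotopic (fun p => exists i, D i /\ p = f i)
                   (fun p => exists i, D i /\ p = (v i, py (f i), pz (f i))).
Proof.
  intros HC Hv.
  pose proof (ambient_isotopic_conj swap_xz _ _ swap_xz_involutive swap_xz_dist1
    (push_z I D (fun i => swap_xz (f i)) v C HC Hv)) as K.
  refine (ambient_isotopic_ext _ _ _ _ _ _ K); intros z; split;
    intros [i [Hi E]]; exists i; (split; [exact Hi|]).
  - rewrite <- (swap_xz_involutive z), E. apply swap_xz_involutive.
  - now rewrite E.
  - rewrite <- (swap_xz_involutive z), E. reflexivity.
  - rewrite E. reflexivity.
Qed.


(** * Lifts of plane graphs *)

Lemma Rabs_le_bounds (x a : R) : Rabs x <= a -> - a <= x <= a.
Proof.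
  intros H. pose proof (Rle_abs x). pose proof (Rle_abs (- x)).
  rewrite Rabs_Ropp in *. lra.
Qed.

Definition lip_on (a b : R) (f : R -> R) : Prop :=
  exists L, 0 <= L /\ forall x y, a <= x <= b -> a <= y <= b ->
    Rabs (f x - f y) <= L * Rabs (x - y).

Lemma lip_on_ext (a b : R) (f g : R -> R) :
  (forall x, a <= x <= b -> f x = g x) -> lip_on a b f -> lip_on a b g.
Proof.
  intros E [L [HL H]]. exists L. split; [exact HL|]. intros.
  rewrite <- !E by assumption. auto.
Qed.

Lemma lip_on_const (a b c : R) : lip_on a b (fun _ => c).
Proof. exists 0. split; [lra|]. intros. rewrite Rminus_diag, Rabs_R0. lra. Qed.

Lemma lip_on_id (a b : R) : lip_on a b (fun x => x).
Proof. exists 1. split; [lra|]. intros. lra. Qed.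

Lemma lip_on_plus (a b : R) (f g : R -> R) :
  lip_on a b f -> lip_on a b g -> lip_on a b (fun x => f x + g x).
Proof.
  intros [L [HL H]] [M [HM K]]. exists (L + M). split; [lra|]. intros x y Hx Hy.
  replace (f x + g x - (f y + g y)) with (f x - f y + (g x - g y)) by ring.
  apply Rle_trans with (1 := Rabs_triang _ _).
  pose proof (H x y Hx Hy). pose proof (K x y Hx Hy). lra.
Qed.

Lemma lip_on_bounded (a b : R) (f : R -> R) :
  lip_on a b f -> exists B, 0 <= B /\ forall x, a <= x <= b -> Rabs (f x) <= B.
Proof.
  intros [L [HL H]].
  exists (Rabs (f a) + L * Rabs (b - a)). split.
  { pose proof (Rabs_pos (f a)). pose proof (Rabs_pos (b - a)). nra. }
  intros x Hx. pose proof (H x a Hx ltac:(lra)) as K.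
  pose proof (Rabs_triang (f x - f a) (f a)) as T.
  replace (f x - f a + f a) with (f x) in T by ring.
  assert (Rabs (x - a) <= Rabs (b - a)) by (rewrite !Rabs_right; lra).
  nra.
Qed.

Lemma lip_on_mult (a b : R) (f g : R -> R) :
  lip_on a b f -> lip_on a b g -> lip_on a b (fun x => f x * g x).
Proof.
  intros Hf Hg.
  destruct (lip_on_bounded _ _ _ Hf) as [B [HB Bf]].
  destruct (lip_on_bounded _ _ _ Hg) as [B' [HB' Bg]].
  destruct Hf as [L [HL H]], Hg as [M [HM K]].
  exists (L * B' + B * M). split; [nra|]. intros x y Hx Hy.
  replace (f x * g x - f y * g y) with ((f x - f y) * g x + f y * (g x - g y)) by ring.
  apply Rle_trans with (1 := Rabs_triang _ _). rewrite !Rabs_mult.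
  pose proof (H x y Hx Hy). pose proof (K x y Hx Hy).
  pose proof (Bg x Hx). pose proof (Bf y Hy).
  pose proof (Rabs_pos (f x - f y)). pose proof (Rabs_pos (g x - g y)).
  pose proof (Rabs_pos (g x)). pose proof (Rabs_pos (f y)). pose proof (Rabs_pos (x - y)).
  assert (Rabs (f x - f y) * Rabs (g x) <= (L * Rabs (x - y)) * B').
  { apply Rmult_le_compat; assumption. }
  assert (Rabs (f y) * Rabs (g x - g y) <= B * (M * Rabs (x - y))).
  { apply Rmult_le_compat; assumption. }
  lra.
Qed.

Lemma lip_on_minus (a b : R) (f g : R -> R) :
  lip_on a b f -> lip_on a b g -> lip_on a b (fun x => f x - g x).
Proof.
  intros Hf Hg. apply lip_on_ext with (f := fun x => f x + (-1) * g x); [intros; ring|].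
  apply lip_on_plus; [exact Hf|]. apply lip_on_mult; [apply lip_on_const|exact Hg].
Qed.

Lemma lip_on_inv (a b k : R) (f : R -> R) :
  0 < k -> (forall x, a <= x <= b -> k <= f x) -> lip_on a b f ->
  lip_on a b (fun x => / f x).
Proof.
  intros Hk Hf [L [HL H]]. exists (L / (k * k)). split.
  { apply Rmult_le_pos; [exact HL|]. left. apply Rinv_0_lt_compat. nra. }
  intros x y Hx Hy. pose proof (Hf x Hx). pose proof (Hf y Hy).
  replace (/ f x - / f y) with ((f y - f x) * (/ f x * / f y)) by (field; lra).
  rewrite Rabs_mult, (Rabs_right (/ f x * / f y)).
  2:{ apply Rle_ge. apply Rmult_le_pos; left; apply Rinv_0_lt_compat; lra. }
  rewrite Rabs_minus_sym. pose proof (H x y Hx Hy).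
  assert (/ f x * / f y <= / k * / k).
  { apply Rmult_le_compat; try (left; apply Rinv_0_lt_compat; lra);
      apply Rinv_le_contravar; lra. }
  assert (0 <= / f x * / f y).
  { apply Rmult_le_pos; left; apply Rinv_0_lt_compat; lra. }
  replace (L / (k * k) * Rabs (x - y)) with (L * Rabs (x - y) * (/ k * / k)) by (field; lra).
  apply Rmult_le_compat; auto using Rabs_pos.
Qed.

Lemma lip_on_min (a b : R) (f g : R -> R) :
  lip_on a b f -> lip_on a b g -> lip_on a b (fun x => Rmin (f x) (g x)).
Proof.
  intros [L [HL H]] [M [HM K]]. exists (L + M). split; [lra|]. intros x y Hx Hy.
  pose proof (H x y Hx Hy) as H1. pose proof (K x y Hx Hy) as K1.
  pose proof (Rabs_pos (x - y)).
  assert (0 <= L * Rabs (x - y)) by nra. assert (0 <= M * Rabs (x - y)) by nra.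
  apply Rabs_le_bounds in H1. apply Rabs_le_bounds in K1.
  rewrite Rmult_plus_distr_r. apply Rabs_le.
  unfold Rmin. destruct (Rle_dec (f x) (g x)), (Rle_dec (f y) (g y)); lra.
Qed.

Lemma lip_on_max (a b : R) (f g : R -> R) :
  lip_on a b f -> lip_on a b g -> lip_on a b (fun x => Rmax (f x) (g x)).
Proof.
  intros [L [HL H]] [M [HM K]]. exists (L + M). split; [lra|]. intros x y Hx Hy.
  pose proof (H x y Hx Hy) as H1. pose proof (K x y Hx Hy) as K1.
  pose proof (Rabs_pos (x - y)).
  assert (0 <= L * Rabs (x - y)) by nra. assert (0 <= M * Rabs (x - y)) by nra.
  apply Rabs_le_bounds in H1. apply Rabs_le_bounds in K1.
  rewrite Rmult_plus_distr_r. apply Rabs_le.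
  unfold Rmax. destruct (Rle_dec (f x) (g x)), (Rle_dec (f y) (g y)); lra.
Qed.

Lemma lip_on_comp (a b a' b' : R) (f g : R -> R) :
  (forall x, a <= x <= b -> a' <= g x <= b') ->
  lip_on a' b' f -> lip_on a b g -> lip_on a b (fun x => f (g x)).
Proof.
  intros Hr [L [HL H]] [M [HM K]]. exists (L * M). split; [nra|]. intros x y Hx Hy.
  apply Rle_trans with (1 := H _ _ (Hr x Hx) (Hr y Hy)).
  rewrite Rmult_assoc. apply Rmult_le_compat_l; auto.
Qed.

Lemma finite_upper (I : Type) (l : list I) (Q : I -> R -> Prop) (C0 : R) :
  (forall i C D, Q i C -> C <= D -> Q i D) ->
  (forall i, In i l -> exists C, Q i C) ->
  exists C, C0 <= C /\ forall i, In i l -> Q i C.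
Proof.
  intros Hm. induction l as [|i l IH]; intros H.
  - exists C0. split; [lra|]. intros i [].
  - destruct IH as [C [HC K]]; [intros; apply H; now right|].
    destruct (H i (or_introl eq_refl)) as [C' HC'].
    exists (Rmax C C'). pose proof (Rmax_l C C'). pose proof (Rmax_r C C').
    split; [lra|]. intros j [<-|Hj]; eauto.
Qed.

Lemma finite_lower (I : Type) (l : list I) (Q : I -> R -> Prop) (e0 : R) :
  0 < e0 ->
  (forall i, In i l -> exists e, 0 < e /\ forall e', 0 < e' <= e -> Q i e') ->
  exists e, 0 < e <= e0 /\ forall i e', In i l -> 0 < e' <= e -> Q i e'.
Proof.
  intros He0. induction l as [|i l IH]; intros H.
  - exists e0. split; [lra|]. intros i e' [].
  - destruct IH as [e [He K]]; [intros; apply H; now right|].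
    destruct (H i (or_introl eq_refl)) as [d [Hd K']].
    exists (Rmin e d). pose proof (Rmin_l e d). pose proof (Rmin_r e d).
    split; [split; [apply Rmin_glb_lt; lra|lra]|].
    intros j e' [<-|Hj] He'; [apply K'|apply K; auto]; lra.
Qed.

Definition gset {I : Type} (l : list I) (a b : I -> R) (Y Z : I -> R -> R) : pset :=
  fun p => exists i x, In i l /\ a i <= x <= b i /\ p = (x, Y i x, Z i x).

(* Over a common abscissa, the graphs [W i] and [W j] may be deformed into
   [W' i] and [W' j]: they keep their order wherever [P i] and [P j] meet. *)
Definition pair_ok {I : Type} (a b : I -> R) (P W W' : I -> R -> R) (i j : I) : Prop :=
  exists C, 1 <= C /\ forall q, a i <= q <= b i -> a j <= q <= b j ->
    W' i q - W' j q <= C * Rabs (P i q - P j q) + nu C (W i q - W j q).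

(** Supplies a common abscissa at which two points of different graphs can be compared, at a cost
    bounded by the distance of their own abscissas. *)
Lemma clamp_between (a b a' b' x x' : R) :
  a <= b' -> a' <= b -> a <= x <= b -> a' <= x' <= b' ->
  exists q, a <= q <= b /\ a' <= q <= b' /\
    Rabs (x - q) <= Rabs (x - x') /\ Rabs (q - x') <= Rabs (x - x').
Proof.
  intros H1 H2 Hx Hx'. destruct (Rle_dec x x').
  - exists (Rmax x a'). unfold Rmax, Rabs.
    destruct (Rle_dec x a'); repeat destruct Rcase_abs; lra.
  - exists (Rmax x' a). unfold Rmax, Rabs.
    destruct (Rle_dec x' a); repeat destruct Rcase_abs; lra.
Qed.

Lemma disjoint_gauge (a b a' b' g : R) (P W W' P2 W2 W2' : R -> R) :
  0 < g -> (forall x x', a <= x <= b -> a' <= x' <= b' -> g <= Rabs (x - x')) ->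
  lip_on a b W -> lip_on a b W' -> lip_on a' b' W2 -> lip_on a' b' W2' ->
  exists C, 1 <= C /\ forall x x', a <= x <= b -> a' <= x' <= b' ->
    W' x - W2' x' <= C * (Rabs (x - x') + Rabs (P x - P2 x')) + nu C (W x - W2 x').
Proof.
  intros Hgap Hsep LW LW' MW MW'.
  destruct (lip_on_bounded _ _ _ LW) as [B1 [? B1W]].
  destruct (lip_on_bounded _ _ _ MW) as [B2 [? B2W]].
  destruct (lip_on_bounded _ _ _ LW') as [B3 [? B3W]].
  destruct (lip_on_bounded _ _ _ MW') as [B4 [? B4W]].
  set (S := B1 + B2 + B3 + B4). set (K := 1 + S / (g)).
  assert (0 <= S / (g)).
  { apply Rmult_le_pos; [unfold S; lra|]. left; apply Rinv_0_lt_compat; lra. }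
  exists K. split; [unfold K; lra|]. intros x x' Hx Hx'.
  pose proof (Hsep x x' Hx Hx').
  assert (S <= K * Rabs (x - x')).
  { apply Rle_trans with (K * (g)).
    - unfold K. rewrite Rmult_plus_distr_r.
      replace (S / (g) * (g)) with S by (field; lra). lra.
    - apply Rmult_le_compat_l; [unfold K|]; lra. }
  assert (- (B1 + B2) <= nu K (W x - W2 x')).
  { pose proof (B1W x Hx) as U. pose proof (B2W x' Hx') as V.
    apply Rabs_le_bounds in U. apply Rabs_le_bounds in V.
    pose proof (nu_mono 1 K (W x - W2 x') ltac:(lra) ltac:(unfold K; lra)) as T.
    rewrite nu_1 in T. lra. }
  pose proof (B3W x Hx) as U. pose proof (B4W x' Hx') as V.
  apply Rabs_le_bounds in U. apply Rabs_le_bounds in V.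
  pose proof (Rabs_pos (P x - P2 x')).
  assert (0 <= K * Rabs (P x - P2 x')).
  { apply Rmult_le_pos; [unfold K|]; lra. }
  unfold S in *. lra.
Qed.

(** If the intervals meet, shifting both points to a common abscissa changes every quantity by at
    most a Lipschitz constant times the distance of the abscissas, which the passive term absorbs.
    If they are disjoint, that distance has a positive lower bound and absorbs everything bounded.
    Hence the order of graphs need only be examined over common abscissas. *)
Lemma pair_gauge (I : Type) (a b : I -> R) (P W W' : I -> R -> R) (i j : I) :
  lip_on (a i) (b i) (P i) -> lip_on (a i) (b i) (W i) -> lip_on (a i) (b i) (W' i) ->
  lip_on (a j) (b j) (P j) -> lip_on (a j) (b j) (W j) -> lip_on (a j) (b j) (W' j) ->
  pair_ok a b P W W' i j ->
  exists C, 1 <= C /\ forall x x', a i <= x <= b i -> a j <= x' <= b j ->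
    W' i x - W' j x' <=
      C * (Rabs (x - x') + Rabs (P i x - P j x')) + nu C (W i x - W j x').
Proof.
  intros LP LW LW' MP MW MW' [C [HC Hq]].
  destruct (Rle_dec (a i) (b j)) as [H1|H1]; [destruct (Rle_dec (a j) (b i)) as [H2|H2]|].
  - destruct LP as [L1 [? LP]], LW as [L2 [? LW]], LW' as [L3 [? LW']].
    destruct MP as [M1 [? MP]], MW as [M2 [? MW]], MW' as [M3 [? MW']].
    set (K := L3 + M3 + C * (L1 + M1) + C * (L2 + M2) + C).
    assert (HK : C <= K) by (unfold K; nra).
    exists K. split; [lra|]. intros x x' Hx Hx'.
    destruct (clamp_between _ _ _ _ x x' H1 H2 Hx Hx') as [q [Q1 [Q2 [Q3 Q4]]]].
    specialize (Hq q Q1 Q2).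
    pose proof (LP q x Q1 Hx) as E1. pose proof (LW q x Q1 Hx) as E2.
    pose proof (LW' q x Q1 Hx) as E3.
    pose proof (MP q x' Q2 Hx') as F1. pose proof (MW q x' Q2 Hx') as F2.
    pose proof (MW' q x' Q2 Hx') as F3.
    rewrite (Rabs_minus_sym q x) in *.
    set (d := Rabs (x - x')) in *. pose proof (Rabs_pos (x - q)). pose proof (Rabs_pos (q - x')).
    assert (Hd : 0 <= d) by (unfold d; apply Rabs_pos).
    assert (E1' : Rabs (P i q - P i x) <= L1 * d) by nra.
    assert (E2' : Rabs (W i q - W i x) <= L2 * d) by nra.
    assert (E3' : Rabs (W' i q - W' i x) <= L3 * d) by nra.
    assert (F1' : Rabs (P j q - P j x') <= M1 * d) by nra.
    assert (F2' : Rabs (W j q - W j x') <= M2 * d) by nra.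
    assert (F3' : Rabs (W' j q - W' j x') <= M3 * d) by nra.
    clear E1 E2 E3 F1 F2 F3.
    assert (G1 : Rabs (P i q - P j q) <= Rabs (P i x - P j x') + (L1 + M1) * d).
    { replace (P i q - P j q) with ((P i x - P j x') + ((P i q - P i x) + - (P j q - P j x')))
        by ring.
      pose proof (Rabs_triang (P i x - P j x') ((P i q - P i x) + - (P j q - P j x'))).
      pose proof (Rabs_triang (P i q - P i x) (- (P j q - P j x'))).
      rewrite Rabs_Ropp in *. lra. }
    assert (G2 : nu C (W i q - W j q) <= nu C (W i x - W j x') + C * ((L2 + M2) * d)).
    { apply Rle_trans with (1 := nu_lipschitz C _ (W i x - W j x') HC).
      apply Rplus_le_compat_l. apply Rmult_le_compat_l; [lra|].
      replace (W i q - W j q - (W i x - W j x'))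
        with ((W i q - W i x) + - (W j q - W j x')) by ring.
      pose proof (Rabs_triang (W i q - W i x) (- (W j q - W j x'))).
      rewrite Rabs_Ropp in *. lra. }
    pose proof (nu_mono C K (W i x - W j x') HC HK).
    apply Rabs_le_bounds in E3'. apply Rabs_le_bounds in F3'.
    pose proof (Rabs_pos (P i x - P j x')).
    assert (C * Rabs (P i q - P j q) <= C * (Rabs (P i x - P j x') + (L1 + M1) * d)).
    { apply Rmult_le_compat_l; lra. }
    assert (C * Rabs (P i x - P j x') <= K * Rabs (P i x - P j x')).
    { apply Rmult_le_compat_r; lra. }
    assert (K * d = (L3 + M3) * d + C * (L1 + M1) * d + C * (L2 + M2) * d + C * d).
    { unfold K. ring. }
    assert (0 <= C * d) by nra.
    lra.
  - apply disjoint_gauge with (g := a j - b i); auto; [lra|].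
    intros x x' Hx Hx'. rewrite Rabs_left; lra.
  - apply disjoint_gauge with (g := a i - b j); auto; [lra|].
    intros x x' Hx Hx'. rewrite Rabs_right; lra.
Qed.

Lemma graph_gauge (I : Type) (l : list I) (a b : I -> R) (P W W' : I -> R -> R) :
  (forall i, In i l -> lip_on (a i) (b i) (P i)) ->
  (forall i, In i l -> lip_on (a i) (b i) (W i)) ->
  (forall i, In i l -> lip_on (a i) (b i) (W' i)) ->
  (forall i j, In i l -> In j l -> pair_ok a b P W W' i j) ->
  exists C, 1 <= C /\ forall i j x x', In i l -> In j l ->
    a i <= x <= b i -> a j <= x' <= b j ->
    W' i x - W' j x' <=
      C * (Rabs (x - x') + Rabs (P i x - P j x')) + nu C (W i x - W j x').
Proof.
  intros HP HW HW' Hij.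
  destruct (finite_upper (I * I) (list_prod l l)
    (fun ij C => 1 <= C /\ forall x x', a (fst ij) <= x <= b (fst ij) ->
       a (snd ij) <= x' <= b (snd ij) ->
       W' (fst ij) x - W' (snd ij) x' <=
         C * (Rabs (x - x') + Rabs (P (fst ij) x - P (snd ij) x'))
         + nu C (W (fst ij) x - W (snd ij) x')) 1) as [C [HC K]].
  - intros [i j] C D [HC H] HD. split; [lra|]. intros x x' Hx Hx'.
    specialize (H x x' Hx Hx'). simpl in *.
    pose proof (nu_mono C D (W i x - W j x') HC HD).
    pose proof (Rabs_pos (x - x')). pose proof (Rabs_pos (P i x - P j x')). nra.
  - intros [i j] H. apply in_prod_iff in H. destruct H as [Hi Hj]. simpl.
    apply pair_gauge; auto.
  - exists C. split; [exact HC|]. intros i j x x' Hi Hj Hx Hx'.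
    destruct (K (i, j)) as [_ H]; [now apply in_prod|]. now apply H.
Qed.

Lemma graph_push_z (I : Type) (l : list I) (a b : I -> R) (Y Z Z' : I -> R -> R) :
  (forall i, In i l -> lip_on (a i) (b i) (Y i)) ->
  (forall i, In i l -> lip_on (a i) (b i) (Z i)) ->
  (forall i, In i l -> lip_on (a i) (b i) (Z' i)) ->
  (forall i j, In i l -> In j l -> pair_ok a b Y Z Z' i j) ->
  ambient_isotopic (gset l a b Y Z) (gset l a b Y Z').
Proof.
  intros HY HZ HZ' Hij.
  destruct (graph_gauge I l a b Y Z Z' HY HZ HZ' Hij) as [C [HC H]].
  refine (ambient_isotopic_ext _ _ _ _ _ _ (push_z (I * R)
    (fun ix => In (fst ix) l /\ a (fst ix) <= snd ix <= b (fst ix))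
    (fun ix => (snd ix, Y (fst ix) (snd ix), Z (fst ix) (snd ix)))
    (fun ix => Z' (fst ix) (snd ix)) C HC _)).
  - intros p; split.
    + intros [[i x] [[Hi Hx] E]]. exists i, x. auto.
    + intros [i [x [Hi [Hx E]]]]. exists (i, x). auto.
  - intros p; split.
    + intros [[i x] [[Hi Hx] E]]. exists i, x. auto.
    + intros [i [x [Hi [Hx E]]]]. exists (i, x). auto.
  - intros [i x] [j x'] [Hi Hx] [Hj Hx']. simpl in *. now apply H.
Qed.

Lemma graph_push_y (I : Type) (l : list I) (a b : I -> R) (Y Y' Z : I -> R -> R) :
  (forall i, In i l -> lip_on (a i) (b i) (Z i)) ->
  (forall i, In i l -> lip_on (a i) (b i) (Y i)) ->
  (forall i, In i l -> lip_on (a i) (b i) (Y' i)) ->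
  (forall i j, In i l -> In j l -> pair_ok a b Z Y Y' i j) ->
  ambient_isotopic (gset l a b Y Z) (gset l a b Y' Z).
Proof.
  intros HZ HY HY' Hij.
  destruct (graph_gauge I l a b Z Y Y' HZ HY HY' Hij) as [C [HC H]].
  refine (ambient_isotopic_ext _ _ _ _ _ _ (push_y (I * R)
    (fun ix => In (fst ix) l /\ a (fst ix) <= snd ix <= b (fst ix))
    (fun ix => (snd ix, Y (fst ix) (snd ix), Z (fst ix) (snd ix)))
    (fun ix => Y' (fst ix) (snd ix)) C HC _)).
  - intros p; split.
    + intros [[i x] [[Hi Hx] E]]. exists i, x. auto.
    + intros [i [x [Hi [Hx E]]]]. exists (i, x). auto.
  - intros p; split.
    + intros [[i x] [[Hi Hx] E]]. exists i, x. auto.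
    + intros [i [x [Hi [Hx E]]]]. exists (i, x). auto.
  - intros [i x] [j x'] [Hi Hx] [Hj Hx']. simpl in *. now apply H.
Qed.

Lemma graph_push_x (I : Type) (l : list I) (a b : I -> R) (Y Z : I -> R -> R)
  (f g : R -> R) (C : R) :
  1 <= C -> (forall x, g (f x) = x) -> (forall x, f (g x) = x) ->
  (forall x y, f x - f y <= nu C (x - y)) ->
  (forall x y, g x - g y <= nu C (x - y)) ->
  ambient_isotopic (gset l a b Y Z)
    (gset l (fun i => f (a i)) (fun i => f (b i))
       (fun i x => Y i (g x)) (fun i x => Z i (g x))).
Proof.
  intros HC Hgf Hfg Hf Hg.
  assert (mono : forall h : R -> R, (forall x y, h x - h y <= nu C (x - y)) ->
            forall x y, x <= y -> h x <= h y).
  { intros h Hh x y Hxy. pose proof (Hh x y) as K. rewrite nu_neg in K by lra.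
    assert (0 < / C) by (apply Rinv_0_lt_compat; lra). unfold Rdiv in K. nra. }
  refine (ambient_isotopic_ext _ _ _ _ _ _ (push_x (I * R)
    (fun ix => In (fst ix) l /\ a (fst ix) <= snd ix <= b (fst ix))
    (fun ix => (snd ix, Y (fst ix) (snd ix), Z (fst ix) (snd ix)))
    (fun ix => f (snd ix)) C HC _)).
  - intros p; split.
    + intros [[i x] [[Hi Hx] E]]. exists i, x. auto.
    + intros [i [x [Hi [Hx E]]]]. exists (i, x). auto.
  - intros p; split.
    + intros [[i x] [[Hi Hx] E]]. exists i, (f x). simpl in *. rewrite Hgf.
      split; [exact Hi|]. split; [|exact E]. split; apply (mono f Hf); lra.
    + intros [i [x [Hi [Hx E]]]]. exists (i, g x). unfold py, pz, px; simpl. rewrite Hfg.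
      split; [split; [exact Hi|]|exact E].
      rewrite <- (Hgf (a i)), <- (Hgf (b i)). split; apply (mono g Hg); lra.
  - intros [i x] [j x'] [Hi Hx] [Hj Hx']. unfold px, py, pz; simpl in *.
    pose proof (Hf x x'). pose proof (Rabs_pos (Z i x - Z j x')).
    pose proof (Rabs_pos (Y i x - Y j x')). nra.
Qed.


(** * Pairs of graphs over common abscissas: vertices, crossings, nested chords *)

Definition comparable (K u u' : R) : Prop :=
  (0 <= u /\ u' <= K * u /\ u <= K * u') \/ (u <= 0 /\ K * u <= u' /\ K * u' <= u).

Lemma comparable_mono (K M u u' : R) :
  1 <= K -> K <= M -> comparable K u u' -> comparable M u u'.
Proof. intros HK HM [H|H]; [left|right]; nra. Qed.

(* At every abscissa of [J] either the gap [D] of the passive coordinates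
   controls both differences [U], [U'] of the active ones, or [U] and [U'] have
   the same sign and comparable sizes. *)
Definition separated (J : R -> Prop) (D U U' : R -> R) : Prop :=
  exists K, 1 <= K /\ forall q, J q ->
    Rabs (U q) + Rabs (U' q) <= K * Rabs (D q) \/ comparable K (U q) (U' q).

Lemma separated_sym (J J' : R -> Prop) (D U U' D' V V' : R -> R) :
  (forall q, J' q -> J q) ->
  (forall q, J' q -> D' q = - D q /\ V q = - U q /\ V' q = - U' q) ->
  separated J D U U' -> separated J' D' V V'.
Proof.
  intros HJ E [K [HK H]]. exists K. split; [exact HK|]. intros q Hq.
  destruct (E q Hq) as [E1 [E2 E3]]. rewrite E1, E2, E3, !Rabs_Ropp.
  destruct (H q (HJ q Hq)) as [K1|[K1|K1]]; [now left|right; right|right; left]; lra.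
Qed.

Lemma separated_pair_ok (I : Type) (a b : I -> R) (P W W' : I -> R -> R) (i j : I) :
  separated (fun q => a i <= q <= b i /\ a j <= q <= b j)
    (fun q => P i q - P j q) (fun q => W i q - W j q) (fun q => W' i q - W' j q) ->
  pair_ok a b P W W' i j.
Proof.
  intros [K [HK H]]. exists K. split; [exact HK|]. intros q Hi Hj.
  destruct (H q (conj Hi Hj)) as [E|[E|E]].
  - pose proof (nu_mono 1 K (W i q - W j q) ltac:(lra) HK) as T. rewrite nu_1 in T.
    pose proof (Rle_abs (W' i q - W' j q)). pose proof (Rle_abs (- (W i q - W j q))).
    rewrite Rabs_Ropp in *. lra.
  - rewrite nu_pos by lra. pose proof (Rabs_pos (P i q - P j q)). nra.
  - rewrite nu_neg by lra. pose proof (Rabs_pos (P i q - P j q)).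
    assert (W' i q - W' j q <= (W i q - W j q) / K); [|nra].
    apply Rmult_le_reg_l with K; [lra|].
    replace (K * ((W i q - W j q) / K)) with (W i q - W j q) by (field; lra). lra.
Qed.

(** A uniform margin [k] is enough: the differences being bounded by [B], all ratios that matter are
    controlled by [B / k]. *)
Lemma separated_gap (J : R -> Prop) (D U U' : R -> R) (B k : R) :
  0 < k -> (forall q, J q -> Rabs (U q) <= B) -> (forall q, J q -> Rabs (U' q) <= B) ->
  (forall q, J q -> k <= Rabs (D q) \/ (k <= U q /\ k <= U' q) \/
                    (U q <= - k /\ U' q <= - k)) ->
  separated J D U U'.
Proof.
  intros Hk HU HU' H. set (K := 1 + 2 * Rabs B / k).
  assert (HK : 2 * Rabs B <= K * k).
  { unfold K. rewrite Rmult_plus_distr_r.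
    replace (2 * Rabs B / k * k) with (2 * Rabs B) by (field; lra). lra. }
  assert (HK1 : 1 <= K).
  { unfold K. assert (0 <= 2 * Rabs B / k); [|lra].
    apply Rmult_le_pos; [pose proof (Rabs_pos B); lra|].
    left; apply Rinv_0_lt_compat; lra. }
  exists K. split; [exact HK1|]. intros q Hq.
  pose proof (HU q Hq) as E1. pose proof (HU' q Hq) as E2. pose proof (Rle_abs B).
  pose proof (Rabs_le_bounds _ _ E1). pose proof (Rabs_le_bounds _ _ E2).
  destruct (H q Hq) as [E|[E|E]].
  - left. nra.
  - right; left. nra.
  - right; right. nra.
Qed.

(** For two edges with a common vertex at abscissa [w]: the passive gap opens linearly there, and
    the active differences vanish at least as fast. *)
Lemma separated_linear (J : R -> Prop) (D U U' : R -> R) (w s L : R) :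
  s <> 0 -> (forall q, J q -> D q = s * (q - w)) ->
  (forall q, J q -> Rabs (U q) <= L * Rabs (q - w)) ->
  (forall q, J q -> Rabs (U' q) <= L * Rabs (q - w)) ->
  separated J D U U'.
Proof.
  intros Hs HD HU HU'.
  assert (Hs' : 0 < Rabs s) by now apply Rabs_pos_lt.
  exists (1 + 2 * Rabs L / Rabs s). split.
  { assert (0 <= 2 * Rabs L / Rabs s); [|lra].
    apply Rmult_le_pos; [pose proof (Rabs_pos L); lra|].
    left; apply Rinv_0_lt_compat; lra. }
  intros q Hq. left. rewrite (HD q Hq), Rabs_mult.
  pose proof (HU q Hq). pose proof (HU' q Hq). pose proof (Rle_abs L).
  pose proof (Rabs_pos (q - w)).
  rewrite Rmult_plus_distr_r, Rmult_1_l, <- Rmult_assoc.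
  replace (2 * Rabs L / Rabs s * Rabs s) with (2 * Rabs L) by (field; lra).
  nra.
Qed.

Lemma separated_empty (J : R -> Prop) (D U U' : R -> R) :
  (forall q, ~ J q) -> separated J D U U'.
Proof. intros H. exists 1. split; [lra|]. intros q Hq. now elim (H q). Qed.

Lemma separated_equal (J : R -> Prop) (D U U' : R -> R) :
  (forall q, J q -> U' q = U q) -> separated J D U U'.
Proof.
  intros H. exists 1. split; [lra|]. intros q Hq. right. rewrite (H q Hq).
  unfold comparable. lra.
Qed.

(** The secant of the parabola [y = x^2] through the abscissas [a] and [b]; its slope is [a + b].
    The next function is its elevation over the parabola. *)
Definition line (a b x : R) : R := (a + b) * x - a * b.
Definition cap (a b x : R) : R := (x - a) * (b - x).

Lemma line_left (a b : R) : line a b a = a * a.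
Proof. unfold line. ring. Qed.

Lemma line_right (a b : R) : line a b b = b * b.
Proof. unfold line. ring. Qed.

Lemma line_cap (a b x : R) : line a b x = x * x + cap a b x.
Proof. unfold line, cap. ring. Qed.

Lemma lip_line (a b u v : R) : lip_on u v (line a b).
Proof.
  apply lip_on_minus; [apply lip_on_mult; [apply lip_on_const|apply lip_on_id]|
    apply lip_on_const].
Qed.

Lemma lip_cap (a b u v : R) : lip_on u v (cap a b).
Proof.
  apply lip_on_mult; apply lip_on_minus; auto using lip_on_id, lip_on_const.
Qed.

Lemma cap_pos (a b x : R) : a <= x <= b -> 0 <= cap a b x.
Proof. unfold cap. intros. nra. Qed.

(** An affine function on an interval is at least the smaller of its two end values, and at a vertex
    of the inner chord the difference is the elevation of the outer one. *)
Lemma line_nested (a b a' b' q : R) :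
  a < a' -> a' < b' -> b' < b -> a' <= q <= b' ->
  Rmin (cap a b a') (cap a b b') <= line a b q - line a' b' q.
Proof.
  intros H1 H2 H3 Hq.
  assert (E : (b' - a') * (line a b q - line a' b' q)
              = (b' - q) * cap a b a' + (q - a') * cap a b b').
  { unfold line, cap. ring. }
  pose proof (Rmin_l (cap a b a') (cap a b b')).
  pose proof (Rmin_r (cap a b a') (cap a b b')).
  apply Rmult_le_reg_l with (b' - a'); [lra|]. rewrite E. nra.
Qed.

Lemma cap_nested_pos (a b a' b' : R) :
  a < a' -> a' < b' -> b' < b -> 0 < Rmin (cap a b a') (cap a b b').
Proof. intros. unfold cap. apply Rmin_glb_lt; nra. Qed.

Definition cross_pt (a b a' b' : R) : R := (a' * b' - a * b) / (a' + b' - (a + b)).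

Lemma cross_pt_spec (a b a' b' q : R) :
  a < a' -> b < b' ->
  line a b q - line a' b' q = (a + b - (a' + b')) * (q - cross_pt a b a' b').
Proof. intros. unfold line, cross_pt. field. lra. Qed.

Lemma cross_pt_between (a b a' b' : R) :
  a < a' -> a' < b -> b < b' -> a' < cross_pt a b a' b' < b.
Proof.
  intros H1 H2 H3. unfold cross_pt. split.
  - apply Rmult_lt_reg_r with (a' + b' - (a + b)); [lra|].
    unfold Rdiv. rewrite Rmult_assoc, Rinv_l by lra. nra.
  - apply Rmult_lt_reg_r with (a' + b' - (a + b)); [lra|].
    unfold Rdiv. rewrite Rmult_assoc, Rinv_l by lra. nra.
Qed.

Definition same_sign (u v : R) : Prop := (0 < u /\ 0 < v) \/ (u < 0 /\ v < 0).

Lemma lip_pair_bounded (J : R -> Prop) (a b a' b' : R) (f g : R -> R) :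
  (forall q, J q -> a <= q <= b /\ a' <= q <= b') ->
  lip_on a b f -> lip_on a' b' g ->
  exists B, 0 <= B /\ forall q, J q -> Rabs (f q - g q) <= B.
Proof.
  intros HJ Hf Hg.
  destruct (lip_on_bounded _ _ _ Hf) as [B [HB Bf]].
  destruct (lip_on_bounded _ _ _ Hg) as [B' [HB' Bg]].
  exists (B + B'). split; [lra|]. intros q Hq. destruct (HJ q Hq).
  pose proof (Bf q ltac:(lra)). pose proof (Bg q ltac:(lra)).
  pose proof (Rabs_triang (f q) (- g q)). rewrite Rabs_Ropp in *.
  replace (f q - g q) with (f q + - g q) by ring. lra.
Qed.

Lemma lip_pair_vertex (J : R -> Prop) (a b a' b' w : R) (f g : R -> R) :
  (forall q, J q -> a <= q <= b /\ a' <= q <= b') ->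
  a <= w <= b -> a' <= w <= b' -> f w = g w ->
  lip_on a b f -> lip_on a' b' g ->
  exists L, 0 <= L /\ forall q, J q -> Rabs (f q - g q) <= L * Rabs (q - w).
Proof.
  intros HJ Hw Hw' E [L [HL H]] [L' [HL' H']]. exists (L + L'). split; [lra|].
  intros q Hq. destruct (HJ q Hq).
  replace (f q - g q) with (f q - f w + - (g q - g w)) by (rewrite E; ring).
  apply Rle_trans with (1 := Rabs_triang _ _). rewrite Rabs_Ropp.
  pose proof (H q w ltac:(lra) ltac:(lra)). pose proof (H' q w ltac:(lra) ltac:(lra)). lra.
Qed.

Lemma lip_pair_sign (a b a' b' w : R) (f g : R -> R) :
  a <= w <= b -> a' <= w <= b' -> 0 < f w - g w ->
  lip_on a b f -> lip_on a' b' g ->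
  exists d k, 0 < d /\ 0 < k /\ forall q, a <= q <= b -> a' <= q <= b' ->
    Rabs (q - w) <= d -> k <= f q - g q.
Proof.
  intros Hw Hw' Hp [L [HL H]] [L' [HL' H']].
  set (k := (f w - g w) / 2). exists (k / (L + L' + 1)), k.
  assert (Hk : 0 < k) by (unfold k; lra).
  split; [apply Rdiv_lt_0_compat; lra|]. split; [exact Hk|].
  intros q Hq Hq' Hd.
  pose proof (H q w Hq Hw) as E. pose proof (H' q w Hq' Hw') as E'.
  apply Rabs_le_bounds in E. apply Rabs_le_bounds in E'.
  assert (Rabs (q - w) * (L + L' + 1) <= k).
  { replace k with (k / (L + L' + 1) * (L + L' + 1)) by (field; lra).
    apply Rmult_le_compat_r; lra. }
  pose proof (Rabs_pos (q - w)). unfold k in *. nra.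
Qed.

Lemma lip_pair_same_sign (a b a' b' w : R) (f g f' g' : R -> R) :
  a <= w <= b -> a' <= w <= b' ->
  same_sign (f w - g w) (f' w - g' w) ->
  lip_on a b f -> lip_on a b f' -> lip_on a' b' g -> lip_on a' b' g' ->
  exists d k, 0 < d /\ 0 < k /\ forall q, a <= q <= b -> a' <= q <= b' ->
    Rabs (q - w) <= d ->
    (k <= f q - g q /\ k <= f' q - g' q) \/ (f q - g q <= - k /\ f' q - g' q <= - k).
Proof.
  intros Hw Hw' Hsign Lf Lf' Lg Lg'.
  destruct Hsign as [[S S']|[S S']].
  - destruct (lip_pair_sign a b a' b' w f g) as [d [k [Hd [Hk K]]]]; auto.
      destruct (lip_pair_sign a b a' b' w f' g') as [d' [k' [Hd' [Hk' K']]]]; auto.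
      exists (Rmin d d'), (Rmin k k').
      split; [now apply Rmin_glb_lt|]. split; [now apply Rmin_glb_lt|].
      intros q Hq Hq' Hqw. left.
      pose proof (Rmin_l d d'). pose proof (Rmin_r d d').
      pose proof (Rmin_l k k'). pose proof (Rmin_r k k').
      pose proof (K q Hq Hq' ltac:(lra)). pose proof (K' q Hq Hq' ltac:(lra)). lra.
  - destruct (lip_pair_sign a' b' a b w g f) as [d [k [Hd [Hk K]]]]; auto; [lra|].
      destruct (lip_pair_sign a' b' a b w g' f') as [d' [k' [Hd' [Hk' K']]]]; auto; [lra|].
      exists (Rmin d d'), (Rmin k k').
      split; [now apply Rmin_glb_lt|]. split; [now apply Rmin_glb_lt|].
      intros q Hq Hq' Hqw. right.
      pose proof (Rmin_l d d'). pose proof (Rmin_r d d').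
      pose proof (Rmin_l k k'). pose proof (Rmin_r k k').
      pose proof (K q Hq' Hq ltac:(lra)). pose proof (K' q Hq' Hq ltac:(lra)). lra.
Qed.

(** Close to the crossing the two active differences keep their common sign by continuity; further
    away the passive gap, linear in the distance from [w], is bounded below. *)
Lemma separated_crossing (a b a' b' w s : R) (D f g f' g' : R -> R) :
  a <= w <= b -> a' <= w <= b' -> s <> 0 ->
  (forall q, D q = s * (q - w)) ->
  same_sign (f w - g w) (f' w - g' w) ->
  lip_on a b f -> lip_on a b f' -> lip_on a' b' g -> lip_on a' b' g' ->
  separated (fun q => a <= q <= b /\ a' <= q <= b') D
    (fun q => f q - g q) (fun q => f' q - g' q).
Proof.
  intros Hw Hw' Hs HD Hsign Lf Lf' Lg Lg'.
  destruct (lip_pair_same_sign a b a' b' w f g f' g') as [d [k [Hd [Hk K]]]]; auto.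
  destruct (lip_pair_bounded (fun q => a <= q <= b /\ a' <= q <= b') a b a' b' f g)
    as [B [HB HBf]]; auto.
  destruct (lip_pair_bounded (fun q => a <= q <= b /\ a' <= q <= b') a b a' b' f' g')
    as [B' [HB' HBf']]; auto.
  assert (Hs' : 0 < Rabs s) by now apply Rabs_pos_lt.
  apply separated_gap with (B := B + B') (k := Rmin k (Rabs s * d)).
  - apply Rmin_glb_lt; [exact Hk|nra].
  - intros q Hq. specialize (HBf q Hq). lra.
  - intros q Hq. specialize (HBf' q Hq). lra.
  - intros q [Hq Hq']. pose proof (Rmin_l k (Rabs s * d)). pose proof (Rmin_r k (Rabs s * d)).
    destruct (Rle_dec (Rabs (q - w)) d) as [E|E].
    + right. destruct (K q Hq Hq' E); [left|right]; lra.
    + left. rewrite HD, Rabs_mult. nra.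
Qed.

Definition is_end {I : Type} (a b : I -> R) (i : I) (q : R) : Prop := q = a i \/ q = b i.

(* Two lifts of the same plane chords with the same over- and undercrossings. *)
Lemma relift (I : Type) (l : list I) (a b : I -> R) (Z Z' : I -> R -> R) :
  (forall i, In i l -> a i < b i) ->
  (forall i j, In i l -> In j l -> a i = a j -> b i = b j -> i = j) ->
  (forall i, In i l -> lip_on (a i) (b i) (Z i)) ->
  (forall i, In i l -> lip_on (a i) (b i) (Z' i)) ->
  (forall i j q, In i l -> In j l -> is_end a b i q -> is_end a b j q ->
     Z i q = Z j q /\ Z' i q = Z' j q) ->
  (forall i j, In i l -> In j l -> a i < a j -> a j < b i -> b i < b j ->
     let w := cross_pt (a i) (b i) (a j) (b j) in
     same_sign (Z i w - Z j w) (Z' i w - Z' j w)) ->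
  ambient_isotopic (gset l a b (fun i => line (a i) (b i)) Z)
                   (gset l a b (fun i => line (a i) (b i)) Z').
Proof.
  intros Hab Huniq HZ HZ' Hv Hc.
  set (S := fun i j => separated (fun q => a i <= q <= b i /\ a j <= q <= b j)
    (fun q => line (a i) (b i) q - line (a j) (b j) q)
    (fun q => Z i q - Z j q) (fun q => Z' i q - Z' j q)).
  assert (Ssym : forall i j, S i j -> S j i).
  { intros i j. apply separated_sym; [tauto|]. intros q _. lra. }
  assert (Hvert : forall i j w s, In i l -> In j l -> is_end a b i w -> is_end a b j w ->
     s <> 0 -> (forall q, line (a i) (b i) q - line (a j) (b j) q = s * (q - w)) -> S i j).
  { intros i j w s Hi Hj Ei Ej Hs HD. pose proof (Hab i Hi). pose proof (Hab j Hj).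
    assert (Hw : a i <= w <= b i) by (destruct Ei; lra).
    assert (Hw' : a j <= w <= b j) by (destruct Ej; lra).
    destruct (Hv i j w Hi Hj Ei Ej) as [V V'].
    destruct (lip_pair_vertex (fun q => a i <= q <= b i /\ a j <= q <= b j)
      (a i) (b i) (a j) (b j) w (Z i) (Z j)) as [L [HL K]]; auto.
    destruct (lip_pair_vertex (fun q => a i <= q <= b i /\ a j <= q <= b j)
      (a i) (b i) (a j) (b j) w (Z' i) (Z' j)) as [L' [HL' K']]; auto.
    apply separated_linear with (w := w) (s := s) (L := L + L'); auto.
    - intros q Hq. specialize (K q Hq). pose proof (Rabs_pos (q - w)). nra.
    - intros q Hq. specialize (K' q Hq). pose proof (Rabs_pos (q - w)). nra. }
  (* By the order of the ends, the chords are apart, share a vertex, interleave, or are nested. A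
     shared vertex gives a linear plane gap, a crossing is settled by the hypothesis on signs, and
     nested chords have a positive plane gap throughout. *)
  assert (Hord : forall i j, In i l -> In j l -> a i < a j -> S i j).
  { intros i j Hi Hj Ha. pose proof (Hab i Hi). pose proof (Hab j Hj).
    destruct (Rtotal_order (b i) (a j)) as [B|[B|B]].
    - apply separated_empty. intros q [Q Q']. lra.
    - apply Hvert with (w := b i) (s := a i + b i - (a j + b j)); unfold is_end; auto; [lra|].
      intros q. rewrite B. unfold line. ring.
    - destruct (Rtotal_order (b i) (b j)) as [C|[C|C]].
      + pose proof (cross_pt_between _ _ _ _ Ha B C).
        apply separated_crossing with (w := cross_pt (a i) (b i) (a j) (b j))
          (s := a i + b i - (a j + b j)); auto; try lra.
        intros q. now apply cross_pt_spec.
      + apply Hvert with (w := b i) (s := a i - a j); unfold is_end; auto; [lra|].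
        intros q. rewrite <- C. unfold line. ring.
      + destruct (lip_pair_bounded (fun q => a i <= q <= b i /\ a j <= q <= b j)
          (a i) (b i) (a j) (b j) (Z i) (Z j)) as [B1 [HB1 HBf]]; auto.
        destruct (lip_pair_bounded (fun q => a i <= q <= b i /\ a j <= q <= b j)
          (a i) (b i) (a j) (b j) (Z' i) (Z' j)) as [B2 [HB2 HBf']]; auto.
        apply separated_gap with (B := B1 + B2)
          (k := Rmin (cap (a i) (b i) (a j)) (cap (a i) (b i) (b j))).
        * now apply cap_nested_pos.
        * intros q Hq. specialize (HBf q Hq). lra.
        * intros q Hq. specialize (HBf' q Hq). lra.
        * intros q [Q Q']. left.
          apply Rle_trans with (2 := Rle_abs _). now apply line_nested. }
  apply graph_push_z; auto.
  - intros i Hi. apply lip_line.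
  - intros i j Hi Hj. apply separated_pair_ok. change (S i j).
    destruct (Rtotal_order (a i) (a j)) as [A|[A|A]]; [auto| |auto].
    destruct (Req_dec (b i) (b j)) as [B|B].
    + assert (i = j) by auto. subst j. apply separated_equal. intros; lra.
    + apply Hvert with (w := a i) (s := b i - b j); unfold is_end; auto; [lra|].
      intros q. rewrite A. unfold line. ring.
Qed.


(** * Chords of a parabola *)

Definition lines {I : Type} (a b : I -> R) (i : I) : R -> R := line (a i) (b i).

(* The chords of the parabola [y = x^2] between abscissas [a i] and [b i], the
   [i]-th one lifted to the sheet [z = h i * (y - x^2)]. *)
Definition chords {I : Type} (l : list I) (a b h : I -> R) : pset :=
  gset l a b (lines a b) (fun i x => h i * cap (a i) (b i) x).

Definition chord_family {I : Type} (l : list I) (a b : I -> R) : Prop :=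
  (forall i, In i l -> a i < b i) /\
  (forall i j, In i l -> In j l -> a i = a j -> b i = b j -> i = j).

Definition interleaved {I : Type} (a b : I -> R) (i j : I) : Prop :=
  a i < a j /\ a j < b i /\ b i < b j.

Definition cross {I : Type} (a b : I -> R) (i j : I) : R :=
  cross_pt (a i) (b i) (a j) (b j).

Lemma same_sign_scale (c u v : R) : 0 < c -> same_sign (c * u) v <-> same_sign u v.
Proof. intros Hc. unfold same_sign. split; intros [[H1 H2]|[H1 H2]]; [left|right|left|right]; nra. Qed.

Lemma same_sign_sym (u v : R) : same_sign u v -> same_sign v u.
Proof. unfold same_sign. tauto. Qed.

Lemma same_sign_refl (u : R) : u <> 0 -> same_sign u u.
Proof. intros H. unfold same_sign. destruct (Rtotal_order u 0) as [?|[?|?]]; lra. Qed.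

(** Two secants that meet have the same elevation over the parabola there, so at a crossing the
    order of the sheets is the order of [h]. Any lift with these signs at the crossings and common
    values at the vertices may replace the sheets. *)
Lemma chords_relift (I : Type) (l : list I) (a b h : I -> R) (Z : I -> R -> R) :
  chord_family l a b ->
  (forall i, In i l -> lip_on (a i) (b i) (Z i)) ->
  (forall i j q, In i l -> In j l -> is_end a b i q -> is_end a b j q -> Z i q = Z j q) ->
  (forall i j, In i l -> In j l -> interleaved a b i j ->
     same_sign (h i - h j) (Z i (cross a b i j) - Z j (cross a b i j))) ->
  ambient_isotopic (chords l a b h) (gset l a b (lines a b) Z).
Proof.
  intros [Hab Hu] HZ Hv Hc. apply relift; auto.
  - intros i Hi. apply lip_on_mult; [apply lip_on_const|apply lip_cap].
  - intros i j q Hi Hj Ei Ej. split; [|auto].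
    replace (cap (a i) (b i) q) with 0 by (unfold cap; destruct Ei; subst; ring).
    replace (cap (a j) (b j) q) with 0 by (unfold cap; destruct Ej; subst; ring).
    lra.
  - intros i j Hi Hj H1 H2 H3 w.
    pose proof (cross_pt_between _ _ _ _ H1 H2 H3) as Hw. fold w in Hw.
    pose proof (cross_pt_spec (a i) (b i) (a j) (b j) w H1 H3) as E.
    fold w in E. rewrite Rminus_diag, Rmult_0_r, !line_cap in E.
    replace (cap (a j) (b j) w) with (cap (a i) (b i) w) by lra.
    assert (0 < cap (a i) (b i) w) by (unfold cap; nra).
    replace (h i * cap (a i) (b i) w - h j * cap (a i) (b i) w)
      with (cap (a i) (b i) w * (h i - h j)) by ring.
    apply same_sign_scale; [assumption|]. apply Hc; auto. split; auto.
Qed.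

(** A profile that is constant except within [e] of the ends, unlike [cap]. Over the plateaus chords
    of different heights are vertically apart by a fixed amount, so their plane projections may be
    moved across each other. *)
Definition trap (e a b x : R) : R := Rmin 1 (Rmin ((x - a) / e) ((b - x) / e)).

Lemma lip_trap (e a b u v : R) : lip_on u v (trap e a b).
Proof.
  apply lip_on_min; [apply lip_on_const|].
  apply lip_on_min; apply lip_on_mult; try apply lip_on_const;
    apply lip_on_minus; auto using lip_on_id, lip_on_const.
Qed.

Lemma trap_end (e a b x : R) : 0 < e -> a <= b -> x = a \/ x = b -> trap e a b x = 0.
Proof.
  intros He Hab Hx. unfold trap.
  assert (E : forall u, 0 <= u -> 0 <= u / e).
  { intros u Hu. apply Rmult_le_pos; [exact Hu|]. left; now apply Rinv_0_lt_compat. }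
  pose proof (E (b - a) ltac:(lra)).
  destruct Hx; subst x; rewrite Rminus_diag; unfold Rdiv at 1 2; try rewrite Rmult_0_l.
  - rewrite Rmin_left with (x := 0), Rmin_right; lra.
  - unfold Rdiv in H. rewrite Rmin_right with (x := (b - a) * / e); [|lra].
    rewrite Rmin_right; lra.
Qed.

Lemma trap_plateau (e a b x : R) : 0 < e -> a + e <= x -> x <= b - e -> trap e a b x = 1.
Proof.
  intros He Ha Hb. unfold trap.
  assert (E : forall u, e <= u -> 1 <= u / e).
  { intros u Hu. apply Rmult_le_reg_r with e; [exact He|].
    replace (u / e * e) with u by (field; lra). lra. }
  pose proof (E (x - a) ltac:(lra)). pose proof (E (b - x) ltac:(lra)).
  apply Rmin_left. apply Rmin_glb; assumption.
Qed.

Lemma trap_right (e a b x : R) :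
  0 < e -> b - x <= e -> b - x <= x - a -> trap e a b x = (b - x) / e.
Proof.
  intros He H1 H2. unfold trap.
  assert (E : forall u v, u <= v -> u / e <= v / e).
  { intros u v Huv. apply Rmult_le_compat_r; [left; now apply Rinv_0_lt_compat|exact Huv]. }
  rewrite (Rmin_right ((x - a) / e)) by auto.
  apply Rmin_right. replace 1 with (e / e) by (field; lra). auto.
Qed.

(* For small [e], the crossings lie over the plateaus of the trapezoids. *)
Lemma chords_trap (I : Type) (l : list I) (a b h : I -> R) :
  chord_family l a b ->
  (forall i j, In i l -> In j l -> interleaved a b i j -> h i <> h j) ->
  exists e0, 0 < e0 /\ forall e, 0 < e <= e0 ->
    ambient_isotopic (chords l a b h)
      (gset l a b (lines a b) (fun i x => h i * trap e (a i) (b i) x)).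
Proof.
  intros Hf Hh.
  destruct (finite_lower (I * I) (list_prod l l)
    (fun ij e => interleaved a b (fst ij) (snd ij) ->
       trap e (a (fst ij)) (b (fst ij)) (cross a b (fst ij) (snd ij)) = 1 /\
       trap e (a (snd ij)) (b (snd ij)) (cross a b (fst ij) (snd ij)) = 1) 1)
    as [e0 [He0 K]].
  - lra.
  - intros [i j] _. simpl.
    destruct (classic (interleaved a b i j)) as [X|X].
    2:{ exists 1. split; [lra|]. intros; tauto. }
    destruct X as [H1 [H2 H3]].
    pose proof (cross_pt_between _ _ _ _ H1 H2 H3) as Hw.
    unfold cross. set (w := cross_pt _ _ _ _) in *.
    exists (Rmin (w - a j) (b i - w)). split; [apply Rmin_glb_lt; lra|].
    intros e He _. pose proof (Rmin_l (w - a j) (b i - w)).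
    pose proof (Rmin_r (w - a j) (b i - w)). split; apply trap_plateau; lra.
  - exists e0. split; [lra|]. intros e He. apply chords_relift; auto.
    + intros i Hi. apply lip_on_mult; [apply lip_on_const|apply lip_trap].
    + destruct Hf as [Hab _]. intros i j q Hi Hj Ei Ej.
      pose proof (Hab i Hi). pose proof (Hab j Hj).
      rewrite !trap_end by (lra || assumption). lra.
    + intros i j Hi Hj X. destruct (K (i, j) e) as [E1 E2]; simpl in *; auto.
      { now apply in_prod. }
      rewrite E1, E2, !Rmult_1_r. apply same_sign_refl. pose proof (Hh i j Hi Hj X). lra.
Qed.

(** On the middle of the interval [P] does the separating, whatever [D] and [D'] do; near each end
    [D] and [D'] are nonzero of the same sign. The bound [e0] depends on [D] and [D'] only, because
    [P] will itself vary with [e]. *)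
Lemma separated_plateau (u v k : R) (D D' : R -> R) :
  u < v -> 0 < k -> lip_on u v D -> lip_on u v D' ->
  same_sign (D u) (D' u) -> same_sign (D v) (D' v) ->
  exists e0, 0 < e0 /\ forall e (P : R -> R), 0 < e <= e0 ->
    (forall q, u + e <= q <= v - e -> k <= Rabs (P q)) ->
    separated (fun q => u <= q <= v) P D D'.
Proof.
  intros Huv Hk HD HD' Su Sv.
  destruct (lip_pair_same_sign u v u v u D (fun _ => 0) D' (fun _ => 0))
    as [d1 [k1 [Hd1 [Hk1 K1]]]]; auto using lip_on_const; try lra.
  { now rewrite !Rminus_0_r. }
  destruct (lip_pair_same_sign u v u v v D (fun _ => 0) D' (fun _ => 0))
    as [d2 [k2 [Hd2 [Hk2 K2]]]]; auto using lip_on_const; try lra.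
  { now rewrite !Rminus_0_r. }
  destruct (lip_on_bounded _ _ _ HD) as [B [HB Bf]].
  destruct (lip_on_bounded _ _ _ HD') as [B' [HB' Bf']].
  exists (Rmin d1 d2). split; [now apply Rmin_glb_lt|]. intros e P He HP.
  pose proof (Rmin_l d1 d2). pose proof (Rmin_r d1 d2).
  set (m := Rmin k (Rmin k1 k2)).
  assert (Hm : 0 < m /\ m <= k /\ m <= k1 /\ m <= k2).
  { pose proof (Rmin_l k (Rmin k1 k2)). pose proof (Rmin_r k (Rmin k1 k2)).
    pose proof (Rmin_l k1 k2). pose proof (Rmin_r k1 k2).
    split; [|unfold m; lra]. repeat apply Rmin_glb_lt; assumption. }
  apply separated_gap with (B := B + B') (k := m); [lra| | |].
  - intros q Hq. specialize (Bf q Hq). lra.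
  - intros q Hq. specialize (Bf' q Hq). lra.
  - intros q Hq.
    destruct (Rle_dec q (u + e)) as [E|E]; [|destruct (Rle_dec (v - e) q) as [E'|E']].
    + right. destruct (K1 q Hq Hq); [rewrite Rabs_right; lra|left|right]; lra.
    + right. destruct (K2 q Hq Hq); [rewrite Rabs_left1; lra|left|right]; lra.
    + left. specialize (HP q ltac:(lra)). lra.
Qed.


Lemma gset_ext (I : Type) (l : list I) (a b a' b' : I -> R) (Y Z Y' Z' : I -> R -> R) :
  (forall i, In i l -> a i = a' i /\ b i = b' i) ->
  (forall i x, In i l -> a i <= x <= b i -> Y i x = Y' i x /\ Z i x = Z' i x) ->
  forall p, gset l a b Y Z p <-> gset l a' b' Y' Z' p.
Proof.
  intros Hab HYZ p. split; intros [i [x [Hi [Hx E]]]]; exists i, x;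
    destruct (Hab i Hi) as [Ea Eb].
  - destruct (HYZ i x Hi Hx) as [EY EZ]. rewrite <- EY, <- EZ, <- Ea, <- Eb. auto.
  - rewrite <- Ea, <- Eb in Hx. destruct (HYZ i x Hi Hx) as [EY EZ].
    rewrite EY, EZ. auto.
Qed.

Lemma lip_of_nu (f : R -> R) (C u v : R) :
  1 <= C -> (forall x y, f x - f y <= nu C (x - y)) -> lip_on u v f.
Proof.
  intros HC Hf. exists C. split; [lra|]. intros x y _ _.
  pose proof (Hf x y). pose proof (Hf y x).
  pose proof (nu_le_abs C (x - y) HC). pose proof (nu_le_abs C (y - x) HC).
  rewrite (Rabs_minus_sym y) in *. apply Rabs_le. lra.
Qed.

Lemma nu_strict (f : R -> R) (C : R) :
  1 <= C -> (forall x y, f x - f y <= nu C (x - y)) ->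
  forall x y, x < y -> f x < f y.
Proof.
  intros HC Hf x y Hxy. pose proof (Hf x y) as K. rewrite nu_neg in K by lra.
  assert (0 < / C) by (apply Rinv_0_lt_compat; lra). unfold Rdiv in K. nra.
Qed.

Lemma comparable_product (C x y x' y' : R) :
  1 <= C -> 0 <= x -> 0 <= y -> 0 <= x' -> 0 <= y' ->
  x' <= C * x -> x <= C * x' -> y' <= C * y -> y <= C * y' ->
  comparable (C * C) (x * y) (x' * y').
Proof.
  intros. left. split; [now apply Rmult_le_pos|].
  assert (x' * y' <= (C * x) * (C * y)) by (apply Rmult_le_compat; lra).
  assert (x * y <= (C * x') * (C * y')) by (apply Rmult_le_compat; lra). lra.
Qed.

(** Moving the vertices by [f] changes y at a given abscissa. Chords that interleave are kept apart
    by their trapezoids except near the ends of the overlap, where the order of the vertices decides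
    which chord is above. For all other pairs the plane order survives under [f], with comparable
    differences. *)
Lemma chords_move_separated (I : Type) (l : list I) (a b h : I -> R) (f g : R -> R) (C : R) :
  1 <= C -> (forall x, g (f x) = x) ->
  (forall x y, f x - f y <= nu C (x - y)) -> (forall x y, g x - g y <= nu C (x - y)) ->
  chord_family l a b ->
  (forall i j, In i l -> In j l -> interleaved a b i j -> h i <> h j) ->
  exists e0, 0 < e0 /\ forall e, 0 < e <= e0 -> forall i j, In i l -> In j l ->
    separated (fun q => a i <= q <= b i /\ a j <= q <= b j)
      (fun q => h i * trap e (a i) (b i) q - h j * trap e (a j) (b j) q)
      (fun q => line (a i) (b i) q - line (a j) (b j) q)
      (fun q => line (f (a i)) (f (b i)) (f q) - line (f (a j)) (f (b j)) (f q)).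
Proof.
  intros HC Hgf Hf Hg [Hab Hu] Hh.
  assert (Hup : forall x y, y <= x -> 0 <= f x - f y /\ f x - f y <= C * (x - y) /\
                  x - y <= C * (f x - f y)).
  { intros x y Hxy.
    assert (Hm : f y <= f x).
    { destruct (Req_dec x y); [subst; lra|].
      left; apply (nu_strict f C HC Hf); lra. }
    pose proof (Hf x y) as K. rewrite nu_pos in K by lra.
    pose proof (Hg (f x) (f y)) as K'. rewrite nu_pos, !Hgf in K' by lra. lra. }
  assert (Hst : forall x y, x < y -> f x < f y) by exact (nu_strict f C HC Hf).
  assert (HCC : 1 <= C * C) by nra.
  set (SS := fun e i j =>
    separated (fun q => a i <= q <= b i /\ a j <= q <= b j)
      (fun q => h i * trap e (a i) (b i) q - h j * trap e (a j) (b j) q)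
      (fun q => line (a i) (b i) q - line (a j) (b j) q)
      (fun q => line (f (a i)) (f (b i)) (f q) - line (f (a j)) (f (b j)) (f q))).
  assert (Ssym : forall e i j, SS e i j -> SS e j i).
  { intros e i j. apply separated_sym; [tauto|]. intros q _. lra. }
  assert (LL : forall i u v, lip_on u v (fun q => line (f (a i)) (f (b i)) (f q))).
  { intros i u v. apply lip_on_minus; [|apply lip_on_const].
    apply lip_on_mult; [apply lip_on_const|]. now apply lip_of_nu with C. }
  assert (LD : forall i j u v,
    lip_on u v (fun q => line (a i) (b i) q - line (a j) (b j) q)).
  { intros. apply lip_on_minus; apply lip_line. }
  assert (LD' : forall i j u v, lip_on u v (fun q =>
    line (f (a i)) (f (b i)) (f q) - line (f (a j)) (f (b j)) (f q))).
  { intros. apply lip_on_minus; auto. }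
  assert (Hcross : forall i j, In i l -> In j l -> interleaved a b i j ->
    exists e0, 0 < e0 /\ forall e, 0 < e <= e0 -> SS e i j).
  { intros i j Hi Hj X. pose proof (Hh i j Hi Hj X) as Hne. destruct X as [H1 [H2 H3]].
    pose proof (Hst _ _ H1). pose proof (Hst _ _ H2). pose proof (Hst _ _ H3).
    destruct (separated_plateau (a j) (b i) (Rabs (h i - h j))
      (fun q => line (a i) (b i) q - line (a j) (b j) q)
      (fun q => line (f (a i)) (f (b i)) (f q) - line (f (a j)) (f (b j)) (f q)))
      as [e0 [He0 K]]; auto.
    - apply Rabs_pos_lt. lra.
    (* At the left end of the overlap chord [j] touches the parabola and chord [i] is above it; at
       the right end it is the other way round. Both facts depend on the order of the vertices
       alone, which [f] preserves. *)
    - left. rewrite !line_left, !line_cap. unfold cap. split; nra.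
    - right. rewrite !line_right, !line_cap. unfold cap. split; nra.
    - exists e0. split; [exact He0|]. intros e He.
      destruct (K e (fun q => h i * trap e (a i) (b i) q - h j * trap e (a j) (b j) q) He)
        as [M [HM KM]].
      + intros q Hq. rewrite !trap_plateau by lra. rewrite !Rmult_1_r. lra.
      + exists M. split; [exact HM|]. intros q Hq. apply KM. lra. }
  assert (Hother : forall e i j, In i l -> In j l -> a i <= a j ->
    ~ interleaved a b i j -> SS e i j).
  { intros e i j Hi Hj Ha HX. pose proof (Hab i Hi). pose proof (Hab j Hj).
    destruct (Req_dec (a i) (a j)) as [A|A].
    - destruct (Rtotal_order (b i) (b j)) as [B|[B|B]].
      + apply Ssym. exists (C * C). split; [exact HCC|]. intros q [Q Q']. right.
        (* For secants with a common end the difference factors into two lengths, and [f] changes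
           each of them by a factor between [1/C] and [C]. *)
        replace (line (a j) (b j) q - line (a i) (b i) q) with ((q - a i) * (b j - b i))
          by (unfold line; rewrite <- A; ring).
        replace (line (f (a j)) (f (b j)) (f q) - line (f (a i)) (f (b i)) (f q))
          with ((f q - f (a i)) * (f (b j) - f (b i))) by (unfold line; rewrite <- A; ring).
        destruct (Hup q (a i) ltac:(lra)) as [? [? ?]].
        destruct (Hup (b j) (b i) ltac:(lra)) as [? [? ?]].
        apply comparable_product; lra.
      + assert (i = j) by auto. subst j. apply separated_equal. intros; lra.
      + exists (C * C). split; [exact HCC|]. intros q [Q Q']. right.
        replace (line (a i) (b i) q - line (a j) (b j) q) with ((q - a i) * (b i - b j))
          by (unfold line; rewrite <- A; ring).
        replace (line (f (a i)) (f (b i)) (f q) - line (f (a j)) (f (b j)) (f q))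
          with ((f q - f (a i)) * (f (b i) - f (b j))) by (unfold line; rewrite <- A; ring).
        destruct (Hup q (a i) ltac:(lra)) as [? [? ?]].
        destruct (Hup (b i) (b j) ltac:(lra)) as [? [? ?]].
        apply comparable_product; lra.
    - destruct (Rtotal_order (b i) (a j)) as [B|[B|B]].
      + apply separated_empty. intros q [Q Q']. lra.
      + exists (C * C). split; [exact HCC|]. intros q [Q Q'].
        assert (q = b i) by lra. subst q. rewrite !line_right, B, !line_left.
        right; left. lra.
      + destruct (Rlt_le_dec (b i) (b j)) as [D|D].
        { exfalso. apply HX. split; [lra|auto]. }
        destruct (Req_dec (b i) (b j)) as [E|E].
        * exists (C * C). split; [exact HCC|]. intros q [Q Q']. right.
          replace (line (a i) (b i) q - line (a j) (b j) q) with ((b i - q) * (a j - a i))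
            by (unfold line; rewrite <- E; ring).
          replace (line (f (a i)) (f (b i)) (f q) - line (f (a j)) (f (b j)) (f q))
            with ((f (b i) - f q) * (f (a j) - f (a i))) by (unfold line; rewrite <- E; ring).
          destruct (Hup (b i) q ltac:(lra)) as [? [? ?]].
          destruct (Hup (a j) (a i) ltac:(lra)) as [? [? ?]].
          apply comparable_product; lra.
        * assert (N1 : a i < a j) by lra. assert (N2 : a j < b j) by lra.
          assert (N3 : b j < b i) by lra.
          pose proof (cap_nested_pos _ _ _ _ N1 N2 N3) as P1.
          pose proof (cap_nested_pos _ _ _ _ (Hst _ _ N1) (Hst _ _ N2) (Hst _ _ N3)) as P2.
          destruct (lip_on_bounded _ _ _ (LD i j (a j) (b j))) as [B1 [HB1 K1]].
          destruct (lip_on_bounded _ _ _ (LD' i j (a j) (b j))) as [B2 [HB2 K2]].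
          set (k1 := Rmin (cap (a i) (b i) (a j)) (cap (a i) (b i) (b j))) in *.
          set (k2 := Rmin (cap (f (a i)) (f (b i)) (f (a j))) (cap (f (a i)) (f (b i)) (f (b j)))) in *.
          apply separated_gap with (B := B1 + B2) (k := Rmin k1 k2).
          -- now apply Rmin_glb_lt.
          -- intros q [_ Q]. specialize (K1 q Q). lra.
          -- intros q [_ Q]. specialize (K2 q Q). lra.
          -- intros q [_ Q]. right; left.
             pose proof (Rmin_l k1 k2). pose proof (Rmin_r k1 k2).
             pose proof (line_nested _ _ _ _ q N1 N2 N3 Q). fold k1 in H3.
             assert (Q' : f (a j) <= f q <= f (b j)).
             { destruct (Hup q (a j) ltac:(lra)). destruct (Hup (b j) q ltac:(lra)). lra. }
             pose proof (line_nested _ _ _ _ (f q) (Hst _ _ N1) (Hst _ _ N2) (Hst _ _ N3) Q').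
             fold k2 in H4. lra. }
  destruct (finite_lower (I * I) (list_prod l l)
    (fun ij e => interleaved a b (fst ij) (snd ij) -> SS e (fst ij) (snd ij)) 1)
    as [e0 [He0 K]].
  - lra.
  - intros [i j] Hij. apply in_prod_iff in Hij. simpl.
    destruct (classic (interleaved a b i j)) as [X|X].
    + destruct (Hcross i j) as [e0 [He0 K]]; try tauto. exists e0. auto.
    + exists 1. split; [lra|]. intros; tauto.
  - exists e0. split; [lra|]. intros e He i j Hi Hj. change (SS e i j).
    assert (Hle : forall i j, In i l -> In j l -> a i <= a j -> SS e i j).
    { clear i j Hi Hj. intros i j Hi Hj Ha. destruct (classic (interleaved a b i j)).
      - apply (K (i, j) e); auto. now apply in_prod.
      - now apply Hother. }
    destruct (Rle_dec (a i) (a j)); [auto|]. apply Ssym, Hle; auto; lra.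
Qed.

Lemma chord_family_map (I : Type) (l : list I) (a b : I -> R) (f g : R -> R) :
  (forall x, g (f x) = x) -> (forall x y, x < y -> f x < f y) ->
  chord_family l a b -> chord_family l (fun i => f (a i)) (fun i => f (b i)).
Proof.
  intros Hgf Hf [Hab Hu]. split; [auto|]. intros i j Hi Hj Ea Eb. apply Hu; auto.
  - now rewrite <- (Hgf (a i)), Ea, Hgf.
  - now rewrite <- (Hgf (b i)), Eb, Hgf.
Qed.

(** After flattening to trapezoids, a push along y gives the point over [q] the ordinate that the
    moved chord has over [f q]. The push along x by [f] then makes the chords straight again, and a
    relift returns to sheets. Since only signs at crossings count, the heights may change to [h'] on
    the way. *)
Lemma chords_move (I : Type) (l : list I) (a b h h' : I -> R) (f g : R -> R) (C : R) :
  1 <= C -> (forall x, g (f x) = x) -> (forall x, f (g x) = x) ->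
  (forall x y, f x - f y <= nu C (x - y)) -> (forall x y, g x - g y <= nu C (x - y)) ->
  chord_family l a b ->
  (forall i j, In i l -> In j l -> interleaved a b i j -> same_sign (h i - h j) (h' i - h' j)) ->
  ambient_isotopic (chords l a b h) (chords l (fun i => f (a i)) (fun i => f (b i)) h').
Proof.
  intros HC Hgf Hfg Hf Hg Hab Hh.
  pose proof (nu_strict f C HC Hf) as Hst. pose proof (nu_strict g C HC Hg) as Hst'.
  assert (Hne : forall i j, In i l -> In j l -> interleaved a b i j -> h i <> h j).
  { intros i j Hi Hj X. destruct (Hh i j Hi Hj X); lra. }
  pose proof (chord_family_map I l a b f g Hgf Hst Hab) as Hab'.
  assert (Hint : forall i j, interleaved (fun i => f (a i)) (fun i => f (b i)) i j ->
                   interleaved a b i j).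
  { intros i j [X1 [X2 X3]]. apply Hst' in X1, X2, X3. rewrite !Hgf in *. repeat split; auto. }
  destruct (chords_trap I l a b h Hab Hne) as [e1 [He1 K1]].
  destruct (chords_move_separated I l a b h f g C HC Hgf Hf Hg Hab Hne) as [e2 [He2 K2]].
  (* For the final relift the plateaus must also contain the crossings of the moved chords, pulled
     back by [g]. *)
  destruct (finite_lower (I * I) (list_prod l l)
    (fun ij e => interleaved a b (fst ij) (snd ij) ->
       let w := g (cross (fun i => f (a i)) (fun i => f (b i)) (fst ij) (snd ij)) in
       trap e (a (fst ij)) (b (fst ij)) w = 1 /\ trap e (a (snd ij)) (b (snd ij)) w = 1) 1)
    as [e3 [He3 K3]]; [lra| |].
  { intros [i j] _. simpl.
    destruct (classic (interleaved a b i j)) as [X|X].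
    2:{ exists 1. split; [lra|]. intros; tauto. }
    destruct X as [H1 [H2 H3]].
    pose proof (cross_pt_between _ _ _ _ (Hst _ _ H1) (Hst _ _ H2) (Hst _ _ H3)) as [Hw1 Hw2].
    unfold cross. set (w := cross_pt _ _ _ _) in *.
    apply Hst' in Hw1, Hw2. rewrite !Hgf in *.
    exists (Rmin (g w - a j) (b i - g w)). split; [apply Rmin_glb_lt; lra|].
    intros e He _. pose proof (Rmin_l (g w - a j) (b i - g w)).
    pose proof (Rmin_r (g w - a j) (b i - g w)). split; apply trap_plateau; lra. }
  set (e := Rmin e1 (Rmin e2 e3)).
  assert (He : 0 < e /\ e <= e1 /\ e <= e2 /\ e <= e3).
  { unfold e. pose proof (Rmin_l e1 (Rmin e2 e3)). pose proof (Rmin_r e1 (Rmin e2 e3)).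
    pose proof (Rmin_l e2 e3). pose proof (Rmin_r e2 e3).
    split; [repeat apply Rmin_glb_lt; lra|lra]. }
  apply ambient_isotopic_trans with (1 := K1 e ltac:(lra)).
  apply ambient_isotopic_trans with (B :=
    gset l a b (fun i x => line (f (a i)) (f (b i)) (f x))
      (fun i x => h i * trap e (a i) (b i) x)).
  { apply graph_push_y.
    - intros i Hi. apply lip_on_mult; [apply lip_on_const|apply lip_trap].
    - intros i Hi. apply lip_line.
    - intros i Hi. apply lip_on_minus; [|apply lip_on_const].
      apply lip_on_mult; [apply lip_on_const|]. now apply lip_of_nu with C.
    - intros i j Hi Hj. apply separated_pair_ok.
      exact (K2 e ltac:(lra) i j Hi Hj). }
  apply ambient_isotopic_trans with (1 := graph_push_x I l a b _ _ f g C HC Hgf Hfg Hf Hg).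
  apply ambient_isotopic_sym.
  eapply ambient_isotopic_ext; [intros z; reflexivity| |apply chords_relift with
    (Z := fun i x => h i * trap e (a i) (b i) (g x)); [exact Hab'| | |]].
  - intros z. apply gset_ext; [auto|]. intros i x _ _. now rewrite Hfg.
  - intros i Hi. apply lip_on_mult; [apply lip_on_const|].
    apply lip_on_comp with (a' := a i) (b' := b i) (f := trap e (a i) (b i)) (g := g).
    + intros x Hx. rewrite <- (Hgf (a i)), <- (Hgf (b i)).
      destruct Hx as [X1 X2]. split; apply Rnot_lt_le; intros N; apply Hst in N;
        rewrite !Hfg in N; lra.
    + apply lip_trap.
    + now apply lip_of_nu with C.
  - intros i j q Hi Hj Ei Ej. destruct Hab as [Hlt _].
    pose proof (Hlt i Hi). pose proof (Hlt j Hj).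
    rewrite !trap_end; try lra.
    + destruct Ej; subst; rewrite Hgf; auto.
    + destruct Ei; subst; rewrite Hgf; auto.
  - intros i j Hi Hj X. apply Hint in X. destruct (K3 (i, j) e) as [E1 E2]; auto.
    { now apply in_prod. } { lra. }
    simpl in E1, E2. rewrite E1, E2, !Rmult_1_r.
    apply same_sign_sym. auto.
Qed.


(** * Removing a vertex of valency two *)

Lemma separated_union (J J1 J2 : R -> Prop) (D U U' : R -> R) :
  (forall q, J q -> J1 q \/ J2 q) ->
  separated J1 D U U' -> separated J2 D U U' -> separated J D U U'.
Proof.
  intros HJ [K1 [HK1 H1]] [K2 [HK2 H2]]. exists (Rmax K1 K2).
  pose proof (Rmax_l K1 K2). pose proof (Rmax_r K1 K2).
  split; [lra|]. intros q Hq. pose proof (Rabs_pos (D q)).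
  destruct (HJ q Hq) as [X|X]; [destruct (H1 q X) as [E|E]|destruct (H2 q X) as [E|E]].
  - left. nra.
  - right. now apply comparable_mono with K1.
  - left. nra.
  - right. now apply comparable_mono with K2.
Qed.

(** Variant of [separated_plateau] for an overlap whose right end is a common vertex: there [D],
    [D'] and the separating [P] all vanish, so [P] is only asked to open linearly. *)
Lemma separated_plateau_vertex (u v k : R) (D D' : R -> R) :
  u < v -> 0 < k -> lip_on u v D -> lip_on u v D' ->
  same_sign (D u) (D' u) -> D v = 0 -> D' v = 0 ->
  exists e0, 0 < e0 /\ forall e (P : R -> R), 0 < e <= e0 ->
    (forall q, u + e <= q <= v -> k * Rmin 1 (v - q) <= Rabs (P q)) ->
    separated (fun q => u <= q <= v) P D D'.
Proof.
  intros Huv Hk HD HD' Su Dv Dv'.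
  destruct (lip_pair_same_sign u v u v u D (fun _ => 0) D' (fun _ => 0))
    as [d1 [k1 [Hd1 [Hk1 K1]]]]; auto using lip_on_const; try lra.
  { now rewrite !Rminus_0_r. }
  destruct (lip_on_bounded _ _ _ HD) as [B [HB Bf]].
  destruct (lip_on_bounded _ _ _ HD') as [B' [HB' Bf']].
  destruct HD as [L [HL LD]], HD' as [L' [HL' LD']].
  exists d1. split; [exact Hd1|]. intros e P He HP.
  apply separated_union with (J1 := fun q => u <= q <= v /\ q <= u + e)
    (J2 := fun q => u + e <= q <= v).
  - intros q Hq. destruct (Rle_dec q (u + e)); [left|right]; lra.
  - apply separated_gap with (B := B + B') (k := k1); [exact Hk1| | |].
    + intros q [Hq _]. specialize (Bf q Hq). lra.
    + intros q [Hq _]. specialize (Bf' q Hq). lra.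
    + intros q [Hq Hqe]. right.
      destruct (K1 q Hq Hq); [rewrite Rabs_right; lra|left|right]; lra.
  - set (M := B + B' + L + L').
    assert (HM : 0 <= M) by (unfold M; lra).
    assert (HK : M <= (1 + M / k) * k).
    { rewrite Rmult_plus_distr_r. replace (M / k * k) with M by (field; lra). lra. }
    exists (1 + M / k). split.
    { assert (0 <= M / k); [|lra]. apply Rmult_le_pos; [exact HM|].
      left; now apply Rinv_0_lt_compat. }
    intros q Hq. left. assert (Hq' : u <= q <= v) by lra.
    pose proof (LD q v Hq' ltac:(lra)) as E. pose proof (LD' q v Hq' ltac:(lra)) as E'.
    rewrite Dv, Rminus_0_r in E. rewrite Dv', Rminus_0_r in E'.
    rewrite (Rabs_left1 (q - v)) in E, E' by lra.
    specialize (Bf q Hq'). specialize (Bf' q Hq'). specialize (HP q Hq).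
    assert (Hmin : Rabs (D q) + Rabs (D' q) <= M * Rmin 1 (v - q)).
    { unfold Rmin. destruct (Rle_dec 1 (v - q)); unfold M; nra. }
    assert (H0 : 0 <= Rmin 1 (v - q)) by (apply Rmin_glb; lra).
    assert (0 < 1 + M / k).
    { assert (0 <= M / k); [|lra]. apply Rmult_le_pos; [exact HM|].
      left; now apply Rinv_0_lt_compat. }
    apply Rle_trans with (1 := Hmin).
    apply Rle_trans with ((1 + M / k) * (k * Rmin 1 (v - q))).
    + rewrite <- Rmult_assoc. apply Rmult_le_compat_r; assumption.
    + apply Rmult_le_compat_l; lra.
Qed.

(** The chord created by a contraction joins the position of one vertex to another but keeps the
    height of an older edge, so chords are recorded by their ends and height instead of by an
    edge. *)
Definition chord : Type := (R * R * R)%type.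
Definition lo (c : chord) : R := fst (fst c).
Definition hi (c : chord) : R := snd (fst c).
Definition ht (c : chord) : R := snd c.
Definition chord_set (l : list chord) : pset := chords l lo hi ht.

(** The broken path from [y] through [i] to [o]: inscribed in a convex curve, it is the maximum of
    its two secants. *)
Definition bent (y i o x : R) : R := Rmax (line y i x) (line i o x).

Lemma bent_left (y i o x : R) : y < i -> i < o -> x <= i -> bent y i o x = line y i x.
Proof. intros. apply Rmax_left. unfold line. nra. Qed.

Lemma bent_right (y i o x : R) : y < i -> i < o -> i <= x -> bent y i o x = line i o x.
Proof. intros. apply Rmax_right. unfold line. nra. Qed.

Lemma lip_bent (y i o u v : R) : lip_on u v (bent y i o).
Proof. apply lip_on_max; apply lip_line. Qed.

(** Straightening the broken path at the constant trapezoid height [h] must not run into the chord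
    [c]. If [c] contains [y] strictly inside, or ends at [o], the different heights keep them apart.
    Otherwise [c] starts at [y] or lies inside, below the path before and after, or meets it at most
    in [y]. *)
Lemma bent_separated (y i o h : R) (c : chord) :
  y < i -> i < o -> lo c < hi c -> lo c < i -> (hi c < i \/ hi c = o) ->
  ~ (lo c = y /\ hi c = o) ->
  (hi c = o -> ht c <> h) -> (lo c < y -> y < hi c -> ht c <> h) ->
  exists e0, 0 < e0 /\ forall e, 0 < e <= e0 ->
    separated (fun q => y <= q <= o /\ lo c <= q <= hi c)
      (fun q => h * trap e y o q - ht c * trap e (lo c) (hi c) q)
      (fun q => bent y i o q - line (lo c) (hi c) q)
      (fun q => line y o q - line (lo c) (hi c) q).
Proof.
  destruct c as [[a b] t]. unfold lo, hi, ht; simpl.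
  intros Hyi Hio Hab Hai Hb Hne Ho Hc.
  assert (LD : forall u v, lip_on u v (fun q => bent y i o q - line a b q)).
  { intros. apply lip_on_minus; [apply lip_bent|apply lip_line]. }
  assert (LD' : forall u v, lip_on u v (fun q => line y o q - line a b q)).
  { intros. apply lip_on_minus; apply lip_line. }
  destruct Hb as [Hb|Hb].
  - destruct (Rtotal_order b y) as [B|[B|B]].
    + exists 1. split; [lra|]. intros e _. apply separated_empty. intros q [Q Q']. lra.
    + exists 1. split; [lra|]. intros e _. exists 1. split; [lra|].
      intros q [Q Q']. assert (q = y) by lra. subst q. right; left.
      rewrite bent_left by lra. rewrite B, !line_left, line_right. lra.
    + destruct (Rtotal_order a y) as [A|[A|A]].
      * destruct (separated_plateau y b (Rabs (h - t))
          (fun q => bent y i o q - line a b q) (fun q => line y o q - line a b q))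
          as [e0 [He0 K]]; auto.
        -- apply Rabs_pos_lt. specialize (Hc A B). lra.
        -- right. rewrite bent_left, !line_left, !line_cap by lra. unfold cap. nra.
        -- left. rewrite bent_left, !line_right, !line_cap by lra. unfold cap.
           split; nra.
        -- exists e0. split; [exact He0|]. intros e He.
           destruct (K e (fun q => h * trap e y o q - t * trap e a b q) He) as [M [HM KM]].
           ++ intros q Hq. rewrite !trap_plateau by lra. rewrite !Rmult_1_r. lra.
           ++ exists M. split; [exact HM|]. intros q Hq. apply KM. lra.
      * exists 1. split; [lra|]. intros e _. subst a.
        set (C := (o - b) / (i - b)).
        assert (HC : o - b = C * (i - b)) by (unfold C; field; lra).
        assert (HC1 : 1 <= C).
        { apply Rmult_le_reg_r with (i - b); [lra|]. rewrite <- HC. lra. }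
        exists (C * C). split; [nra|]. intros q [Q Q']. right.
        rewrite bent_left by lra.
        replace (line y i q - line y b q) with ((q - y) * (i - b)) by (unfold line; ring).
        replace (line y o q - line y b q) with ((q - y) * (o - b)) by (unfold line; ring).
        apply comparable_product; nra.
      * exists 1. split; [lra|]. intros e _.
        pose proof (cap_nested_pos y i a b A Hab Hb) as P1.
        pose proof (cap_nested_pos y o a b A Hab ltac:(lra)) as P2.
        destruct (lip_on_bounded _ _ _ (LD a b)) as [B1 [HB1 K1]].
        destruct (lip_on_bounded _ _ _ (LD' a b)) as [B2 [HB2 K2]].
        set (k1 := Rmin (cap y i a) (cap y i b)) in *.
        set (k2 := Rmin (cap y o a) (cap y o b)) in *.
        apply separated_gap with (B := B1 + B2) (k := Rmin k1 k2).
        -- now apply Rmin_glb_lt.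
        -- intros q [_ Q]. specialize (K1 q Q). lra.
        -- intros q [_ Q]. specialize (K2 q Q). lra.
        -- intros q [_ Q]. right; left. rewrite bent_left by lra.
           pose proof (Rmin_l k1 k2). pose proof (Rmin_r k1 k2).
           pose proof (line_nested y i a b q A Hab Hb Q). fold k1 in H1.
           pose proof (line_nested y o a b q A Hab ltac:(lra) Q). fold k2 in H2. lra.
  - subst b. specialize (Ho eq_refl). clear Hc.
    assert (Hay : a <> y) by tauto. clear Hne.
    (* The overlap runs from the later of the two left ends to the common vertex [o]. At its left
       end the sign of the difference is that of the order of [y] and [a]. *)
    set (u := Rmax y a).
    assert (Hu : y <= u /\ a <= u /\ u < i).
    { unfold u, Rmax. destruct (Rle_dec y a); lra. }
    destruct (separated_plateau_vertex u o (Rabs (h - t))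
      (fun q => bent y i o q - line a o q) (fun q => line y o q - line a o q))
      as [e0 [He0 K]]; auto; try lra.
    + apply Rabs_pos_lt. lra.
    + rewrite bent_left by lra. unfold u, Rmax. destruct (Rle_dec y a).
      * left. rewrite !line_left, !line_cap. unfold cap. split; nra.
      * right. rewrite !line_left, !line_cap. unfold cap. split; nra.
    + rewrite bent_right, !line_right by lra. lra.
    + rewrite !line_right. lra.
    (* With [e] at most 1 the falling sides have slope at least 1 in absolute value, which gives the
       linear opening at [o]. The bound [(o - i) / 2] ensures that within [e] of [o] both trapezoids
       are on their right sides. *)
    + exists (Rmin e0 (Rmin 1 ((o - i) / 2))). split.
      { repeat apply Rmin_glb_lt; lra. }
      intros e He.
      pose proof (Rmin_l e0 (Rmin 1 ((o - i) / 2))). pose proof (Rmin_r e0 (Rmin 1 ((o - i) / 2))).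
      pose proof (Rmin_l 1 ((o - i) / 2)). pose proof (Rmin_r 1 ((o - i) / 2)).
      destruct (K e (fun q => h * trap e y o q - t * trap e a o q) ltac:(lra)) as [M [HM KM]].
      * intros q Hq. destruct (Rle_dec q (o - e)) as [E|E].
        -- rewrite !trap_plateau by lra. rewrite !Rmult_1_r.
           pose proof (Rmin_l 1 (o - q)). pose proof (Rabs_pos (h - t)). nra.
        -- rewrite !trap_right by lra. rewrite <- Rmult_minus_distr_r, Rabs_mult.
           apply Rmult_le_compat_l; [apply Rabs_pos|].
           assert (o - q <= (o - q) / e).
           { apply Rmult_le_reg_r with e; [lra|].
             replace ((o - q) / e * e) with (o - q) by (field; lra). nra. }
           rewrite Rabs_right by lra.
           pose proof (Rmin_r 1 (o - q)). lra.
      * exists M. split; [exact HM|]. intros q Hq. apply KM.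
        unfold u, Rmax. destruct (Rle_dec y a); lra.
Qed.

(* Removing a vertex [i] of valency two whose neighbour [o] follows it
   immediately at the right end.  On the chord family through [i], the vertex
   [i] is first raised to the level of the trapezoid over [[y, o]]; seen from the
   side, the bent path from [y] through [i] to [o] is then pushed straight. *)
Lemma chord_set_contract (l : list chord) (y i o h h0 : R) :
  y < i -> i < o ->
  (forall c, In c l -> lo c < i /\ (hi c < i \/ hi c = o)) ->
  (forall c, In c l -> hi c = o -> ht c <> h) ->
  (forall c, In c l -> lo c < y -> y < hi c -> ht c <> h) ->
  (forall c d, In c l -> In d l -> interleaved lo hi c d -> ht c <> ht d) ->
  chord_family ((i, o, h0) :: (y, i, h) :: l) lo hi ->
  chord_family ((y, o, h) :: l) lo hi ->
  ambient_isotopic (chord_set ((i, o, h0) :: (y, i, h) :: l))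
                   (chord_set ((y, o, h) :: l)).
Proof.
  intros Hyi Hio Hl Hho Hhy Hint HF HF'.
  set (E := (i, o, h0) :: (y, i, h) :: l) in *. set (E' := (y, o, h) :: l) in *.
  set (star := (y, o, h) : chord).
  (* Plane projection for the new family before straightening: the chord from [y] to [o] still makes
     its bend at [i]. *)
  set (bw := fun (c : chord) => if Req_EM_T (lo c) y then
       if Req_EM_T (hi c) o then bent y i o else line (lo c) (hi c)
       else line (lo c) (hi c)).
  assert (Hstar : forall c, In c E' -> lo c = y -> hi c = o -> c = star).
  { intros c Hc E1 E2. apply HF'; auto. now left. }
  assert (bw_star : bw star = bent y i o).
  { unfold bw, star, lo, hi; simpl.
    destruct (Req_EM_T y y); [|lra]. destruct (Req_EM_T o o); [reflexivity|lra]. }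
  assert (bw_other : forall c, ~ (lo c = y /\ hi c = o) -> bw c = line (lo c) (hi c)).
  { intros c Hc. unfold bw. destruct (Req_EM_T (lo c) y); [|reflexivity].
    destruct (Req_EM_T (hi c) o); [tauto|reflexivity]. }
  assert (Hcase : forall c, In c E' -> c = star \/ (In c l /\ ~ (lo c = y /\ hi c = o))).
  { intros c Hc. destruct (classic (lo c = y /\ hi c = o)) as [[X X']|X].
    - left. now apply Hstar.
    - right. split; [|exact X]. destruct Hc as [<-|Hc]; [|exact Hc].
      exfalso. apply X. now unfold lo, hi. }
  assert (HE'lt : forall c, In c l -> lo c < hi c).
  { intros c Hc. apply HF'. now right. }
  assert (Hne' : forall c d, In c E' -> In d E' -> interleaved lo hi c d -> ht c <> ht d).
  { intros c d Hc Hd X.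
    destruct (Hcase c Hc) as [->|[Hc' Nc]], (Hcase d Hd) as [->|[Hd' Nd]].
    - destruct X; lra.
    - destruct X as [X1 [X2 X3]]. unfold star, lo, hi in *; simpl in *.
      exfalso. destruct (Hl d Hd') as [_ [Y|Y]]; unfold lo, hi in *; lra.
    - destruct X as [X1 [X2 X3]]. unfold star, lo, hi, ht in *; simpl in *. eapply Hhy; eauto.
    - auto. }
  destruct (chords_trap chord E' lo hi ht HF' Hne') as [e1 [He1 K1]].
  destruct (finite_lower chord l (fun c e => ~ (lo c = y /\ hi c = o) ->
    separated (fun q => y <= q <= o /\ lo c <= q <= hi c)
      (fun q => h * trap e y o q - ht c * trap e (lo c) (hi c) q)
      (fun q => bent y i o q - line (lo c) (hi c) q)
      (fun q => line y o q - line (lo c) (hi c) q)) 1) as [e2 [He2 K2]]; [lra| |].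
  { intros c Hc. destruct (classic (lo c = y /\ hi c = o)) as [X|X].
    - exists 1. split; [lra|]. intros; tauto.
    - destruct (bent_separated y i o h c) as [e0 [He0 K]]; auto; try apply Hl; auto.
      exists e0. auto. }
  (* Both edges at [i] receive the height profile of the future chord from [y] to [o]; [i] itself is
     thereby lifted off the level 0. *)
  set (Zs := fun e (c : chord) => if Req_EM_T (lo c) i then fun x => h * trap e y o x
       else if Req_EM_T (hi c) i then fun x => h * trap e y o x
       else fun x => ht c * trap e (lo c) (hi c) x).
  assert (Zs_io : forall e c, In c E -> lo c = i -> Zs e c = fun x => h * trap e y o x).
  { intros e c Hc X. unfold Zs. destruct (Req_EM_T (lo c) i); [reflexivity|tauto]. }
  assert (Zs_yi : forall e c, In c E -> hi c = i -> Zs e c = fun x => h * trap e y o x).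
  { intros e c Hc X. unfold Zs. destruct (Req_EM_T (lo c) i); [reflexivity|].
    destruct (Req_EM_T (hi c) i); [reflexivity|tauto]. }
  assert (Zs_l : forall e c, In c l -> Zs e c = fun x => ht c * trap e (lo c) (hi c) x).
  { intros e c Hc. destruct (Hl c Hc) as [A B]. unfold Zs.
    destruct (Req_EM_T (lo c) i); [lra|]. destruct (Req_EM_T (hi c) i); [lra|reflexivity]. }
  assert (Zs_first : forall e, Zs e (i, o, h0) = fun x => h * trap e y o x).
  { intros e. apply Zs_io; [now left|reflexivity]. }
  assert (Zs_second : forall e, Zs e (y, i, h) = fun x => h * trap e y o x).
  { intros e. apply Zs_yi; [right; now left|reflexivity]. }
  assert (Zs_lip : forall e c u v, lip_on u v (Zs e c)).
  { intros e c u v. unfold Zs. destruct (Req_EM_T (lo c) i); [|destruct (Req_EM_T (hi c) i)];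
      apply lip_on_mult; auto using lip_on_const, lip_trap. }
  (* No vertex lies between [i] and [o], so the chord joining them takes part in no crossing, and
     its height may be altered freely. *)
  assert (HneE : forall c d, In c E -> In d E -> interleaved lo hi c d ->
      ht c <> ht d /\ lo c <> i /\ lo d <> i).
  { intros c d Hc Hd [X1 [X2 X3]].
    destruct Hc as [<-|[<-|Hc]], Hd as [<-|[<-|Hd]];
      unfold lo, hi, ht in *; simpl in *; try lra;
      try (destruct (Hl d Hd) as [D1 [D2|D2]]; unfold lo, hi in *);
      try (destruct (Hl c Hc) as [C1 [C2|C2]]; unfold lo, hi in *); try lra.
    - split; [|lra]. intros N. apply (Hho d Hd); auto.
    - split; [|lra]. apply (Hhy c Hc); auto.
    - split; [|lra]. apply (Hint c d Hc Hd); repeat split; auto.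
    - split; [|lra]. apply (Hint c d Hc Hd); repeat split; auto. }
  destruct (finite_lower (chord * chord) (list_prod E E)
    (fun cd e => interleaved lo hi (fst cd) (snd cd) ->
       Zs e (fst cd) (cross lo hi (fst cd) (snd cd)) = ht (fst cd) /\
       Zs e (snd cd) (cross lo hi (fst cd) (snd cd)) = ht (snd cd)) 1)
    as [e3 [He3 K3]]; [lra| |].
  { intros [c d] Hcd. apply in_prod_iff in Hcd. destruct Hcd as [Hc Hd]. simpl.
    destruct (classic (interleaved lo hi c d)) as [X|X].
    2:{ exists 1. split; [lra|]. intros; tauto. }
    destruct (HneE c d Hc Hd X) as [_ [Ci Di]].
    destruct X as [X1 [X2 X3]].
    pose proof (cross_pt_between _ _ _ _ X1 X2 X3) as Hw.
    unfold cross. set (w := cross_pt _ _ _ _) in *.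
    assert (Hpl : forall f e, In f E -> lo f <> i -> 0 < e -> lo f + e <= w -> w <= hi f - e ->
                    Zs e f w = ht f).
    { intros f e Hf Fi He A B. destruct Hf as [<-|[<-|Hf]].
      - now elim Fi.
      - rewrite Zs_second. unfold lo, hi, ht in A, B |- *; simpl in A, B |- *.
        rewrite trap_plateau by lra. ring.
      - rewrite Zs_l by exact Hf. rewrite trap_plateau by lra. ring. }
    exists (Rmin (w - lo d) (hi c - w)). split; [apply Rmin_glb_lt; lra|].
    intros e He _. pose proof (Rmin_l (w - lo d) (hi c - w)).
    pose proof (Rmin_r (w - lo d) (hi c - w)). split; apply Hpl; auto; lra. }
  set (e := Rmin e1 (Rmin e2 e3)).
  assert (He : 0 < e /\ e <= e1 /\ e <= e2 /\ e <= e3).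
  { unfold e. pose proof (Rmin_l e1 (Rmin e2 e3)). pose proof (Rmin_r e1 (Rmin e2 e3)).
    pose proof (Rmin_l e2 e3). pose proof (Rmin_r e2 e3).
    split; [repeat apply Rmin_glb_lt; lra|lra]. }
  clearbody e.
  apply ambient_isotopic_trans with (B := gset E lo hi (lines lo hi) (Zs e)).
  { apply chords_relift; auto.
    - assert (Hv : forall c q, In c E -> is_end lo hi c q ->
        Zs e c q = if Req_EM_T q i then h * trap e y o i else 0).
      { intros c q Hc Hq. destruct Hc as [<-|[<-|Hc]].
        - rewrite Zs_first. destruct Hq as [->| ->]; unfold lo, hi; simpl.
          + destruct (Req_EM_T i i); lra.
          + destruct (Req_EM_T o i); [lra|]. rewrite trap_end by lra. ring.
        - rewrite Zs_second. destruct Hq as [->| ->]; unfold lo, hi; simpl.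
          + destruct (Req_EM_T y i); [lra|]. rewrite trap_end by lra. ring.
          + destruct (Req_EM_T i i); lra.
        - rewrite Zs_l by exact Hc. destruct (Hl c Hc) as [A B]. pose proof (HE'lt c Hc).
          rewrite trap_end by (lra || exact Hq).
          destruct Hq as [->| ->]; destruct (Req_EM_T _ i); lra. }
      intros c d q Hc Hd Ec Ed. now rewrite !Hv.
    - intros c d Hc Hd X. destruct (K3 (c, d) e) as [Z1 Z2]; auto.
      { now apply in_prod. } { lra. }
      simpl in Z1, Z2. rewrite Z1, Z2. apply same_sign_refl.
      pose proof (HneE c d Hc Hd X). lra. }
  (* No motion here: the two lifted edges at [i] together are the same set as the single bent
     chord. *)
  apply ambient_isotopic_trans with (B :=
    gset E' lo hi bw (fun c x => ht c * trap e (lo c) (hi c) x)).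
  { apply ambient_isotopic_ext with
      (A := gset E lo hi (lines lo hi) (Zs e)) (B := gset E lo hi (lines lo hi) (Zs e));
      [tauto| |apply ambient_isotopic_refl].
    intros p. split.
    - intros [c [x [Hc [Hx ->]]]]. destruct Hc as [<-|[<-|Hc]].
      + exists star, x. unfold lo, hi in Hx; simpl in Hx.
        rewrite Zs_first, bw_star, bent_right by lra.
        split; [now left|]. split; [unfold star, lo, hi; simpl; lra|reflexivity].
      + exists star, x. unfold lo, hi in Hx; simpl in Hx.
        rewrite Zs_second, bw_star, bent_left by lra.
        split; [now left|]. split; [unfold star, lo, hi; simpl; lra|reflexivity].
      + exists c, x. rewrite Zs_l by exact Hc. destruct (classic (lo c = y /\ hi c = o)) as [X|X].
        * exfalso. destruct X as [X1 X2].
          apply (Hho c Hc X2). rewrite (Hstar c); auto. now right.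
        * rewrite bw_other by exact X. split; [now right|]. split; [exact Hx|reflexivity].
    - intros [c [x [Hc [Hx ->]]]]. destruct (Hcase c Hc) as [->|[Hc' Nc]].
      + rewrite bw_star. unfold star, lo, hi, ht in Hx; simpl in Hx.
        destruct (Rle_dec x i).
        * exists (y, i, h), x. rewrite Zs_second, bent_left by lra.
          split; [right; now left|]. split; [unfold lo, hi; simpl; lra|reflexivity].
        * exists (i, o, h0), x. rewrite Zs_first, bent_right by lra.
          split; [now left|]. split; [unfold lo, hi; simpl; lra|reflexivity].
      + exists c, x. rewrite Zs_l, bw_other by assumption.
        split; [right; now right|]. split; [exact Hx|reflexivity]. }
  apply ambient_isotopic_trans with (2 := ambient_isotopic_sym _ _ (K1 e ltac:(lra))).
  apply graph_push_y.
  - intros c Hc. apply lip_on_mult; [apply lip_on_const|apply lip_trap].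
  - intros c Hc. unfold bw. destruct (Req_EM_T (lo c) y); [destruct (Req_EM_T (hi c) o)|];
      auto using lip_bent, lip_line.
  - intros c Hc. apply lip_line.
  - intros c d Hc Hd. apply separated_pair_ok. unfold lines.
    destruct (Hcase c Hc) as [->|[Hc' Nc]], (Hcase d Hd) as [->|[Hd' Nd]].
    + apply separated_equal. intros; lra.
    + rewrite bw_star, bw_other by exact Nd. exact (K2 d e Hd' ltac:(lra) Nd).
    + rewrite bw_star, bw_other by exact Nc.
      refine (separated_sym _ _ _ _ _ _ _ _ _ _ (K2 c e Hc' ltac:(lra) Nc)).
      * intros q Hq. unfold star, lo, hi in *; simpl in *. tauto.
      * intros q _. unfold star, lo, hi, ht; simpl. lra.
    + rewrite !bw_other by assumption. apply separated_equal. reflexivity.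
Qed.


(** * From the circle to the parabola *)

Definition elo (X : nat -> R) (e : nat * nat) : R := Rmin (X (fst e)) (X (snd e)).
Definition ehi (X : nat -> R) (e : nat * nat) : R := Rmax (X (fst e)) (X (snd e)).

Lemma line_min_max (a b x : R) : line (Rmin a b) (Rmax a b) x = line a b x.
Proof.
  unfold Rmin, Rmax, line. destruct (Rle_dec a b); ring.
Qed.

(* Rank of the vertex [u] when the circle is cut just after the vertex [r]. *)
Definition cut_rank (n r u : nat) : nat :=
  if Nat.leb u r then (u - 1 + n - r)%nat else (u - 1 - r)%nat.

(** Half the angle from the cut to the vertex. The cut is midway between two vertices, whence the
    [/ 2], and this keeps the value strictly between 0 and [PI]. *)
Definition half_angle (n r u : nat) : R := PI * (INR (cut_rank n r u) + / 2) / INR n.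

(* The projective map [(x, y) |-> (x / (1 - y), (1 + y) / (1 - y))] takes the
   circle minus (0, 1) to the parabola, hence chords to chords.  After a rotation
   bringing the cut to (0, 1) it sends the vertex [u] to the abscissa [cut_pos]. *)
Definition cut_pos (n r u : nat) : R :=
  - (cos (half_angle n r u) / sin (half_angle n r u)).

Lemma half_angle_bounds (n r u : nat) :
  (r <= n)%nat -> (1 <= u <= n)%nat -> 0 < half_angle n r u < PI.
Proof.
  intros Hr Hu.
  assert (Hk : (cut_rank n r u + 1 <= n)%nat).
  { unfold cut_rank. destruct (Nat.leb_spec u r); lia. }
  apply le_INR in Hk. rewrite plus_INR in Hk. simpl in Hk.
  pose proof (pos_INR (cut_rank n r u)). pose proof PI_RGT_0. unfold half_angle. split.
  - apply Rdiv_lt_0_compat; [nra|lra].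
  - apply Rmult_lt_reg_r with (INR n); [lra|].
    unfold Rdiv. rewrite Rmult_assoc, Rinv_l by lra. nra.
Qed.

Lemma cut_pos_lt (n r u v : nat) :
  (r <= n)%nat -> (1 <= u <= n)%nat -> (1 <= v <= n)%nat ->
  (cut_rank n r u < cut_rank n r v)%nat -> cut_pos n r u < cut_pos n r v.
Proof.
  intros Hr Hu Hv H. apply lt_INR in H.
  pose proof (half_angle_bounds n r u Hr Hu) as Bu.
  pose proof (half_angle_bounds n r v Hr Hv) as Bv.
  assert (L : half_angle n r u < half_angle n r v).
  { unfold half_angle, Rdiv. apply Rmult_lt_compat_r.
    - apply Rinv_0_lt_compat. apply lt_0_INR. lia.
    - pose proof PI_RGT_0. nra. }
  unfold cut_pos. set (a := half_angle n r u) in *. set (b := half_angle n r v) in *.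
  pose proof (sin_gt_0 a ltac:(lra) ltac:(lra)) as Sa.
  pose proof (sin_gt_0 b ltac:(lra) ltac:(lra)) as Sb.
  pose proof (sin_gt_0 (b - a) ltac:(lra) ltac:(lra)) as Sd.
  rewrite sin_minus in Sd.
  apply Ropp_lt_contravar. apply Rmult_lt_reg_r with (sin a * sin b); [nra|].
  replace (cos b / sin b * (sin a * sin b)) with (cos b * sin a) by (field; lra).
  replace (cos a / sin a * (sin a * sin b)) with (cos a * sin b) by (field; lra). lra.
Qed.

(** The midpoint of the arc following the vertex [r] has angle [2 * PI * (r - 1/2) / n]; adding the
    shift takes it to [PI / 2]. *)
Definition cut_shift (n r : nat) : R := PI / 2 + (PI - 2 * PI * INR r) / INR n.

Lemma cut_angle (n r u : nat) : (r <= n)%nat -> (1 <= u <= n)%nat ->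
  cos (vangle n u + cut_shift n r) = - sin (2 * half_angle n r u) /\
  sin (vangle n u + cut_shift n r) = cos (2 * half_angle n r u).
Proof.
  intros Hr Hu. assert (Hn : INR n <> 0) by (apply not_0_INR; lia).
  assert (E : vangle n u + cut_shift n r = PI / 2 + 2 * half_angle n r u \/
              vangle n u + cut_shift n r = PI / 2 + 2 * half_angle n r u - 2 * PI).
  { unfold vangle, cut_shift, half_angle, cut_rank. destruct (Nat.leb_spec u r).
    - right. rewrite (minus_INR (u - 1 + n)), plus_INR by lia. field. exact Hn.
    - left. rewrite (minus_INR (u - 1)) by lia. field. exact Hn. }
  assert (P : forall x, cos (x - 2 * PI) = cos x /\ sin (x - 2 * PI) = sin x).
  { intros x. rewrite cos_minus, sin_minus, cos_2PI, sin_2PI. split; ring. }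
  assert (Q : forall x, cos (PI / 2 + x) = - sin x /\ sin (PI / 2 + x) = cos x).
  { intros x. rewrite cos_plus, sin_plus, cos_PI2, sin_PI2. split; ring. }
  destruct E as [-> | ->].
  - apply Q.
  - destruct (P (PI / 2 + 2 * half_angle n r u)) as [-> ->]. apply Q.
Qed.

Definition ux (n r u : nat) : R := cos (vangle n u + cut_shift n r).
Definition uy (n r u : nat) : R := sin (vangle n u + cut_shift n r).

(** The projective map in homogeneous form. The factor [1 - uy] is the weight that the vertex
    carries when convex combinations are mapped. *)
Lemma cut_vertex (n r u : nat) : (r <= n)%nat -> (1 <= u <= n)%nat ->
  0 < 1 - uy n r u /\ -1 <= uy n r u /\ -1 <= ux n r u <= 1 /\
  ux n r u = (1 - uy n r u) * cut_pos n r u /\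
  1 + uy n r u = (1 - uy n r u) * (cut_pos n r u * cut_pos n r u).
Proof.
  intros Hr Hu. pose proof (half_angle_bounds n r u Hr Hu) as B.
  destruct (cut_angle n r u Hr Hu) as [E1 E2].
  pose proof (COS_bound (vangle n u + cut_shift n r)).
  pose proof (SIN_bound (vangle n u + cut_shift n r)).
  unfold ux, uy. split; [|split; [lra|split; [lra|]]].
  - rewrite E2, cos_2a_sin. pose proof (sin_gt_0 (half_angle n r u) ltac:(lra) ltac:(lra)). nra.
  - rewrite E1, E2. unfold cut_pos. set (a := half_angle n r u) in *.
    pose proof (sin_gt_0 a ltac:(lra) ltac:(lra)) as S.
    pose proof (sin2_cos2 a) as T. unfold Rsqr in T.
    split.
    + rewrite sin_2a, cos_2a_sin. field. lra.
    + rewrite cos_2a_sin.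
      replace (1 - (1 - 2 * sin a * sin a)) with (2 * (sin a * sin a)) by ring.
      replace (2 * (sin a * sin a) * (- (cos a / sin a) * - (cos a / sin a)))
        with (2 * (cos a * cos a)) by (field; lra). lra.
Qed.

Lemma nu_scale (C s w : R) : 1 <= C -> / C <= s -> s <= C -> s * w <= nu C w.
Proof.
  intros HC H1 H2. destruct (Rle_dec 0 w).
  - rewrite nu_pos by lra. nra.
  - rewrite nu_neg by lra. unfold Rdiv. nra.
Qed.

(* The projective map, realized in two steps by isotopies. *)
Lemma circle_to_parabola (I : Type) (D : I -> Prop) (f : I -> pt) (k : R) :
  0 < k ->
  (forall i, D i -> -1 <= px (f i) <= 1) ->
  (forall i, D i -> -1 <= py (f i) <= 1 - k) ->
  ambient_isotopic (fun p => exists i, D i /\ p = f i)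
    (fun p => exists i, D i /\
       p = (px (f i) / (1 - py (f i)), (1 + py (f i)) / (1 - py (f i)), pz (f i))).
Proof.
  intros Hk Hx Hy. set (m := Rmin k 1).
  assert (Hm : 0 < m /\ m <= k /\ m <= 1).
  { unfold m. split; [apply Rmin_glb_lt; lra|]. split; [apply Rmin_l|apply Rmin_r]. }
  (* The slopes of the first push lie between 1/2 and [1 / m], its dependence on y is at most
     [1 / m^2], and the slopes of the second push lie between 1/2 and [2 / m^2]. This [C] bounds all
     of them. *)
  set (C := 2 / (m * m)).
  assert (Hmm : 0 < m * m <= 1) by nra.
  assert (HC : 2 <= C).
  { unfold C. apply Rmult_le_reg_r with (m * m); [lra|].
    replace (2 / (m * m) * (m * m)) with 2 by (field; lra). nra. }
  assert (HC' : / C <= / 2) by (apply Rinv_le_contravar; lra).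
  assert (Hinv : forall i, D i -> / 2 <= / (1 - py (f i)) <= / m).
  { intros i Hi. specialize (Hy i Hi). split; apply Rinv_le_contravar; lra. }
  assert (Hm2 : / m * / m = C / 2) by (unfold C; field; lra).
  assert (Hm1 : 1 <= / m) by (rewrite <- Rinv_1; apply Rinv_le_contravar; lra).
  apply ambient_isotopic_trans with (B := fun p => exists i, D i /\
    p = (px (f i) / (1 - py (f i)), py (f i), pz (f i))).
  - apply push_x with (C := C); [lra|]. intros i j Hi Hj.
    pose proof (Hx i Hi). pose proof (Hx j Hj). pose proof (Hy i Hi). pose proof (Hy j Hj).
    pose proof (Hinv i Hi) as Ii. pose proof (Hinv j Hj) as Ij.
    replace (px (f i) / (1 - py (f i)) - px (f j) / (1 - py (f j)))
      with (/ (1 - py (f i)) * (px (f i) - px (f j)) +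
            px (f j) * (/ (1 - py (f i)) * / (1 - py (f j))) * (py (f i) - py (f j)))
      by (field; lra).
    assert (N : / (1 - py (f i)) * (px (f i) - px (f j)) <= nu C (px (f i) - px (f j))).
    { apply nu_scale; nra. }
    assert (Q : px (f j) * (/ (1 - py (f i)) * / (1 - py (f j))) * (py (f i) - py (f j))
                <= C * Rabs (py (f i) - py (f j))).
    { apply Rle_trans with (1 := Rle_abs _). rewrite !Rabs_mult.
      apply Rmult_le_compat_r; [apply Rabs_pos|].
      rewrite (Rabs_right (/ (1 - py (f i)))), (Rabs_right (/ (1 - py (f j)))) by lra.
      assert (Rabs (px (f j)) <= 1) by (apply Rabs_le; lra).
      pose proof (Rabs_pos (px (f j))).
      assert (/ (1 - py (f i)) * / (1 - py (f j)) <= / m * / m).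
      { apply Rmult_le_compat; lra. }
      assert (0 <= / (1 - py (f i)) * / (1 - py (f j))) by (apply Rmult_le_pos; lra).
      nra. }
    pose proof (Rabs_pos (pz (f i) - pz (f j))). nra.
  - apply (push_y I D (fun i => (px (f i) / (1 - py (f i)), py (f i), pz (f i)))
      (fun i => (1 + py (f i)) / (1 - py (f i))) C); [lra|].
    intros i j Hi Hj. cbv beta.
    pose proof (Hy i Hi). pose proof (Hy j Hj).
    pose proof (Hinv i Hi) as Ii. pose proof (Hinv j Hj) as Ij.
    set (A := Rabs (px _ - px _)). set (B := Rabs (pz _ - pz _)).
    change (py (px (f i) / (1 - py (f i)), py (f i), pz (f i))) with (py (f i)).
    change (py (px (f j) / (1 - py (f j)), py (f j), pz (f j))) with (py (f j)).
    assert (0 <= A + B).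
    { unfold A, B. apply Rplus_le_le_0_compat; apply Rabs_pos. }
    replace ((1 + py (f i)) / (1 - py (f i)) - (1 + py (f j)) / (1 - py (f j)))
      with (2 * (/ (1 - py (f i)) * / (1 - py (f j))) * (py (f i) - py (f j)))
      by (field; lra).
    assert (N : 2 * (/ (1 - py (f i)) * / (1 - py (f j))) * (py (f i) - py (f j))
       <= nu C (py (f i) - py (f j))).
    { assert (/ (1 - py (f i)) * / (1 - py (f j)) <= / m * / m).
      { apply Rmult_le_compat; lra. }
      assert (/ 2 * / 2 <= / (1 - py (f i)) * / (1 - py (f j))).
      { apply Rmult_le_compat; lra. }
      apply nu_scale; lra. }
    nra.
Qed.

(** The projective map multiplies the sheet profile by a factor varying along the chord. Two chords
    that cross have the same positive value there, so the order is unaffected. *)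
Lemma chords_rescale (I : Type) (l : list I) (a b h h' : I -> R) (G : I -> R -> R) :
  chord_family l a b ->
  (forall i, In i l -> lip_on (a i) (b i) (G i)) ->
  (forall i j w, In i l -> In j l -> interleaved a b i j -> w = cross a b i j ->
     G i w = G j w /\ 0 < G i w) ->
  (forall i q, In i l -> is_end a b i q -> G i q = 0) ->
  (forall i j, In i l -> In j l -> interleaved a b i j ->
     same_sign (h i - h j) (h' i - h' j)) ->
  ambient_isotopic (gset l a b (lines a b) (fun i x => h i * G i x)) (chords l a b h').
Proof.
  intros Hf HG Hc Hv Hh. apply ambient_isotopic_sym. apply chords_relift; auto.
  - intros i Hi. apply lip_on_mult; [apply lip_on_const|auto].
  - intros i j q Hi Hj Ei Ej. rewrite (Hv i q), (Hv j q) by assumption. ring.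
  - intros i j Hi Hj X. destruct (Hc i j _ Hi Hj X eq_refl) as [E P].
    rewrite <- E. replace (h i * G i (cross a b i j) - h j * G i (cross a b i j))
      with (G i (cross a b i j) * (h i - h j)) by ring.
    apply same_sign_sym, same_sign_scale; auto.
Qed.

Lemma cross_common (a b a' b' : R) :
  a < a' -> a' < b -> b < b' ->
  line a b (cross_pt a b a' b') = line a' b' (cross_pt a b a' b') /\
  cap a b (cross_pt a b a' b') = cap a' b' (cross_pt a b a' b') /\
  0 < cap a b (cross_pt a b a' b').
Proof.
  intros H1 H2 H3. pose proof (cross_pt_between _ _ _ _ H1 H2 H3) as Hw.
  pose proof (cross_pt_spec a b a' b' (cross_pt a b a' b') H1 H3) as E.
  rewrite Rminus_diag, Rmult_0_r in E. split; [lra|]. rewrite !line_cap in E. split; [lra|].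
  unfold cap. nra.
Qed.

(** A projective map turns the affine weights [1 - t] and [t] into weights proportional to
    [(1 - t) * A] and [t * B], so the image is again a point of the chord. *)
Lemma parabola_chord (A B X Y t : R) :
  0 < A -> 0 < B -> 0 <= t <= 1 -> X <> Y ->
  let w := (1 - t) * A + t * B in
  let u := ((1 - t) * (A * X) + t * (B * Y)) / w in
  0 < w /\ Rmin X Y <= u <= Rmax X Y /\
  ((1 - t) * (A * (X * X)) + t * (B * (Y * Y))) / w = line X Y u.
Proof.
  intros HA HB Ht HXY w u.
  assert (Hw : 0 < w).
  { unfold w. destruct (Req_dec t 0) as [->|]; [lra|]. nra. }
  split; [exact Hw|].
  assert (Hu : u * w = (1 - t) * (A * X) + t * (B * Y)) by (unfold u; field; lra).
  split.
  - assert (0 <= (1 - t) * A) by nra. assert (0 <= t * B) by nra.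
    split; apply Rmult_le_reg_r with w; try exact Hw; rewrite Hu; unfold w.
    + pose proof (Rmin_l X Y). pose proof (Rmin_r X Y). nra.
    + pose proof (Rmax_l X Y). pose proof (Rmax_r X Y). nra.
  - unfold line, u. unfold w in *. field. lra.
Qed.

Lemma parabola_chord_onto (A B X Y u : R) :
  0 < A -> 0 < B -> X <> Y -> Rmin X Y <= u <= Rmax X Y ->
  exists t, 0 <= t <= 1 /\
    ((1 - t) * (A * X) + t * (B * Y)) / ((1 - t) * A + t * B) = u.
Proof.
  intros HA HB HXY Hu. set (s := (u - X) / (Y - X)).
  assert (Es : u = (1 - s) * X + s * Y) by (unfold s; field; lra).
  assert (Hs : 0 <= s <= 1).
  { unfold Rmin, Rmax in Hu. destruct (Rle_dec X Y).
    - unfold s. split.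
      + apply Rmult_le_pos; [lra|]. left; apply Rinv_0_lt_compat; lra.
      + apply Rmult_le_reg_r with (Y - X); [lra|].
        unfold Rdiv. rewrite Rmult_assoc, Rinv_l by lra. lra.
    - replace s with ((X - u) / (X - Y)) by (unfold s; field; lra). split.
      + apply Rmult_le_pos; [lra|]. left; apply Rinv_0_lt_compat; lra.
      + apply Rmult_le_reg_r with (X - Y); [lra|].
        unfold Rdiv. rewrite Rmult_assoc, Rinv_l by lra. lra. }
  set (d := (1 - s) * B + s * A).
  assert (Hd : 0 < d).
  { unfold d. destruct (Req_dec s 0) as [->|]; [lra|]. nra. }
  (* The reweighting is inverted: this is the solution [t] of
     [t * B / ((1 - t) * A + t * B) = s]. *)
  exists (s * A / d). split.
  - split.
    + apply Rmult_le_pos; [nra|]. left; now apply Rinv_0_lt_compat.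
    + apply Rmult_le_reg_r with d; [exact Hd|].
      replace (s * A / d * d) with (s * A) by (field; lra). unfold d. nra.
  - rewrite Es.
    assert (E1 : 1 - s * A / d = (1 - s) * B / d) by (unfold d; field; unfold d in Hd; lra).
    rewrite E1. field. nra.
Qed.

Lemma circle_chords_isotopic (n r : nat) (E : list (nat * nat)) (s : nat * nat -> nat)
  (h : nat * nat -> R) :
  (r <= n)%nat ->
  (forall e, In e E -> (1 <= fst e <= n /\ 1 <= snd e <= n)%nat) ->
  (forall e a, In e E -> inSheet n a (fst e) (snd e) <-> a = s e) ->
  chord_family E (elo (cut_pos n r)) (ehi (cut_pos n r)) ->
  (forall e f, In e E -> In f E ->
     interleaved (elo (cut_pos n r)) (ehi (cut_pos n r)) e f ->
     same_sign (INR (n - s e) - INR (n - s f)) (h e - h f)) ->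
  ambient_isotopic (fun z => exists e, In e E /\ edge_set n (fst e) (snd e) z)
                   (chords E (elo (cut_pos n r)) (ehi (cut_pos n r)) h).
Proof.
  intros Hr HE Hs Hfam Hh. set (X := cut_pos n r) in *. set (dl := cut_shift n r).
  assert (HX : forall e, In e E -> X (fst e) <> X (snd e)).
  { intros e He EX. destruct Hfam as [Hlt _]. specialize (Hlt e He).
    unfold elo, ehi in Hlt. rewrite EX, Rmin_left, Rmax_left in Hlt; lra. }
  set (Dm := fun et : (nat * nat) * R => In (fst et) E /\ 0 <= snd et <= 1).
  set (qx := fun et : (nat * nat) * R =>
    (1 - snd et) * ux n r (fst (fst et)) + snd et * ux n r (snd (fst et))).
  set (qy := fun et : (nat * nat) * R =>
    (1 - snd et) * uy n r (fst (fst et)) + snd et * uy n r (snd (fst et))).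
  set (F := fun et => (qx et, qy et,
    INR (n - s (fst et)) * (1 - qx et ^ 2 - qy et ^ 2)) : pt).
  assert (Hrot : forall u, ux n r u = cos dl * vx n u - sin dl * vy n u /\
                           uy n r u = sin dl * vx n u + cos dl * vy n u).
  { intros u. unfold ux, uy, vx, vy. fold dl. rewrite cos_plus, sin_plus. split; ring. }
  assert (Hcs : sin dl * sin dl + cos dl * cos dl = 1) by (apply sin2_cos2).
  apply ambient_isotopic_trans with (B := fun p => exists et, Dm et /\ p = F et).
  { refine (ambient_isotopic_ext _ _ _ _ (fun z => iff_refl _) _ (rot_isotopic dl _)).
    intros p. split.
    - intros [e [He [a [t [Ha [Ht [Ex [Ey Ez]]]]]]]]. apply Hs in Ha; [|exact He]. subst a.
      exists (e, t). split; [split; assumption|].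
      rewrite <- (rot_inv' dl p). set (q := rot (- dl) p) in *.
      assert (Q1 : px (rot dl q) = qx (e, t)).
      { unfold qx; simpl. destruct (Hrot (fst e)) as [-> _], (Hrot (snd e)) as [-> _].
        unfold rot at 1, px at 1; simpl. rewrite Ex, Ey. ring. }
      assert (Q2 : py (rot dl q) = qy (e, t)).
      { unfold qy; simpl. destruct (Hrot (fst e)) as [_ ->], (Hrot (snd e)) as [_ ->].
        unfold rot at 1, py at 1; simpl. rewrite Ex, Ey. ring. }
      apply pt_ext; [exact Q1|exact Q2|].
      change (pz q = INR (n - s e) * (1 - qx (e, t) ^ 2 - qy (e, t) ^ 2)).
      rewrite Ez, <- Q1, <- Q2. f_equal.
      change (px (rot dl q)) with (cos dl * px q - sin dl * py q).
      change (py (rot dl q)) with (sin dl * px q + cos dl * py q).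
      transitivity (1 - (sin dl * sin dl + cos dl * cos dl) * (px q ^ 2 + py q ^ 2));
        [rewrite Hcs|]; ring.
    - intros [[e t] [[He Ht] ->]]. simpl in He, Ht. exists e. split; [exact He|].
      exists (s e), t. split; [now apply Hs|]. split; [exact Ht|].
      assert (Q1 : px (rot (- dl) (F (e, t))) = (1 - t) * vx n (fst e) + t * vx n (snd e)).
      { unfold rot, F, px, py; simpl. unfold qx, qy; simpl. rewrite cos_neg, sin_neg.
        destruct (Hrot (fst e)) as [-> ->], (Hrot (snd e)) as [-> ->].
        transitivity ((sin dl * sin dl + cos dl * cos dl) *
          ((1 - t) * vx n (fst e) + t * vx n (snd e))); [ring|rewrite Hcs; ring]. }
      assert (Q2 : py (rot (- dl) (F (e, t))) = (1 - t) * vy n (fst e) + t * vy n (snd e)).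
      { unfold rot, F, px, py; simpl. unfold qx, qy; simpl. rewrite cos_neg, sin_neg.
        destruct (Hrot (fst e)) as [-> ->], (Hrot (snd e)) as [-> ->].
        transitivity ((sin dl * sin dl + cos dl * cos dl) *
          ((1 - t) * vy n (fst e) + t * vy n (snd e))); [ring|rewrite Hcs; ring]. }
      split; [exact Q1|]. split; [exact Q2|].
      change (pz (rot (- dl) (F (e, t)))) with
        (INR (n - s e) * (1 - qx (e, t) ^ 2 - qy (e, t) ^ 2)).
      f_equal.
      change (px (rot (- dl) (F (e, t)))) with
        (cos (- dl) * qx (e, t) - sin (- dl) * qy (e, t)).
      change (py (rot (- dl) (F (e, t)))) with
        (sin (- dl) * qx (e, t) + cos (- dl) * qy (e, t)).
      rewrite cos_neg, sin_neg.
      transitivity (1 - (sin dl * sin dl + cos dl * cos dl) *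
        (qx (e, t) ^ 2 + qy (e, t) ^ 2)); [rewrite Hcs|]; ring. }
  (* The finitely many vertices, hence also the chords, stay at distance at least [k] below the line
     [y = 1] that the projective map sends to infinity. *)
  destruct (finite_lower (nat * nat) E (fun e k =>
      k <= 1 - uy n r (fst e) /\ k <= 1 - uy n r (snd e)) 1) as [k [Hk K]]; [lra| |].
  { intros e He. destruct (HE e He) as [H1 H2].
    destruct (cut_vertex n r (fst e) Hr H1) as [P1 _].
    destruct (cut_vertex n r (snd e) Hr H2) as [P2 _].
    exists (Rmin (1 - uy n r (fst e)) (1 - uy n r (snd e))).
    split; [now apply Rmin_glb_lt|]. intros e' He'.
    pose proof (Rmin_l (1 - uy n r (fst e)) (1 - uy n r (snd e))).
    pose proof (Rmin_r (1 - uy n r (fst e)) (1 - uy n r (snd e))). lra. }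
  apply ambient_isotopic_trans with (1 := circle_to_parabola _ Dm F k ltac:(lra)
    ltac:(intros [e t] [He Ht]; simpl in He, Ht; destruct (HE e He) as [H1 H2];
      destruct (cut_vertex n r (fst e) Hr H1) as [_ [_ [? _]]];
      destruct (cut_vertex n r (snd e) Hr H2) as [_ [_ [? _]]];
      unfold F, px; simpl; unfold qx; simpl; nra)
    ltac:(intros [e t] [He Ht]; simpl in He, Ht; destruct (HE e He) as [H1 H2];
      destruct (cut_vertex n r (fst e) Hr H1) as [_ [? _]];
      destruct (cut_vertex n r (snd e) Hr H2) as [_ [? _]];
      destruct (K e k He ltac:(lra));
      unfold F, py; simpl; unfold qy; simpl; nra)).
  (* With [X = x / (1 - y)] and [Y = (1 + y) / (1 - y)] one has [Y + 1 = 2 / (1 - y)] and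
     [Y - X^2 = (1 - x^2 - y^2) / (1 - y)^2]. So the sheet profile [1 - x^2 - y^2] becomes
     [4 * (Y - X^2) / (Y + 1)^2]. *)
  set (G := fun e x => 4 * cap (elo X e) (ehi X e) x *
      (/ (line (elo X e) (ehi X e) x + 1) * / (line (elo X e) (ehi X e) x + 1))).
  apply ambient_isotopic_ext with
    (A := gset E (elo X) (ehi X) (lines (elo X) (ehi X)) (fun e x => INR (n - s e) * G e x))
    (B := chords E (elo X) (ehi X) h); [|reflexivity|].
  - assert (Hpt : forall e t, In e E -> 0 <= t <= 1 ->
      let x := px (F (e, t)) / (1 - py (F (e, t))) in
      elo X e <= x <= ehi X e /\
      (x, (1 + py (F (e, t))) / (1 - py (F (e, t))), pz (F (e, t)))
        = (x, lines (elo X) (ehi X) e x, INR (n - s e) * G e x) /\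
      x = ((1 - t) * ((1 - uy n r (fst e)) * X (fst e)) + t * ((1 - uy n r (snd e)) * X (snd e)))
          / ((1 - t) * (1 - uy n r (fst e)) + t * (1 - uy n r (snd e)))).
    { intros e t He Ht x. destruct (HE e He) as [H1 H2].
      destruct (cut_vertex n r (fst e) Hr H1) as [A0 [_ [_ [A1 A2]]]].
      destruct (cut_vertex n r (snd e) Hr H2) as [B0 [_ [_ [B1 B2]]]].
      fold (X (fst e)) in A1, A2. fold (X (snd e)) in B1, B2.
      destruct (parabola_chord _ _ _ _ t A0 B0 Ht (HX e He)) as [W0 [W1 W2]].
      set (w := (1 - t) * (1 - uy n r (fst e)) + t * (1 - uy n r (snd e))) in *.
      assert (Ew : 1 - py (F (e, t)) = w).
      { unfold F, py; simpl. unfold qy, w; simpl. ring. }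
      assert (Ex : x = ((1 - t) * ((1 - uy n r (fst e)) * X (fst e)) +
         t * ((1 - uy n r (snd e)) * X (snd e))) / w).
      { unfold x. rewrite Ew. unfold F, px; simpl. unfold qx; simpl. rewrite A1, B1. reflexivity. }
      rewrite <- Ex in W1, W2. split; [exact W1|]. split; [|exact Ex].
      assert (Ey : (1 + py (F (e, t))) / (1 - py (F (e, t))) = lines (elo X) (ehi X) e x).
      { unfold lines, elo, ehi. rewrite line_min_max, <- W2, Ew. f_equal.
        unfold F, py; simpl. unfold qy; simpl. rewrite <- A2, <- B2. ring. }
      rewrite Ey. f_equal. unfold F, pz; simpl. f_equal.
      unfold G. change (line (elo X e) (ehi X e) x) with (lines (elo X) (ehi X) e x).
      replace (cap (elo X e) (ehi X e) x) with (lines (elo X) (ehi X) e x - x * x)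
        by (unfold lines; rewrite line_cap; ring).
      rewrite <- Ey. unfold x. clear Ey W1 W2 Ex x.
      change (py (F (e, t))) with (qy (e, t)) in *. change (px (F (e, t))) with (qx (e, t)) in *.
      field. lra. }
    intros p. split.
    + intros [e [x [He [Hx ->]]]]. destruct (HE e He) as [H1 H2].
      destruct (cut_vertex n r (fst e) Hr H1) as [A0 _].
      destruct (cut_vertex n r (snd e) Hr H2) as [B0 _].
      destruct (parabola_chord_onto _ _ _ _ x A0 B0 (HX e He) Hx) as [t [Ht Et]].
      exists (e, t). split; [split; assumption|].
      destruct (Hpt e t He Ht) as [_ [P1 P2]]. rewrite Et in P2. rewrite P1, P2. reflexivity.
    + intros [[e t] [[He Ht] ->]]. simpl in He, Ht.
      destruct (Hpt e t He Ht) as [P0 [P1 _]].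
      exists e, (px (F (e, t)) / (1 - py (F (e, t)))). auto.
  - assert (Hpos : forall e x, elo X e <= x <= ehi X e -> 1 <= line (elo X e) (ehi X e) x + 1).
    { intros e x Hx. rewrite line_cap. pose proof (cap_pos _ _ _ Hx). nra. }
    apply chords_rescale; auto.
    + intros e He. unfold G. apply lip_on_mult.
      * apply lip_on_mult; [apply lip_on_const|apply lip_cap].
      * assert (lip_on (elo X e) (ehi X e) (fun x => / (line (elo X e) (ehi X e) x + 1))).
        { apply lip_on_inv with (k := 1); [lra|auto|].
          apply lip_on_plus; [apply lip_line|apply lip_on_const]. }
        now apply lip_on_mult.
    + intros e f w He Hf [X1 [X2 X3]] ->.
      pose proof (cross_pt_between _ _ _ _ X1 X2 X3) as Hw.
      destruct (cross_common _ _ _ _ X1 X2 X3) as [E1 [E2 E3]]. unfold G, cross.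
      rewrite <- E1, <- E2. split; [reflexivity|].
      pose proof (Hpos e (cross_pt (elo X e) (ehi X e) (elo X f) (ehi X f)) ltac:(lra)) as P.
      assert (0 < / (line (elo X e) (ehi X e)
         (cross_pt (elo X e) (ehi X e) (elo X f) (ehi X f)) + 1)).
      { apply Rinv_0_lt_compat. lra. }
      apply Rmult_lt_0_compat; [lra|]. now apply Rmult_lt_0_compat.
    + intros e q He Hq. unfold G.
      replace (cap (elo X e) (ehi X e) q) with 0 by (unfold cap; destruct Hq; subst; ring).
      ring.
Qed.


(** * Levels and sheets *)

Lemma parity_cases (n : nat) :
  (exists i, n = 2 * i /\ Nat.even n = true /\ Nat.div2 n = i)%nat \/
  (exists i, n = 2 * i + 1 /\ Nat.even n = false /\ Nat.div2 n = i)%nat.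
Proof.
  destruct (Nat.Even_or_Odd n) as [[i ->]|[i ->]].
  - left. exists i. split; [reflexivity|]. split; [|apply Nat.div2_double].
    apply Nat.even_spec. now exists i.
  - right. exists i. split; [reflexivity|]. split.
    + rewrite Nat.add_1_r, Nat.even_succ, <- Nat.negb_even.
      replace (Nat.even (2 * i)) with true; [reflexivity|].
      symmetry. apply Nat.even_spec. now exists i.
    + rewrite Nat.add_1_r. apply Nat.div2_succ_double.
Qed.

(* Levels.  The vertices of the two halves of the circle are numbered
   alternately, 1, 3, 5, ... along the first half and 2, 4, 6, ... along the
   second: [level] is this numbering and [label] its inverse.  The edge between
   levels [k] and [l] then lies in the sheet of index [ceil (min k l / 2)] if
   both ends are in the same half, [ceil (max k l / 2)] otherwise. *)
Definition label (n k : nat) : nat :=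
  if Nat.even k then (n - Nat.div2 n + Nat.div2 k)%nat else (Nat.div2 k + 1)%nat.

Definition level (n u : nat) : nat :=
  if Nat.leb u (n - Nat.div2 n) then (2 * u - 1)%nat
  else (2 * (u - (n - Nat.div2 n)))%nat.

Definition edge_level (k l : nat) : nat :=
  if Nat.even (k + l) then Nat.min k l else Nat.max k l.

Definition sheet (n : nat) (e : nat * nat) : nat :=
  Nat.div2 (edge_level (level n (fst e)) (level n (snd e)) + 1).

Lemma edge_level_sym (k l : nat) : edge_level k l = edge_level l k.
Proof. unfold edge_level. now rewrite Nat.add_comm, Nat.min_comm, Nat.max_comm. Qed.

Lemma sheet_sym (n u v : nat) : sheet n (u, v) = sheet n (v, u).
Proof. unfold sheet; simpl. now rewrite edge_level_sym. Qed.

Lemma edge_level_cases (k l : nat) :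
  (exists i, k + l = 2 * i /\ edge_level k l = Nat.min k l)%nat \/
  (exists i, k + l = 2 * i + 1 /\ edge_level k l = Nat.max k l)%nat.
Proof.
  unfold edge_level. destruct (parity_cases (k + l)) as [[i [E [-> _]]]|[i [E [-> _]]]];
    [left|right]; exists i; auto.
Qed.

Lemma label_cases (n k : nat) :
  (exists i, k = 2 * i /\ label n k = n - Nat.div2 n + i)%nat \/
  (exists i, k = 2 * i + 1 /\ label n k = i + 1)%nat.
Proof.
  unfold label. destruct (parity_cases k) as [[i [E [-> ->]]]|[i [E [-> ->]]]];
    [left|right]; exists i; auto.
Qed.

Lemma level_cases (n u : nat) :
  (u <= n - Nat.div2 n /\ level n u = 2 * u - 1)%nat \/
  (n - Nat.div2 n < u /\ level n u = 2 * (u - (n - Nat.div2 n)))%nat.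
Proof.
  unfold level. destruct (Nat.leb_spec u (n - Nat.div2 n)); [left|right]; auto.
Qed.

Lemma sheet_bounds (n : nat) (e : nat * nat) :
  let l := edge_level (level n (fst e)) (level n (snd e)) in
  (l <= 2 * sheet n e <= l + 1)%nat.
Proof.
  unfold sheet. set (l := edge_level _ _). simpl.
  destruct (parity_cases (l + 1)) as [[i [E [_ ->]]]|[i [E [_ ->]]]]; lia.
Qed.

Lemma level_label (n k : nat) : (1 <= k <= n)%nat -> level n (label n k) = k.
Proof.
  intros Hk. destruct (parity_cases n) as [[m [E [_ D]]]|[m [E [_ D]]]];
  destruct (label_cases n k) as [[i [K L]]|[i [K L]]];
  destruct (level_cases n (label n k)) as [[A B]|[A B]]; try rewrite D in *; lia.
Qed.

Lemma label_bounds (n k : nat) : (1 <= k <= n)%nat -> (1 <= label n k <= n)%nat.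
Proof.
  intros Hk. destruct (parity_cases n) as [[m [E [_ D]]]|[m [E [_ D]]]];
  destruct (label_cases n k) as [[i [K L]]|[i [K L]]]; try rewrite D in *; lia.
Qed.

Lemma level_bounds (n u : nat) : (1 <= u <= n)%nat -> (1 <= level n u <= n)%nat.
Proof.
  intros Hk. destruct (parity_cases n) as [[m [E [_ D]]]|[m [E [_ D]]]];
  destruct (level_cases n u) as [[A B]|[A B]]; try rewrite D in *; lia.
Qed.

Lemma label_level (n u : nat) : (1 <= u <= n)%nat -> label n (level n u) = u.
Proof.
  intros Hk. destruct (parity_cases n) as [[m [E [_ D]]]|[m [E [_ D]]]];
  destruct (level_cases n u) as [[A B]|[A B]];
  destruct (label_cases n (level n u)) as [[i [K L]]|[i [K L]]]; try rewrite D in *; lia.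
Qed.

Lemma md_cases (n x : nat) : (1 <= x <= 2 * n)%nat ->
  (x <= n /\ md n x = x)%nat \/ (n < x /\ md n x = x - n)%nat.
Proof.
  intros Hx. unfold md. assert (Hn : n <> 0%nat) by lia.
  destruct (Nat.le_gt_cases x n) as [L|L]; [left|right]; (split; [exact L|]).
  - destruct (Nat.eq_dec x n) as [->|N].
    + rewrite Nat.Div0.mod_same. reflexivity.
    + rewrite Nat.mod_small by lia. destruct (Nat.eqb_spec x 0); lia.
  - destruct (Nat.eq_dec x (2 * n)) as [->|N].
    + rewrite Nat.Div0.mod_mul. simpl. lia.
    + assert (E : (x mod n = x - n)%nat).
      { symmetry. apply Nat.mod_unique with 1%nat; lia. }
      rewrite E. destruct (Nat.eqb_spec (x - n) 0); lia.
Qed.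

(** Sheet [a] consists of fans centred at the vertices of levels [2a - 1] and, if present, [2a].
    Within the half of its centre a fan reaches only larger levels, so the centre is the minimum; in
    the other half it reaches levels up to [2a], so the maximum is [2a - 1] or [2a]. What remains is
    linear arithmetic over the parities and the wrap-around. *)
Lemma inSheet_eq_sheet (n u v a : nat) :
  (2 <= n)%nat -> (1 <= u <= n)%nat -> (1 <= v <= n)%nat -> u <> v ->
  inSheet n a u v -> a = sheet n (u, v).
Proof.
  intros Hn Hu Hv Huv.
  pose proof (sheet_bounds n (u, v)) as SB. simpl in SB.
  unfold inSheet.
  destruct (parity_cases n) as [[m [E [EV D]]]|[m [E [EV D]]]]; rewrite EV, D;
  destruct (edge_level_cases (level n u) (level n v)) as [[i [P L]]|[i [P L]]];
  destruct (level_cases n u) as [[Cu Ku]|[Cu Ku]];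
  destruct (level_cases n v) as [[Cv Kv]|[Cv Kv]];
  try rewrite D in *; try lia.
  all: try (intros [Ha [[j [Hj HS]]|[j [Hj HS]]]];
    [destruct (md_cases n (a + j) ltac:(lia)) as [[M1 M2]|[M1 M2]]
    |destruct (md_cases n (a + m + j) ltac:(lia)) as [[M1 M2]|[M1 M2]]];
    rewrite M2 in HS; destruct HS as [[S1 S2]|[S1 S2]]; lia).
  all: intros [[Ha [j [Hj [HS|HS]]]]|[Ha [j [Hj HS]]]];
    [destruct (md_cases n (a + j) ltac:(lia)) as [[M1 M2]|[M1 M2]]
    |destruct (md_cases n (a + m + j + 1) ltac:(lia)) as [[M1 M2]|[M1 M2]]
    |pose proof I as M1; pose proof I as M2];
    try rewrite M2 in HS; destruct HS as [[S1 S2]|[S1 S2]]; lia.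
Qed.

Lemma inSheet_exists (n u v : nat) :
  (2 <= n)%nat -> (1 <= u)%nat -> (u < v)%nat -> (v <= n)%nat ->
  exists a, inSheet n a u v.
Proof.
  intros Hn Hu Huv Hv. unfold inSheet.
  destruct (parity_cases n) as [[m [E [-> ->]]]|[m [E [-> ->]]]].
  - destruct (Nat.le_gt_cases u m) as [C|C]; [destruct (Nat.le_gt_cases (v - u) m) as [C'|C']|].
    + exists u. split; [lia|]. left. exists (v - u)%nat. split; [lia|].
      destruct (md_cases n (u + (v - u)) ltac:(lia)) as [[M1 ->]|[M1 ->]]; left; lia.
    + exists (v - m)%nat. split; [lia|]. right. exists (u + n - v)%nat. split; [lia|].
      destruct (md_cases n (v - m + m + (u + n - v)) ltac:(lia)) as [[M1 ->]|[M1 ->]];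
        right; lia.
    + exists (u - m)%nat. split; [lia|]. right. exists (v - u)%nat. split; [lia|].
      destruct (md_cases n (u - m + m + (v - u)) ltac:(lia)) as [[M1 ->]|[M1 ->]]; left; lia.
  - destruct (Nat.le_gt_cases u m) as [C|C]; [destruct (Nat.le_gt_cases (v - u) m) as [C'|C']|].
    + exists u. left. split; [lia|]. exists (v - u)%nat. split; [lia|]. left.
      destruct (md_cases n (u + (v - u)) ltac:(lia)) as [[M1 ->]|[M1 ->]]; left; lia.
    + exists (v - m - 1)%nat. left. split; [lia|]. exists (u + n - v)%nat. split; [lia|]. right.
      destruct (md_cases n (v - m - 1 + m + (u + n - v) + 1) ltac:(lia)) as [[M1 ->]|[M1 ->]];
        right; lia.
    + destruct (Nat.eq_dec u (m + 1)) as [->|C'].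
      * exists (m + 1)%nat. right. split; [reflexivity|]. exists (v - (m + 1))%nat.
        split; [lia|]. left. lia.
      * exists (u - m - 1)%nat. left. split; [lia|]. exists (v - u)%nat. split; [lia|]. right.
        destruct (md_cases n (u - m - 1 + m + (v - u) + 1) ltac:(lia)) as [[M1 ->]|[M1 ->]];
          left; lia.
Qed.

Lemma inSheet_sym (n a u v : nat) : inSheet n a u v -> inSheet n a v u.
Proof.
  assert (S : forall x y, sameEdge u v x y -> sameEdge v u x y).
  { unfold sameEdge. intros x y. lia. }
  unfold inSheet. destruct (Nat.even n).
  - intros [Ha [[j [Hj H]]|[j [Hj H]]]]; (split; [exact Ha|]); [left|right];
      exists j; auto.
  - intros [[Ha [j [Hj [H|H]]]]|[Ha [j [Hj H]]]]; [left|left|right]; (split; [exact Ha|]);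
      exists j; auto.
Qed.

(** Every edge lies in some sheet, and membership determines the sheet; so the converse needs no
    separate computation. *)
Lemma inSheet_iff_sheet (n u v a : nat) :
  (2 <= n)%nat -> (1 <= u <= n)%nat -> (1 <= v <= n)%nat -> u <> v ->
  inSheet n a u v <-> a = sheet n (u, v).
Proof.
  intros Hn Hu Hv Huv. split; [now apply inSheet_eq_sheet|]. intros ->.
  assert (X : exists b, inSheet n b u v).
  { destruct (Nat.lt_ge_cases u v); [apply inSheet_exists; lia|].
    destruct (inSheet_exists n v u) as [b Hb]; [lia..|]. exists b. now apply inSheet_sym. }
  destruct X as [b Hb]. now rewrite <- (inSheet_eq_sheet n u v b).
Qed.

(* Order of the levels when the circle is cut just after the vertex of level [r]:
   the rest of the half of [r], then the other half, then the half of [r] up to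
   [r] itself.  [b] is any bound on the levels. *)
Definition cut_key (b r k : nat) : nat :=
  if Nat.even (r + k) then (if Nat.leb k r then k + 2 * b else k)%nat else (k + b)%nat.

Lemma cut_key_cases (b r k : nat) :
  (exists i, r + k = 2 * i /\ k <= r /\ cut_key b r k = k + 2 * b)%nat \/
  (exists i, r + k = 2 * i /\ r < k /\ cut_key b r k = k)%nat \/
  (exists i, r + k = 2 * i + 1 /\ cut_key b r k = k + b)%nat.
Proof.
  unfold cut_key. destruct (parity_cases (r + k)) as [[i [E [-> _]]]|[i [E [-> _]]]].
  - destruct (Nat.leb_spec k r); [left|right; left]; exists i; auto.
  - right; right. exists i. auto.
Qed.

Lemma cut_rank_cases (n r u : nat) :
  (u <= r /\ cut_rank n r u = u - 1 + n - r)%nat \/ (r < u /\ cut_rank n r u = u - 1 - r)%nat.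
Proof.
  unfold cut_rank. destruct (Nat.leb_spec u r); [left|right]; auto.
Qed.

(** On each of the three arcs made by the cut and the two halves, twice the rank is the level plus a
    constant depending on parities. The keys list these arcs in the same order, which reduces
    comparisons of ranks to comparisons of keys. *)
Lemma cut_rank_label (n r k m i : nat) (odd_n odd_r : bool) :
  (1 <= r <= n)%nat -> (1 <= k <= n)%nat ->
  (n = 2 * m + Nat.b2n odd_n)%nat -> (r = 2 * i + Nat.b2n odd_r)%nat ->
  (exists j, cut_key n r k = k + 2 * n /\ k <= r /\ k = 2 * j + Nat.b2n odd_r /\
     2 * cut_rank n (label n r) (label n k) + 2 + r = 2 * n + k)%nat \/
  (exists j, cut_key n r k = k /\ r < k /\ k = 2 * j + Nat.b2n odd_r /\
     2 * cut_rank n (label n r) (label n k) + 2 + r = k)%nat \/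
  (exists j, cut_key n r k = k + n /\ k = 2 * j + Nat.b2n (negb odd_r) /\
     2 * cut_rank n (label n r) (label n k) + r + 3 =
       n + k + (if odd_n then 1 else if odd_r then 0 else 2))%nat.
Proof.
  intros Hr Hk Hn Hi.
  pose proof (label_bounds n r Hr). pose proof (label_bounds n k Hk).
  destruct (parity_cases n) as [[m' [E [_ D]]]|[m' [E [_ D]]]];
  destruct odd_n, odd_r; cbn [Nat.b2n negb] in *; try lia;
  destruct (label_cases n r) as [[ir [Kr Lr]]|[ir [Kr Lr]]]; try lia;
  destruct (label_cases n k) as [[ik [Kk Lk]]|[ik [Kk Lk]]];
  rewrite Lr, Lk in *; try rewrite D in *;
  match goal with |- context [cut_rank n ?r ?k] =>
    destruct (cut_rank_cases n r k) as [[A1 ->]|[A1 ->]] end;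
  destruct (cut_key_cases n r k) as [[i1 [B1 [B2 ->]]]|[[i1 [B1 [B2 ->]]]|[i1 [B1 ->]]]];
  try lia;
  first [left; exists ik; lia | right; left; exists ik; lia | right; right; exists ik; lia].
Qed.

Lemma cut_rank_key (n r k l : nat) :
  (1 <= r <= n)%nat -> (1 <= k <= n)%nat -> (1 <= l <= n)%nat ->
  (cut_rank n (label n r) (label n k) < cut_rank n (label n r) (label n l))%nat <->
  (cut_key n r k < cut_key n r l)%nat.
Proof.
  intros Hr Hk Hl.
  assert (B2 : forall x, exists y b, (x = 2 * y + Nat.b2n b)%nat).
  { intros x. destruct (parity_cases x) as [[y [-> _]]|[y [-> _]]];
      [exists y, false|exists y, true]; simpl; lia. }
  destruct (B2 n) as [m [on En]]. destruct (B2 r) as [i [or Er]].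
  pose proof (cut_rank_label n r k m i on or Hr Hk En Er) as Ck.
  pose proof (cut_rank_label n r l m i on or Hr Hl En Er) as Cl.
  destruct on, or; cbn [Nat.b2n negb] in *;
  destruct Ck as [[j1 [-> Ck]]|[[j1 [-> Ck]]|[j1 [-> Ck]]]];
  destruct Cl as [[j2 [-> Cl]]|[[j2 [-> Cl]]|[j2 [-> Cl]]]]; lia.
Qed.


(** * Crossing edges in terms of levels *)

Ltac key_cases k := 
  match goal with
  | H : context [cut_key ?b ?r k] |- _ =>
      let i := fresh "i" in let E := fresh "E" in let L := fresh "L" in let K := fresh "K" in
      destruct (cut_key_cases b r k) as [[i [E [L K]]]|[[i [E [L K]]]|[i [E K]]]];
      rewrite K in *; clear K
  end.

(** Planarity of a sheet, in terms of levels: chords whose ends alternate on the circle cannot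
    belong to one sheet. On each of three arcs the key is the level plus a constant, so finitely
    many linear cases remain. *)
Lemma interleaved_sheets (n r a b c d s t : nat) :
  (1 <= r <= n)%nat -> (1 <= a <= n)%nat -> (1 <= b <= n)%nat ->
  (1 <= c <= n)%nat -> (1 <= d <= n)%nat ->
  (cut_key n r a < cut_key n r b)%nat -> (cut_key n r b < cut_key n r c)%nat ->
  (cut_key n r c < cut_key n r d)%nat ->
  (edge_level a c <= 2 * s <= edge_level a c + 1)%nat ->
  (edge_level b d <= 2 * t <= edge_level b d + 1)%nat -> s <> t.
Proof.
  intros Hr Ha Hb Hc Hd H1 H2 H3 Hs Ht.
  key_cases a; key_cases b; try lia; key_cases c; try lia; key_cases d; try lia;
  destruct (edge_level_cases a c) as [[j [J F]]|[j [J F]]]; rewrite F in *; try lia;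
  destruct (edge_level_cases b d) as [[j' [J' F']]|[j' [J' F']]]; rewrite F' in *; lia.
Qed.

(** If [b] is in the half of [p - 1], its edge has level [b] before and after. Otherwise [a]
    precedes [b] in the other half, which makes the level of the edge from [a] to [c] smaller than
    [p - 1], whereas the edge at [b] has level at least [p - 1] before and [p + 1] after. *)
Lemma interleaved_upper_cut (p a b c : nat) :
  (3 <= p)%nat -> (1 <= a <= p)%nat -> (1 <= b <= p)%nat -> (1 <= c <= p)%nat ->
  (cut_key p (p - 1) a < cut_key p (p - 1) b)%nat ->
  (cut_key p (p - 1) b < cut_key p (p - 1) c)%nat ->
  (cut_key p (p - 1) c < cut_key p (p - 1) (p - 1))%nat ->
  (edge_level b (p - 1) < edge_level a c <-> edge_level b (p + 1) < edge_level a c)%nat /\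
  (edge_level b (p + 1) <> edge_level a c)%nat.
Proof.
  intros Hp Ha Hb Hc H1 H2 H3.
  key_cases a; key_cases b; try lia; key_cases c; try lia; key_cases (p - 1)%nat; try lia;
  destruct (edge_level_cases a c) as [[j [J F]]|[j [J F]]]; rewrite F in *; try lia;
  destruct (edge_level_cases b (p - 1)) as [[j' [J' F']]|[j' [J' F']]]; rewrite F' in *; try lia;
  destruct (edge_level_cases b (p + 1)) as [[j3 [J3 F3]]|[j3 [J3 F3]]]; rewrite F3 in *; lia.
Qed.

(** For odd [b] other than 1 the edge has level [b] before and after. For [b = 1] it drops from 2 to
    1 and for even [b] from 2 to 0; in these cases [a] is even and at least 4, and the edge from [a]
    to [c] has level at least 4. *)
Lemma interleaved_lower_cut (q a b c : nat) :
  (3 <= q)%nat -> (1 <= a <= q)%nat -> (1 <= b <= q)%nat -> (1 <= c <= q)%nat ->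
  (cut_key q 2 a < cut_key q 2 b)%nat ->
  (cut_key q 2 b < cut_key q 2 c)%nat ->
  (cut_key q 2 c < cut_key q 2 2)%nat ->
  (edge_level b 2 < edge_level a c <-> edge_level b 0 < edge_level a c)%nat /\
  (edge_level b 0 <> edge_level a c)%nat.
Proof.
  intros Hp Ha Hb Hc H1 H2 H3.
  key_cases a; key_cases b; try lia; key_cases c; try lia; key_cases 2%nat; try lia;
  destruct (edge_level_cases a c) as [[j [J F]]|[j [J F]]]; rewrite F in *; try lia;
  destruct (edge_level_cases b 2) as [[j' [J' F']]|[j' [J' F']]]; rewrite F' in *; try lia;
  destruct (edge_level_cases b 0) as [[j3 [J3 F3]]|[j3 [J3 F3]]]; rewrite F3 in *; lia.
Qed.

(** Governs positions on the circle, not heights: the split vertex of alpha sits at [c'], while the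
    heights of its two edges are those belonging to [c] and [d]. *)
Definition upper_level (p k : nat) : nat := if Nat.eqb k (p - 1) then (p + 3)%nat else k.
Definition lower_level (p k : nat) : nat := (p + 1 + k)%nat.

Lemma upper_level_cases (p k : nat) :
  (k = p - 1 /\ upper_level p k = p + 3)%nat \/ (k <> p - 1 /\ upper_level p k = k)%nat.
Proof. unfold upper_level. destruct (Nat.eqb_spec k (p - 1)); auto. Qed.

Lemma upper_level_key (p q k l : nat) :
  (3 <= p)%nat -> (3 <= q)%nat -> (1 <= k <= p)%nat -> (1 <= l <= p)%nat ->
  (cut_key p (p - 1) k < cut_key p (p - 1) l)%nat ->
  (cut_key (p + q + 1) (p + 3) (upper_level p k) <
   cut_key (p + q + 1) (p + 3) (upper_level p l))%nat.
Proof.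
  intros Hp Hq Hk Hl H.
  destruct (upper_level_cases p k) as [[U ->]|[U ->]];
  destruct (upper_level_cases p l) as [[V ->]|[V ->]]; try (subst; lia).
  - subst k. key_cases (p - 1)%nat; try lia. key_cases l; lia.
  - subst l. key_cases (p - 1)%nat; try lia.
    destruct (cut_key_cases (p + q + 1) (p + 3) k) as [[? [? [? ->]]]|[[? [? [? ->]]]|[? [? ->]]]];
    destruct (cut_key_cases (p + q + 1) (p + 3) (p + 3)) as [[? [? [? ->]]]|[[? [? [? ->]]]|[? [? ->]]]];
    key_cases k; lia.
  - destruct (cut_key_cases (p + q + 1) (p + 3) k) as [[? [? [? ->]]]|[[? [? [? ->]]]|[? [? ->]]]];
    destruct (cut_key_cases (p + q + 1) (p + 3) l) as [[? [? [? ->]]]|[[? [? [? ->]]]|[? [? ->]]]];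
    key_cases k; try lia; key_cases l; lia.
Qed.

Lemma lower_level_key (p q k l : nat) :
  (3 <= p)%nat -> (3 <= q)%nat -> (1 <= k <= q)%nat -> (1 <= l <= q)%nat ->
  (cut_key q 2 k < cut_key q 2 l)%nat ->
  (cut_key (p + q + 1) (p + 3) (lower_level p k) <
   cut_key (p + q + 1) (p + 3) (lower_level p l))%nat.
Proof.
  intros Hp Hq Hk Hl H. unfold lower_level.
  destruct (cut_key_cases (p + q + 1) (p + 3) (p + 1 + k))
    as [[? [? [? ->]]]|[[? [? [? ->]]]|[? [? ->]]]];
  destruct (cut_key_cases (p + q + 1) (p + 3) (p + 1 + l))
    as [[? [? [? ->]]]|[[? [? [? ->]]]|[? [? ->]]]];
  key_cases k; try lia; key_cases l; lia.
Qed.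

Lemma cut_key_join (p q k : nat) :
  (3 <= p)%nat -> (3 <= q)%nat -> (1 <= k <= p + q + 1)%nat ->
  (cut_key (p + q + 1) (p + 3) k <= cut_key (p + q + 1) (p + 3) (p + 3))%nat /\
  (k <> p + 3 ->
   cut_key (p + q + 1) (p + 3) k <= cut_key (p + q + 1) (p + 3) (p + 1))%nat /\
  (k <> p + 3 -> k <> p + 1 ->
   cut_key (p + q + 1) (p + 3) k <= cut_key (p + q + 1) (p + 3) (p - 1))%nat /\
  (cut_key (p + q + 1) (p + 3) (p - 1) < cut_key (p + q + 1) (p + 3) (p + 1))%nat /\
  (cut_key (p + q + 1) (p + 3) (p + 1) < cut_key (p + q + 1) (p + 3) (p + 3))%nat.
Proof.
  intros Hp Hq Hk.
  destruct (cut_key_cases (p + q + 1) (p + 3) (p + 3))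
    as [[? [? [? ->]]]|[[? [? [? ->]]]|[? [? ->]]]]; try lia;
  destruct (cut_key_cases (p + q + 1) (p + 3) (p + 1))
    as [[? [? [? ->]]]|[[? [? [? ->]]]|[? [? ->]]]]; try lia;
  destruct (cut_key_cases (p + q + 1) (p + 3) (p - 1))
    as [[? [? [? ->]]]|[[? [? [? ->]]]|[? [? ->]]]]; try lia;
  destruct (cut_key_cases (p + q + 1) (p + 3) k)
    as [[? [? [? ->]]]|[[? [? [? ->]]]|[? [? ->]]]]; lia.
Qed.


(** * Edges of a cycle *)

Fixpoint path_edges (l : list nat) : list (nat * nat) :=
  match l with
  | x :: (y :: _) as t => (x, y) :: path_edges t
  | _ => []
  end.

Lemma path_edges_app (l1 l2 : list nat) (x : nat) :
  path_edges (l1 ++ x :: l2) = path_edges (l1 ++ [x]) ++ path_edges (x :: l2).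
Proof.
  induction l1 as [|y [|z l1] IH]; simpl in *; try reflexivity.
  now rewrite IH.
Qed.

Lemma cycle_edges_path (x : nat) (l : list nat) :
  cycle_edges (x :: l) = path_edges (x :: l ++ [x]).
Proof.
  assert (H : forall y, combine (y :: l) (l ++ [x]) = path_edges (y :: l ++ [x])).
  { induction l as [|z l IH]; intros y; [reflexivity|].
    change (combine (y :: z :: l) ((z :: l) ++ [x])) with ((y, z) :: combine (z :: l) (l ++ [x])).
    now rewrite IH. }
  unfold cycle_edges. simpl tl. simpl firstn. apply H.
Qed.

Lemma path_edges_wrap (a b : nat) (l : list nat) : l <> [] ->
  path_edges (a :: l ++ [b]) = (a, hd 0%nat l) :: path_edges l ++ [(last l 0%nat, b)].
Proof.
  destruct l as [|y l]; [congruence|]. intros _. simpl hd.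
  change (path_edges (a :: (y :: l) ++ [b])) with ((a, y) :: path_edges (y :: l ++ [b])).
  f_equal. revert y. induction l as [|z l IH]; intros y; [reflexivity|].
  change (path_edges (y :: (z :: l) ++ [b])) with ((y, z) :: path_edges (z :: l ++ [b])).
  rewrite IH. reflexivity.
Qed.

Lemma cycle_edges_cons (a : nat) (l : list nat) : l <> [] ->
  cycle_edges (a :: l) = (a, hd 0%nat l) :: path_edges l ++ [(last l 0%nat, a)].
Proof. intros. now rewrite cycle_edges_path, path_edges_wrap. Qed.

Lemma cycle_edges_rotate (l1 l2 : list nat) (e : nat * nat) :
  In e (cycle_edges (l1 ++ l2)) <-> In e (cycle_edges (l2 ++ l1)).
Proof.
  assert (H : forall l1 l2, In e (cycle_edges (l1 ++ l2)) -> In e (cycle_edges (l2 ++ l1))).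
  { clear l1 l2. intros [|x l1] [|y l2]; simpl app; rewrite ?app_nil_r; auto.
    rewrite !cycle_edges_path.
    replace (x :: (l1 ++ y :: l2) ++ [x]) with ((x :: l1) ++ y :: l2 ++ [x])
      by (simpl; now rewrite <- app_assoc).
    replace (y :: (l2 ++ x :: l1) ++ [y]) with ((y :: l2) ++ x :: l1 ++ [y])
      by (simpl; now rewrite <- app_assoc).
    rewrite (path_edges_app (x :: l1)), (path_edges_app (y :: l2)).
    change ((x :: l1) ++ [y]) with (x :: l1 ++ [y]).
    change ((y :: l2) ++ [x]) with (y :: l2 ++ [x]).
    rewrite !in_app_iff. tauto. }
  split; apply H.
Qed.

Lemma path_edges_in (l : list nat) (u v : nat) :
  In (u, v) (path_edges l) -> In u l /\ In v l.
Proof.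
  induction l as [|x [|y l] IH]; simpl; try tauto.
  intros [E|H].
  - injection E as <- <-. auto.
  - apply IH in H. simpl in H. tauto.
Qed.

Lemma hd_in (l : list nat) : l <> [] -> In (hd 0%nat l) l.
Proof. destruct l; simpl; [congruence|auto]. Qed.

Lemma last_in (l : list nat) : l <> [] -> In (last l 0%nat) l.
Proof.
  intros H. destruct (exists_last H) as [l' [x ->]].
  rewrite last_last. apply in_app_iff. right. now left.
Qed.

Lemma cycle_edges_in (l : list nat) (u v : nat) :
  In (u, v) (cycle_edges l) -> In u l /\ In v l.
Proof.
  destruct l as [|a [|b l]].
  - intros [].
  - intros H. simpl in H. destruct H as [E|[]]. injection E as <- <-. simpl. auto.
  - intros H. rewrite cycle_edges_cons in H by discriminate.
    assert (N : b :: l <> []) by discriminate.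
    pose proof (last_in _ N) as L.
    destruct H as [E|H]; [|apply in_app_iff in H; destruct H as [H|[E|[]]]].
    + injection E as <- <-. simpl. auto.
    + apply path_edges_in in H. simpl in H |- *. tauto.
    + injection E as <- <-. simpl in L |- *. tauto.
Qed.

Lemma hd_neq_last (l : list nat) : NoDup l -> (2 <= length l)%nat ->
  hd 0%nat l <> last l 0%nat.
Proof.
  destruct l as [|x [|y l]]; simpl; try lia. intros N _ E. apply NoDup_cons_iff in N. destruct N as [H _].
  apply H. rewrite E. assert (M : y :: l <> []) by discriminate. exact (last_in _ M).
Qed.

(** Once the cycle is rotated to start at [u], the vertex [v] is the head of the rest, and the only
    edge entering [u] comes from the last vertex, which differs from the head because two vertices
    remain. *)
Lemma cycle_edges_simple (l : list nat) (u v : nat) :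
  NoDup l -> (3 <= length l)%nat -> In (u, v) (cycle_edges l) ->
  u <> v /\ ~ In (v, u) (cycle_edges l).
Proof.
  intros Hn Hl Huv.
  destruct (in_split u l (proj1 (cycle_edges_in _ _ _ Huv))) as [l1 [l2 ->]].
  rewrite (cycle_edges_rotate l1 (u :: l2) (u, v)) in Huv.
  rewrite (cycle_edges_rotate l1 (u :: l2) (v, u)).
  assert (Hn' : NoDup (u :: l2 ++ l1)).
  { exact (Permutation_NoDup (Permutation_app_comm l1 (u :: l2)) Hn). }
  assert (Hl' : (2 <= length (l2 ++ l1))%nat).
  { rewrite length_app in *. simpl in Hl. lia. }
  change ((u :: l2) ++ l1) with (u :: l2 ++ l1) in *.
  set (r := l2 ++ l1) in *. clearbody r. apply NoDup_cons_iff in Hn'. destruct Hn' as [Hu Hr].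
  assert (Hr0 : r <> []) by (intros ->; simpl in Hl'; lia).
  rewrite cycle_edges_cons in * by exact Hr0.
  pose proof (hd_in r Hr0) as Ih. pose proof (last_in r Hr0) as Il.
  assert (Ev : v = hd 0%nat r).
  { destruct Huv as [E|H]; [now injection E|]. apply in_app_iff in H.
    destruct H as [H|[E|[]]]; [apply path_edges_in in H; tauto|].
    injection E as E1 E2. subst. tauto. }
  split; [intros ->; subst; tauto|].
  intros [E|H].
  - injection E as E1 E2. subst. tauto.
  - apply in_app_iff in H. destruct H as [H|[E|[]]].
    + apply path_edges_in in H. tauto.
    + injection E as E1. apply (hd_neq_last r Hr Hl'). congruence.
Qed.

Lemma map_path_edges (f : nat -> nat) (l : list nat) :
  path_edges (map f l) = map (fun e => (f (fst e), f (snd e))) (path_edges l).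
Proof.
  induction l as [|x [|y l] IH]; simpl; try reflexivity.
  simpl in IH. now rewrite IH.
Qed.

Lemma elo_ehi_eq (X : nat -> R) (e f : nat * nat) :
  elo X e = elo X f -> ehi X e = ehi X f ->
  (X (fst e) = X (fst f) /\ X (snd e) = X (snd f)) \/
  (X (fst e) = X (snd f) /\ X (snd e) = X (fst f)).
Proof.
  unfold elo, ehi, Rmin, Rmax.
  destruct (Rle_dec (X (fst e)) (X (snd e))), (Rle_dec (X (fst f)) (X (snd f))); intros; lra.
Qed.

Lemma cycle_family (l : list nat) (X : nat -> R) :
  NoDup l -> (3 <= length l)%nat ->
  (forall u v, In u l -> In v l -> X u = X v -> u = v) ->
  chord_family (cycle_edges l) (elo X) (ehi X).
Proof.
  intros Hn Hl HX. split.
  - intros [u v] He. destruct (cycle_edges_in _ _ _ He) as [Iu Iv].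
    destruct (cycle_edges_simple l u v Hn Hl He) as [N _].
    assert (X u <> X v) by (intros E; apply N; auto).
    unfold elo, ehi, Rmin, Rmax; simpl. destruct (Rle_dec (X u) (X v)); lra.
  - intros [u v] [x y] He Hf E1 E2.
    destruct (cycle_edges_in _ _ _ He) as [Iu Iv].
    destruct (cycle_edges_in _ _ _ Hf) as [Ix Iy].
    destruct (elo_ehi_eq X _ _ E1 E2) as [[A B]|[A B]]; simpl in A, B.
    + f_equal; auto.
    + exfalso. apply (cycle_edges_simple l u v Hn Hl He).
      apply HX in A, B; auto. now subst.
Qed.

Definition lift_chord (X : nat -> R) (h : nat * nat -> R) (e : nat * nat) : chord :=
  (elo X e, ehi X e, h e).

Lemma chord_set_map (X : nat -> R) (h : nat * nat -> R) (E : list (nat * nat)) (p : pt) :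
  chord_set (map (lift_chord X h) E) p <-> chords E (elo X) (ehi X) h p.
Proof.
  split.
  - intros [c [x [Hc H]]]. apply in_map_iff in Hc. destruct Hc as [e [<- He]].
    exists e, x. auto.
  - intros [e [x [He H]]]. exists (lift_chord X h e), x. split; [now apply in_map|exact H].
Qed.

Lemma chord_set_ext (L L' : list chord) (p : pt) :
  (forall c, In c L <-> In c L') -> chord_set L p <-> chord_set L' p.
Proof.
  intros H. split; intros [c [x [Hc Hx]]]; exists c, x; (split; [now apply H|exact Hx]).
Qed.

(* Only the order of the vertices on the circle matters. *)
Lemma chords_relabel (V : list nat) (E : list (nat * nat)) (X X' : nat -> R)
  (h h' : nat * nat -> R) :
  E <> [] ->
  (forall e, In e E -> In (fst e) V /\ In (snd e) V) ->
  (forall u v, In u V -> In v V -> X u < X v -> X' u < X' v) ->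
  (forall u v, In u V -> In v V -> X u = X v -> u = v) ->
  chord_family E (elo X) (ehi X) ->
  (forall e f, In e E -> In f E -> interleaved (elo X) (ehi X) e f ->
     same_sign (h e - h f) (h' e - h' f)) ->
  ambient_isotopic (chords E (elo X) (ehi X) h) (chords E (elo X') (ehi X') h').
Proof.
  intros HE HV Hlt Hinj Hfam Hh.
  destruct (finite_upper (nat * nat) (list_prod V V)
    (fun uv C => 1 <= C /\ X' (fst uv) - X' (snd uv) <= nu C (X (fst uv) - X (snd uv))) 1)
    as [C [HC K]].
  - intros [u v] C D [HC H] HD. split; [lra|]. simpl in *.
    pose proof (nu_mono C D (X u - X v) HC HD). lra.
  - intros [u v] Huv. apply in_prod_iff in Huv. destruct Huv as [Hu Hv]. simpl.
    destruct (Rtotal_order (X u) (X v)) as [L|[L|L]].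
    + pose proof (Hlt u v Hu Hv L) as L'.
      set (C := 1 + (X v - X u) / (X' v - X' u)).
      assert (0 < (X v - X u) / (X' v - X' u)) by (apply Rdiv_lt_0_compat; lra).
      assert (HC : 1 <= C) by (unfold C; lra).
      exists C. split; [exact HC|]. rewrite nu_neg by lra.
      apply Rmult_le_reg_l with C; [lra|].
      replace (C * ((X u - X v) / C)) with (X u - X v) by (field; lra).
      assert (X v - X u <= C * (X' v - X' u)); [|lra].
      unfold C. rewrite Rmult_plus_distr_r.
      replace ((X v - X u) / (X' v - X' u) * (X' v - X' u)) with (X v - X u) by (field; lra).
      lra.
    + rewrite (Hinj u v Hu Hv L). exists 1. rewrite !Rminus_diag, nu_0. lra.
    + pose proof (Hlt v u Hv Hu L) as L'.
      set (C := 1 + (X' u - X' v) / (X u - X v)).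
      assert (0 < (X' u - X' v) / (X u - X v)) by (apply Rdiv_lt_0_compat; lra).
      assert (HC : 1 <= C) by (unfold C; lra).
      exists C. split; [exact HC|]. rewrite nu_pos by lra.
      unfold C. rewrite Rmult_plus_distr_r.
      replace ((X' u - X' v) / (X u - X v) * (X u - X v)) with (X' u - X' v) by (field; lra).
      lra.
  - assert (HV0 : exists u0, In u0 V).
    { destruct E as [|e E]; [congruence|]. exists (fst e). apply HV. now left. }
    destruct HV0 as [u0 Hu0].
    (* The same extension result on the line: the old positions are sent to the new ones by a map
       with slopes in [[1/C, C]], as there are only finitely many vertices. *)
    destruct (gauge_extension R nat (fun x y => nu C (x - y)) (fun u => In u V) u0 X X')
      as [f [Hf Ef]].
    + intros x. now rewrite Rminus_diag, nu_0.
    + intros x y z. replace (x - z) with (x - y + (y - z)) by ring. apply nu_add.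
    + exact Hu0.
    + intros u v Hu Hv. apply (K (u, v)). now apply in_prod.
    + destruct (increasing_inverse f C HC Hf) as [g [G1 [G2 G3]]].
      pose proof (nu_strict f C HC Hf) as Hst.
      assert (Fmin : forall x y, f (Rmin x y) = Rmin (f x) (f y)).
      { intros x y. unfold Rmin. destruct (Rle_dec x y) as [L|L], (Rle_dec (f x) (f y)) as [L'|L'];
          try reflexivity.
        - destruct (Req_dec x y) as [->|N]; [reflexivity|]. pose proof (Hst x y ltac:(lra)). lra.
        - pose proof (Hst y x ltac:(lra)). lra. }
      assert (Fmax : forall x y, f (Rmax x y) = Rmax (f x) (f y)).
      { intros x y. unfold Rmax. destruct (Rle_dec x y) as [L|L], (Rle_dec (f x) (f y)) as [L'|L'];
          try reflexivity.
        - destruct (Req_dec x y) as [->|N]; [reflexivity|]. pose proof (Hst x y ltac:(lra)). lra.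
        - pose proof (Hst y x ltac:(lra)). lra. }
      refine (ambient_isotopic_ext _ _ _ _ (fun z => iff_refl _) _
        (chords_move _ E (elo X) (ehi X) h h' f g C HC G1 G2 Hf G3 Hfam Hh)).
      apply gset_ext.
      * intros e He. destruct (HV e He). unfold elo, ehi. now rewrite Fmin, Fmax, !Ef.
      * intros e x He _. destruct (HV e He). unfold lines, elo, ehi.
        now rewrite !Fmin, !Fmax, !Ef.
Qed.


(** * Connected sums from two lifts that meet the level 0 in their end points *)

Definition tilt (p : pt) : pt := (pz p, py p, - px p).

(** Conjugated by the exchange of y and z, a quarter turn about the z-axis becomes one about the
    y-axis. It carries the level [z = 0] to the plane [x = 0] along which [conn_sum] is defined. *)
Lemma tilt_isotopic (A : pset) : ambient_isotopic A (fun p => A (tilt p)).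
Proof.
  pose proof (ambient_isotopic_conj swap_yz _ _ swap_yz_involutive swap_yz_dist1
    (rot_isotopic (PI / 2) (fun p => A (swap_yz p)))) as K.
  refine (ambient_isotopic_ext _ _ _ _ _ _ K); intros p; cbv beta.
  - now rewrite swap_yz_involutive.
  - replace (swap_yz (rot (- (PI / 2)) (swap_yz p))) with (tilt p); [reflexivity|].
    destruct p as [[x y] z].
    unfold rot, swap_yz, tilt, px, py, pz; simpl. rewrite cos_neg, sin_neg, cos_PI2, sin_PI2.
    apply pt_ext; unfold px, py, pz; simpl; ring.
Qed.

(** Both arcs are closed by the same segment in the level 0. They touch this level only at [P] and
    [Q], so the closed curves meet it exactly in the segment, and deleting its interior leaves the
    union of the arcs. *)
Lemma conn_sum_of_lifts (A B SU SL : pset) (P Q : pt) :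
  px P < px Q -> pz P = 0 -> pz Q = 0 ->
  SU P -> SU Q -> SL P -> SL Q ->
  (forall z, SU z -> 0 <= pz z /\ (pz z = 0 -> z = P \/ z = Q)) ->
  (forall z, SL z -> pz z <= 0 /\ (pz z = 0 -> z = P \/ z = Q)) ->
  ambient_isotopic A (fun z => SU z \/ seg P Q z) ->
  ambient_isotopic B (fun z => SL z \/ seg P Q z) ->
  conn_sum A B (fun z => SU (tilt z) \/ SL (tilt z)).
Proof.
  intros HPQ HP HQ UP UQ LP LQ HU HL HA HB.
  set (untilt := fun p : pt => (- pz p, py p, px p) : pt).
  assert (TU : forall p, tilt (untilt p) = p).
  { intros p. apply pt_ext; unfold tilt, untilt, px, py, pz; simpl; ring. }
  assert (UT : forall p, untilt (tilt p) = p).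
  { intros p. apply pt_ext; unfold tilt, untilt, px, py, pz; simpl; ring. }
  assert (Hlerp : forall t, lerp (untilt P) (untilt Q) t = untilt (lerp P Q t)).
  { intros t. apply pt_ext; unfold lerp, untilt, px, py, pz; simpl; ring. }
  assert (Hseg : forall z, seg (untilt P) (untilt Q) z <-> seg P Q (tilt z)).
  { intros z. split; intros [t [Ht E]]; exists t; (split; [exact Ht|]).
    - rewrite E, Hlerp. apply TU.
    - rewrite Hlerp, <- E. symmetry. apply UT. }
  assert (Hopen : forall z, open_seg (untilt P) (untilt Q) z <-> open_seg P Q (tilt z)).
  { intros z. split; intros [t [Ht E]]; exists t; (split; [exact Ht|]).
    - rewrite E, Hlerp. apply TU.
    - rewrite Hlerp, <- E. symmetry. apply UT. }
  assert (SP : seg P Q P).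
  { exists 0. split; [lra|]. apply pt_ext; unfold lerp, px, py, pz; simpl; ring. }
  assert (SQ : seg P Q Q).
  { exists 1. split; [lra|]. apply pt_ext; unfold lerp, px, py, pz; simpl; ring. }
  assert (Sz : forall z, seg P Q z -> pz z = 0).
  { intros z [t [_ ->]]. unfold lerp, pz; simpl.
    change (snd P) with (pz P). change (snd Q) with (pz Q). rewrite HP, HQ. ring. }
  assert (Oz : forall z, open_seg P Q z -> z <> P /\ z <> Q /\ seg P Q z).
  { intros z [t [Ht ->]].
    assert (E : px (lerp P Q t) = (1 - t) * px P + t * px Q) by reflexivity.
    split; [|split].
    - intros E'. rewrite E' in E. nra.
    - intros E'. rewrite E' in E. nra.
    - exists t. split; [lra|reflexivity]. }
  assert (Sends : forall z, seg P Q z -> ~ open_seg P Q z -> z = P \/ z = Q).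
  { intros z [t [Ht ->]] N.
    destruct (Req_dec t 0) as [->|]; [left|destruct (Req_dec t 1) as [->|]; [right|]].
    - apply pt_ext; unfold lerp, px, py, pz; simpl; ring.
    - apply pt_ext; unfold lerp, px, py, pz; simpl; ring.
    - exfalso. apply N. exists t. split; [lra|reflexivity]. }
  assert (Ez : forall z, px z = - pz (tilt z)) by (intros z; unfold tilt, px, pz; simpl; ring).
  exists (fun z => SU (tilt z) \/ seg P Q (tilt z)), (fun z => SL (tilt z) \/ seg P Q (tilt z)),
    (untilt P), (untilt Q).
  split; [exact (ambient_isotopic_trans _ _ _ HA (tilt_isotopic _))|].
  split; [exact (ambient_isotopic_trans _ _ _ HB (tilt_isotopic _))|].
  split; [|split; [|split; [|split; [|split; [|split; [|split]]]]]].
  - intros z [H|H]; rewrite Ez; [apply HU in H; lra|rewrite (Sz _ H); lra].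
  - intros z [H|H]; rewrite Ez; [apply HL in H; lra|rewrite (Sz _ H); lra].
  - rewrite Ez, TU. lra.
  - rewrite Ez, TU. lra.
  - intros E. apply (f_equal tilt) in E. rewrite !TU in E. rewrite E in HPQ. lra.
  - intros z. rewrite Hseg. split.
    + intros [[H|H] E]; [|exact H]. rewrite Ez in E.
      destruct (proj2 (HU _ H) ltac:(lra)) as [->| ->]; assumption.
    + intros H. split; [now right|]. rewrite Ez, (Sz _ H). lra.
  - intros z. rewrite Hseg. split.
    + intros [[H|H] E]; [|exact H]. rewrite Ez in E.
      destruct (proj2 (HL _ H) ltac:(lra)) as [->| ->]; assumption.
    + intros H. split; [now right|]. rewrite Ez, (Sz _ H). lra.
  - intros z. rewrite Hopen. split.
    + intros H. split; [tauto|]. intros O. destruct (Oz _ O) as [N1 [N2 S]].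
      apply Sz in S.
      destruct H as [H|H]; [destruct (proj2 (HU _ H) S)|destruct (proj2 (HL _ H) S)]; auto.
    + intros [H O].
      assert (C : SU (tilt z) \/ SL (tilt z) \/ seg P Q (tilt z)) by tauto.
      destruct C as [C|[C|C]]; [tauto|tauto|].
      destruct (Sends _ C O) as [->| ->]; tauto.
Qed.


(** * Positions, sheets and levels at crossings *)

Lemma cut_key_inj (n r k l : nat) :
  (1 <= r <= n)%nat -> (1 <= k <= n)%nat -> (1 <= l <= n)%nat ->
  cut_key n r k = cut_key n r l -> k = l.
Proof.
  intros Hr Hk Hl H. key_cases k; key_cases l; lia.
Qed.

Lemma level_inj (n u v : nat) : (1 <= u <= n)%nat -> (1 <= v <= n)%nat ->
  level n u = level n v -> u = v.
Proof.
  intros Hu Hv E. rewrite <- (label_level n u Hu), <- (label_level n v Hv). now rewrite E.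
Qed.

Definition abscissa (n r u : nat) : R := cut_pos n (label n r) u.

Lemma abscissa_lt_key (n r u v : nat) :
  (1 <= r <= n)%nat -> (1 <= u <= n)%nat -> (1 <= v <= n)%nat ->
  abscissa n r u < abscissa n r v <->
  (cut_key n r (level n u) < cut_key n r (level n v))%nat.
Proof.
  intros Hr Hu Hv. pose proof (label_bounds n r Hr) as Hl.
  assert (K : forall u v, (1 <= u <= n)%nat -> (1 <= v <= n)%nat ->
    (cut_key n r (level n u) < cut_key n r (level n v))%nat ->
    abscissa n r u < abscissa n r v).
  { clear u v Hu Hv. intros u v Hu Hv H.
    apply cut_pos_lt; [lia|exact Hu|exact Hv|].
    rewrite <- (label_level n u Hu), <- (label_level n v Hv).
    apply cut_rank_key; auto using level_bounds. }
  split; [|now apply K].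
  intros H. destruct (Nat.lt_trichotomy (cut_key n r (level n u)) (cut_key n r (level n v)))
    as [L|[L|L]]; [exact L| |].
  - apply cut_key_inj in L; auto using level_bounds. apply level_inj in L; auto.
    subst v. lra.
  - apply K in L; auto. lra.
Qed.

Lemma abscissa_inj (n r u v : nat) :
  (1 <= r <= n)%nat -> (1 <= u <= n)%nat -> (1 <= v <= n)%nat ->
  abscissa n r u = abscissa n r v -> u = v.
Proof.
  intros Hr Hu Hv E. apply (level_inj n); auto.
  apply (cut_key_inj n r); auto using level_bounds.
  destruct (Nat.lt_trichotomy (cut_key n r (level n u)) (cut_key n r (level n v)))
    as [L|[L|L]]; [|exact L|]; apply abscissa_lt_key in L; auto; lra.
Qed.

Lemma interleaved_ends (X : nat -> R) (e f : nat * nat) :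
  interleaved (elo X) (ehi X) e f ->
  exists a b c d, (e = (a, c) \/ e = (c, a)) /\ (f = (b, d) \/ f = (d, b)) /\
    X a < X b /\ X b < X c /\ X c < X d.
Proof.
  destruct e as [e1 e2], f as [f1 f2]. unfold interleaved, elo, ehi, Rmin, Rmax; simpl.
  destruct (Rle_dec (X e1) (X e2)), (Rle_dec (X f1) (X f2)); intros H.
  - exists e1, f1, e2, f2. auto.
  - exists e1, f2, e2, f1. auto.
  - exists e2, f1, e1, f2. auto.
  - exists e2, f2, e1, f1. auto.
Qed.

Definition natural_level (n : nat) (e : nat * nat) : nat :=
  edge_level (level n (fst e)) (level n (snd e)).

Lemma natural_level_swap (n u v : nat) : natural_level n (u, v) = natural_level n (v, u).
Proof. apply edge_level_sym. Qed.

Definition in_range (n : nat) (e : nat * nat) : Prop :=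
  (1 <= fst e <= n /\ 1 <= snd e <= n)%nat.

Lemma crossing_sheets (n r : nat) (e f : nat * nat) :
  (1 <= r <= n)%nat -> in_range n e -> in_range n f ->
  interleaved (elo (abscissa n r)) (ehi (abscissa n r)) e f -> sheet n e <> sheet n f.
Proof.
  intros Hr He Hf X. unfold in_range in *.
  destruct (interleaved_ends _ _ _ X) as [a [b [c [d [Ee [Ef [H1 [H2 H3]]]]]]]].
  assert (R : (1 <= a <= n /\ 1 <= b <= n /\ 1 <= c <= n /\ 1 <= d <= n)%nat).
  { destruct Ee as [-> | ->], Ef as [-> | ->]; simpl in *; lia. }
  destruct R as [Ra [Rb [Rc Rd]]].
  assert (S : sheet n (a, c) <> sheet n (b, d)).
  { apply abscissa_lt_key in H1, H2, H3; auto.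
    apply (interleaved_sheets n r (level n a) (level n b) (level n c) (level n d));
      auto using level_bounds; [apply (sheet_bounds n (a, c))|apply (sheet_bounds n (b, d))]. }
  destruct Ee as [-> | ->], Ef as [-> | ->]; auto.
  - now rewrite (sheet_sym n d b).
  - now rewrite (sheet_sym n c a).
  - now rewrite (sheet_sym n c a), (sheet_sym n d b).
Qed.

(** The sheet is half the level rounded up, so edges in different sheets have levels in the same
    strict order. Hence heights may be taken from levels, which are finer than sheets. *)
Lemma crossing_levels (n r : nat) (e f : nat * nat) :
  (1 <= r <= n)%nat -> in_range n e -> in_range n f ->
  interleaved (elo (abscissa n r)) (ehi (abscissa n r)) e f ->
  ((sheet n e < sheet n f /\ natural_level n e < natural_level n f) \/
   (sheet n f < sheet n e /\ natural_level n f < natural_level n e))%nat.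
Proof.
  intros Hr He Hf X. pose proof (crossing_sheets n r e f Hr He Hf X).
  pose proof (sheet_bounds n e) as Se. pose proof (sheet_bounds n f) as Sf.
  unfold natural_level. simpl in *. lia.
Qed.

Lemma edge_level_bounds (n k l : nat) :
  (1 <= k <= n)%nat -> (1 <= l <= n)%nat -> (1 <= edge_level k l <= n)%nat.
Proof. intros. destruct (edge_level_cases k l) as [[i [_ ->]]|[i [_ ->]]]; lia. Qed.

Lemma sheet_le (n : nat) (e : nat * nat) : in_range n e -> (sheet n e <= n)%nat.
Proof.
  intros [H1 H2]. pose proof (sheet_bounds n e) as S. simpl in S.
  pose proof (edge_level_bounds n _ _ (level_bounds n _ H1) (level_bounds n _ H2)). lia.
Qed.

Lemma height_sign (n s t l m : nat) (K : R) :
  (s <= n)%nat -> (t <= n)%nat -> ((s < t /\ l < m) \/ (t < s /\ m < l))%nat ->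
  same_sign (INR (n - s) - INR (n - t)) ((K - INR l) - (K - INR m)).
Proof.
  intros Hs Ht H. rewrite !minus_INR by assumption.
  destruct H as [[A B]|[A B]]; apply lt_INR in A, B; [left|right]; lra.
Qed.

(* Edge levels of a Hamiltonian cycle of the upper summand whose vertex of level
   [p - 1] is split, the edge leaving it starting from level [p + 1] instead. *)
Definition upper_edge_level (p : nat) (e : nat * nat) : nat :=
  if Nat.eqb (fst e) (label p (p - 1)) then edge_level (p + 1) (level p (snd e))
  else natural_level p e.

(* In the lower summand the vertex of level 2 is split, the edge entering it
   ending at level 0 instead (levels being shifted by [p + 1] in the sum). *)
Definition lower_edge_level (q : nat) (e : nat * nat) : nat :=
  if Nat.eqb (snd e) (label q 2) then edge_level (level q (fst e)) 0
  else natural_level q e.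

(** The split vertex is the last one after the cut. Of four alternating ends only the last can be
    it, so [e] keeps its level, and [interleaved_upper_cut] treats the change of [f]. *)
Lemma upper_crossing (p : nat) (e f : nat * nat) :
  (3 <= p)%nat -> in_range p e -> in_range p f ->
  interleaved (elo (abscissa p (p - 1))) (ehi (abscissa p (p - 1))) e f ->
  ((sheet p e < sheet p f /\ upper_edge_level p e < upper_edge_level p f) \/
   (sheet p f < sheet p e /\ upper_edge_level p f < upper_edge_level p e))%nat.
Proof.
  intros Hp He Hf X.
  pose proof (crossing_levels p (p - 1) e f ltac:(lia) He Hf X) as C.
  destruct (interleaved_ends _ _ _ X) as [a [b [c [d [Ee [Ef [H1 [H2 H3]]]]]]]].
  unfold in_range in *.
  assert (R : (1 <= a <= p /\ 1 <= b <= p /\ 1 <= c <= p /\ 1 <= d <= p)%nat).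
  { destruct Ee as [-> | ->], Ef as [-> | ->]; simpl in *; lia. }
  destruct R as [Ra [Rb [Rc Rd]]].
  apply abscissa_lt_key in H1, H2, H3; try lia.
  pose proof (level_bounds p a Ra). pose proof (level_bounds p b Rb).
  pose proof (level_bounds p c Rc). pose proof (level_bounds p d Rd).
  assert (Hmax : forall k, (1 <= k <= p)%nat ->
     (cut_key p (p - 1) k <= cut_key p (p - 1) (p - 1))%nat).
  { intros k Hk.
    destruct (cut_key_cases p (p - 1) k) as [[? [? [? ->]]]|[[? [? [? ->]]]|[? [? ->]]]];
    destruct (cut_key_cases p (p - 1) (p - 1))
      as [[? [? [? ->]]]|[[? [? [? ->]]]|[? [? ->]]]]; lia. }
  assert (Hnot : forall u, (1 <= u <= p)%nat ->
     (cut_key p (p - 1) (level p u) < cut_key p (p - 1) (level p d))%nat ->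
     Nat.eqb u (label p (p - 1)) = false).
  { intros u Hu L. apply Nat.eqb_neq. intros ->. rewrite level_label in L by lia.
    specialize (Hmax (level p d) ltac:(assumption)). lia. }
  assert (Ue : upper_edge_level p e = natural_level p e).
  { unfold upper_edge_level. destruct Ee as [-> | ->]; simpl; rewrite Hnot; auto; lia. }
  rewrite Ue. unfold upper_edge_level.
  destruct (Nat.eqb_spec (fst f) (label p (p - 1))) as [E|E]; [|exact C].
  assert (Ld : d = label p (p - 1) /\ f = (d, b)).
  { destruct Ef as [-> | ->]; simpl in E; [|auto]. exfalso.
    assert (N : Nat.eqb b (label p (p - 1)) = false) by (apply Hnot; auto; lia).
    apply Nat.eqb_neq in N. tauto. }
  destruct Ld as [Ld ->]. simpl.
  assert (Ld' : level p d = (p - 1)%nat) by (rewrite Ld; apply level_label; lia).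
  rewrite Ld' in *.
  destruct (interleaved_upper_cut p (level p a) (level p b) (level p c)) as [I1 I2]; auto.
  assert (Ee' : natural_level p e = edge_level (level p a) (level p c)).
  { destruct Ee as [-> | ->]; [reflexivity|apply edge_level_sym]. }
  assert (Ef' : natural_level p (d, b) = edge_level (level p b) (p - 1)).
  { unfold natural_level; simpl. rewrite Ld'. apply edge_level_sym. }
  rewrite (edge_level_sym (p + 1)), Ee' in *. rewrite Ef' in C. lia.
Qed.

Lemma lower_crossing (q : nat) (e f : nat * nat) :
  (3 <= q)%nat -> in_range q e -> in_range q f ->
  interleaved (elo (abscissa q 2)) (ehi (abscissa q 2)) e f ->
  ((sheet q e < sheet q f /\ lower_edge_level q e < lower_edge_level q f) \/
   (sheet q f < sheet q e /\ lower_edge_level q f < lower_edge_level q e))%nat.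
Proof.
  intros Hq He Hf X.
  pose proof (crossing_levels q 2 e f ltac:(lia) He Hf X) as C.
  destruct (interleaved_ends _ _ _ X) as [a [b [c [d [Ee [Ef [H1 [H2 H3]]]]]]]].
  unfold in_range in *.
  assert (R : (1 <= a <= q /\ 1 <= b <= q /\ 1 <= c <= q /\ 1 <= d <= q)%nat).
  { destruct Ee as [-> | ->], Ef as [-> | ->]; simpl in *; lia. }
  destruct R as [Ra [Rb [Rc Rd]]].
  apply abscissa_lt_key in H1, H2, H3; try lia.
  pose proof (level_bounds q a Ra). pose proof (level_bounds q b Rb).
  pose proof (level_bounds q c Rc). pose proof (level_bounds q d Rd).
  assert (Hmax : forall k, (1 <= k <= q)%nat -> (cut_key q 2 k <= cut_key q 2 2)%nat).
  { intros k Hk.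
    destruct (cut_key_cases q 2 k) as [[? [? [? ->]]]|[[? [? [? ->]]]|[? [? ->]]]];
    destruct (cut_key_cases q 2 2) as [[? [? [? ->]]]|[[? [? [? ->]]]|[? [? ->]]]]; lia. }
  assert (Hnot : forall u, (1 <= u <= q)%nat ->
     (cut_key q 2 (level q u) < cut_key q 2 (level q d))%nat ->
     Nat.eqb u (label q 2) = false).
  { intros u Hu L. apply Nat.eqb_neq. intros ->. rewrite level_label in L by lia.
    specialize (Hmax (level q d) ltac:(assumption)). lia. }
  assert (Ue : lower_edge_level q e = natural_level q e).
  { unfold lower_edge_level. destruct Ee as [-> | ->]; simpl; rewrite Hnot; auto; lia. }
  rewrite Ue. unfold lower_edge_level.
  destruct (Nat.eqb_spec (snd f) (label q 2)) as [E|E]; [|exact C].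
  assert (Ld : d = label q 2 /\ f = (b, d)).
  { destruct Ef as [-> | ->]; simpl in E; [auto|]. exfalso.
    assert (N : Nat.eqb b (label q 2) = false) by (apply Hnot; auto; lia).
    apply Nat.eqb_neq in N. tauto. }
  destruct Ld as [Ld ->]. simpl.
  assert (Ld' : level q d = 2%nat) by (rewrite Ld; apply level_label; lia).
  rewrite Ld' in *.
  destruct (interleaved_lower_cut q (level q a) (level q b) (level q c)) as [I1 I2]; auto.
  assert (Ee' : natural_level q e = edge_level (level q a) (level q c)).
  { destruct Ee as [-> | ->]; [reflexivity|apply edge_level_sym]. }
  assert (Ef' : natural_level q (b, d) = edge_level (level q b) 2).
  { unfold natural_level; simpl. now rewrite Ld'. }
  rewrite Ee' in *. rewrite Ef' in C. lia.
Qed.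


(** * The joined book *)

(* In the book of [p + q + 1] vertices the levels up to [p - 2], and [p], carry
   the upper summand, the levels [p + 2] and from [p + 4] on the lower one.  The
   two are joined at the levels [p - 1], [p + 1], [p + 3], which are consecutive
   vertices of the circle (apart from vertices of the other summand), and the
   circle is cut just after the last of them. *)
Definition join1 (p q : nat) : nat := label (p + q + 1) (p - 1).
Definition join2 (p q : nat) : nat := label (p + q + 1) (p + 1).
Definition join3 (p q : nat) : nat := label (p + q + 1) (p + 3).
Definition place (p q : nat) : nat -> R := abscissa (p + q + 1) (p + 3).

(** The offset makes the heights of the upper edges positive, while those of the lower edges are
    negative. The value 0 is thus free for the separating surface, and within each summand the order
    is by level. *)
Definition height (p q : nat) (e : nat * nat) : R :=
  if Nat.leb (Nat.min (level (p + q + 1) (fst e)) (level (p + q + 1) (snd e))) p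
  then INR (p + q + 1) + 1 - INR (natural_level (p + q + 1) e)
  else - INR (natural_level (p + q + 1) e).

Definition summand_vertex (p q v : nat) : Prop :=
  (1 <= v <= p + q + 1 /\ level (p + q + 1) v <> p - 1 /\
   level (p + q + 1) v <> p + 1 /\ level (p + q + 1) v <> p + 3)%nat.

Lemma join_levels (p q : nat) : (3 <= p)%nat -> (3 <= q)%nat ->
  (1 <= join1 p q <= p + q + 1 /\ level (p + q + 1) (join1 p q) = p - 1)%nat /\
  (1 <= join2 p q <= p + q + 1 /\ level (p + q + 1) (join2 p q) = p + 1)%nat /\
  (1 <= join3 p q <= p + q + 1 /\ level (p + q + 1) (join3 p q) = p + 3)%nat.
Proof.
  intros Hp Hq. unfold join1, join2, join3.
  repeat split; try (apply label_bounds; lia); apply level_label; lia.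
Qed.

Lemma place_join (p q : nat) : (3 <= p)%nat -> (3 <= q)%nat ->
  place p q (join1 p q) < place p q (join2 p q) /\
  place p q (join2 p q) < place p q (join3 p q).
Proof.
  intros Hp Hq. destruct (join_levels p q Hp Hq) as [[A1 A2] [[B1 B2] [C1 C2]]].
  destruct (cut_key_join p q 1 Hp Hq ltac:(lia)) as [_ [_ [_ [K1 K2]]]].
  split; apply abscissa_lt_key; try lia; rewrite ?A2, ?B2, ?C2; assumption.
Qed.

Lemma place_summand (p q v : nat) : (3 <= p)%nat -> (3 <= q)%nat ->
  summand_vertex p q v -> place p q v < place p q (join1 p q).
Proof.
  intros Hp Hq [Hv [N1 [N2 N3]]].
  destruct (join_levels p q Hp Hq) as [[A1 A2] [[B1 B2] [C1 C2]]].
  pose proof (level_bounds _ _ Hv) as Hl.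
  destruct (cut_key_join p q _ Hp Hq Hl) as [_ [_ [K _]]]. specialize (K N3 N2).
  apply abscissa_lt_key; try lia. rewrite A2.
  destruct (Nat.eq_dec (cut_key (p + q + 1) (p + 3) (level (p + q + 1) v))
    (cut_key (p + q + 1) (p + 3) (p - 1))) as [E|E]; [|lia].
  apply cut_key_inj in E; lia.
Qed.

Lemma place_inj (p q u v : nat) : (3 <= p)%nat -> (3 <= q)%nat ->
  (1 <= u <= p + q + 1)%nat -> (1 <= v <= p + q + 1)%nat ->
  place p q u = place p q v -> u = v.
Proof. intros Hp Hq Hu Hv. apply abscissa_inj; lia. Qed.

Lemma height_sym (p q u v : nat) : height p q (u, v) = height p q (v, u).
Proof.
  unfold height; simpl. rewrite Nat.min_comm, natural_level_swap. reflexivity.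
Qed.

Definition is_upper (p q : nat) (e : nat * nat) : Prop :=
  (Nat.min (level (p + q + 1) (fst e)) (level (p + q + 1) (snd e)) <= p)%nat.

Lemma height_upper (p q : nat) (e : nat * nat) : is_upper p q e ->
  height p q e = INR (p + q + 1) + 1 - INR (natural_level (p + q + 1) e).
Proof. intros H. unfold height. apply Nat.leb_le in H. now rewrite H. Qed.

Lemma height_lower (p q : nat) (e : nat * nat) : ~ is_upper p q e ->
  height p q e = - INR (natural_level (p + q + 1) e).
Proof.
  intros H. unfold height. destruct (Nat.leb_spec (Nat.min (level (p + q + 1) (fst e))
    (level (p + q + 1) (snd e))) p); [contradiction|reflexivity].
Qed.

Lemma height_crossing (p q : nat) (e f : nat * nat) :
  (3 <= p)%nat -> (3 <= q)%nat ->
  in_range (p + q + 1) e -> in_range (p + q + 1) f ->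
  (is_upper p q e <-> is_upper p q f) ->
  interleaved (elo (place p q)) (ehi (place p q)) e f ->
  height p q e <> height p q f.
Proof.
  intros Hp Hq He Hf U X.
  pose proof (crossing_levels (p + q + 1) (p + 3) e f ltac:(lia) He Hf X) as C.
  assert (N : INR (natural_level (p + q + 1) e) <> INR (natural_level (p + q + 1) f)).
  { intros E. apply INR_eq in E. lia. }
  destruct (classic (is_upper p q e)).
  - rewrite !height_upper by tauto. lra.
  - rewrite !height_lower by tauto. lra.
Qed.

Lemma lift_chord_lt (X : nat -> R) (h : nat * nat -> R) (u v : nat) :
  X u < X v -> lift_chord X h (u, v) = (X u, X v, h (u, v)).
Proof.
  intros L. unfold lift_chord, elo, ehi; simpl.
  rewrite Rmin_left, Rmax_right by lra. reflexivity.
Qed.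

Lemma lift_chord_gt (X : nat -> R) (h : nat * nat -> R) (u v : nat) :
  X v < X u -> lift_chord X h (u, v) = (X v, X u, h (u, v)).
Proof.
  intros L. unfold lift_chord, elo, ehi; simpl.
  rewrite Rmin_right, Rmax_left by lra. reflexivity.
Qed.

Lemma elo_lt (X : nat -> R) (u v : nat) : X u < X v -> elo X (u, v) = X u /\ ehi X (u, v) = X v.
Proof. intros. unfold elo, ehi; simpl. rewrite Rmin_left, Rmax_right by lra. auto. Qed.

Lemma elo_gt (X : nat -> R) (u v : nat) : X v < X u -> elo X (u, v) = X v /\ ehi X (u, v) = X u.
Proof. intros. unfold elo, ehi; simpl. rewrite Rmin_right, Rmax_left by lra. auto. Qed.

Lemma ehi_bound (X : nat -> R) (e : nat * nat) (b : R) :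
  X (fst e) < b -> X (snd e) < b -> elo X e < b /\ ehi X e < b.
Proof.
  intros. unfold elo, ehi, Rmin, Rmax.
  destruct (Rle_dec (X (fst e)) (X (snd e))); lra.
Qed.

Definition upper_vertex (p q v : nat) : Prop :=
  (1 <= v <= p + q + 1 /\ level (p + q + 1) v <= p /\ level (p + q + 1) v <> p - 1)%nat.

Definition lower_vertex (p q v : nat) : Prop :=
  (1 <= v <= p + q + 1 /\ p + 2 <= level (p + q + 1) v /\ level (p + q + 1) v <> p + 3)%nat.

Lemma upper_vertex_summand (p q v : nat) : upper_vertex p q v -> summand_vertex p q v.
Proof. intros [H1 [H2 H3]]. split; [exact H1|]. lia. Qed.

Lemma lower_vertex_summand (p q v : nat) : lower_vertex p q v -> summand_vertex p q v.
Proof. intros [H1 [H2 H3]]. split; [exact H1|]. lia. Qed.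

Definition upper_edges (p q : nat) (m : list nat) : list (nat * nat) :=
  (join2 p q, hd 0%nat m) :: path_edges m ++
    [(last m 0%nat, join1 p q); (join1 p q, join3 p q)].

Definition lower_edges (p q : nat) (m : list nat) : list (nat * nat) :=
  (join3 p q, hd 0%nat m) :: path_edges m ++ [(last m 0%nat, join2 p q)].

Lemma chord_family_incl (I : Type) (l l' : list I) (a b : I -> R) :
  incl l' l -> chord_family l a b -> chord_family l' a b.
Proof. intros H [F1 F2]. split; [auto|]. intros i j Hi Hj. apply F2; auto. Qed.

(* The vertex [i] is removed from the path [z - i - o], where [o] is also joined
   to [y], and [i] and [o] are the last two vertices. *)
Lemma contract_before_end (X : nat -> R) (H : nat * nat -> R) (E : list (nat * nat))
  (i o y z : nat) (h0 h1 h2 : R) :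
  X y < X i -> X z < X i -> X i < X o -> X y <> X z ->
  (forall e, In e E -> X (fst e) < X i /\ X (snd e) < X i) ->
  chord_family E (elo X) (ehi X) -> h1 <> h2 ->
  (forall e, In e E -> interleaved (elo X) (ehi X) e (y, i) -> H e <> h1) ->
  (forall e, In e E -> interleaved (elo X) (ehi X) e (z, i) -> H e <> h2) ->
  (forall e f, In e E -> In f E -> interleaved (elo X) (ehi X) e f -> H e <> H f) ->
  ambient_isotopic
    (chord_set ((X i, X o, h0) :: (X z, X i, h2) :: (X y, X o, h1) :: map (lift_chord X H) E))
    (chord_set ((X z, X o, h2) :: (X y, X o, h1) :: map (lift_chord X H) E)).
Proof.
  intros Hy Hz Hio Hyz HE [F1 F2] H12 Hcy Hcz Hcr.
  assert (Hin : forall x, In x (map (lift_chord X H) E) -> exists e, In e E /\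
     x = lift_chord X H e /\ lo x < X i /\ hi x < X i).
  { intros x I. apply in_map_iff in I. destruct I as [e [<- I]]. exists e.
    destruct (HE e I). split; [exact I|]. split; [reflexivity|]. now apply ehi_bound. }
  assert (Hlt : forall x, In x (map (lift_chord X H) E) -> lo x < hi x).
  { intros x I. destruct (Hin x I) as [e [I0 [-> _]]]. now apply F1. }
  assert (Huniq : forall x x', In x (map (lift_chord X H) E) -> In x' (map (lift_chord X H) E) ->
     lo x = lo x' -> hi x = hi x' -> x = x').
  { intros x x' I I' A B. destruct (Hin x I) as [e [I0 [-> _]]], (Hin x' I') as [f [J0 [-> _]]].
    now rewrite (F2 e f I0 J0 A B). }
  apply chord_set_contract; auto.
  - intros x [<-|I]; unfold lo, hi; simpl; [lra|].
    destruct (Hin x I) as [e [_ [_ [I1 I2]]]]. unfold lo, hi in *. lra.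
  - intros x [<-|I] Ex; [exact H12|]. destruct (Hin x I) as [e [_ [_ [I1 I2]]]]. lra.
  - intros x [<-|I] L1 L2; [exact H12|]. destruct (Hin x I) as [e [I0 [-> [I1 I2]]]].
    apply Hcz; [exact I0|]. destruct (elo_lt X z i Hz) as [G1 G2].
    unfold interleaved. rewrite G1, G2. split; [exact L1|]. split; [exact L2|exact I2].
  - intros x x' [<-|I] [<-|I'] [L1 [L2 L3]].
    + lra.
    + destruct (Hin x' I') as [e [_ [_ [I1 I2]]]].
      unfold lo, hi in L1, L2, L3, I1, I2; simpl in L1, L2, L3. lra.
    + destruct (Hin x I) as [e [I0 [-> [I1 I2]]]]. apply Hcy; [exact I0|].
      destruct (elo_lt X y i Hy) as [G1 G2].
      unfold interleaved. rewrite G1, G2. split; [exact L1|]. split; [exact L2|exact I2].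
    + destruct (Hin x I) as [e [I0 [-> _]]], (Hin x' I') as [e' [I0' [-> _]]].
      apply Hcr; auto. split; [exact L1|]. split; [exact L2|exact L3].
  - split.
    + intros x [<-|[<-|[<-|I]]]; [| | |auto]; unfold lo, hi; simpl; lra.
    + intros x x' [<-|[<-|[<-|I]]] [<-|[<-|[<-|I']]] A B; auto;
        try (destruct (Hin x I) as [_ [_ [_ [G1 G2]]]]);
        try (destruct (Hin x' I') as [_ [_ [_ [K1 K2]]]]);
        exfalso; unfold lo, hi in *; simpl in *; lra.
  - split.
    + intros x [<-|[<-|I]]; [| |auto]; unfold lo, hi; simpl; lra.
    + intros x x' [<-|[<-|I]] [<-|[<-|I']] A B; auto;
        try (destruct (Hin x I) as [_ [_ [_ [G1 G2]]]]);
        try (destruct (Hin x' I') as [_ [_ [_ [K1 K2]]]]);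
        exfalso; unfold lo, hi in *; simpl in *; lra.
Qed.

(** The closed arc has two vertices too many, [c] and [d]. Each is removed at the moment when [c']
    is its right neighbour, and the edge from the interior keeps its height while its end moves to
    [c']. The result is alpha with its split vertex reunited at [c']. *)
Lemma upper_contract (p q : nat) (m : list nat) :
  (3 <= p)%nat -> (3 <= q)%nat -> NoDup m -> (2 <= length m)%nat ->
  (forall v, In v m -> upper_vertex p q v) ->
  ambient_isotopic
    (chord_set (map (lift_chord (place p q) (height p q))
       ((join2 p q, join3 p q) :: upper_edges p q m)))
    (chord_set ((place p q (last m 0%nat), place p q (join3 p q),
                   height p q (last m 0%nat, join1 p q))
       :: (place p q (hd 0%nat m), place p q (join3 p q), height p q (join2 p q, hd 0%nat m))
       :: map (lift_chord (place p q) (height p q)) (path_edges m))).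
Proof.
  intros Hp Hq Hn Hm Hv.
  destruct (join_levels p q Hp Hq) as [[A1 A2] [[B1 B2] [C1 C2]]].
  destruct (place_join p q Hp Hq) as [O1 O2].
  assert (Hm0 : m <> []) by (intros ->; simpl in Hm; lia).
  set (X := place p q) in *. set (H := height p q) in *.
  set (d := join1 p q) in *. set (c := join2 p q) in *. set (c' := join3 p q) in *.
  assert (Xm : forall v, In v m -> X v < X d).
  { intros v I. apply place_summand; auto. now apply upper_vertex_summand, Hv. }
  assert (Rm : forall v, In v m -> (1 <= v <= p + q + 1)%nat) by (intros v I; apply (Hv v I)).
  assert (Jm : forall v, In v m -> v <> d /\ v <> c /\ v <> c').
  { intros v I. pose proof (Xm v I). repeat split; intros ->; lra. }
  assert (Jd : d <> c /\ d <> c' /\ c <> c').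
  { repeat split; intros E; rewrite E in *; lia. }
  set (y := hd 0%nat m) in *. set (z := last m 0%nat) in *.
  assert (Iy : In y m) by now apply hd_in. assert (Iz : In z m) by now apply last_in.
  assert (Nyz : y <> z) by now apply hd_neq_last.
  pose proof (Xm y Iy) as Xy. pose proof (Xm z Iz) as Xz.
  assert (Xinj : forall u v, (1 <= u <= p + q + 1)%nat -> (1 <= v <= p + q + 1)%nat ->
     X u = X v -> u = v) by (intros u v; exact (place_inj p q u v Hp Hq)).
  assert (Pe : forall e, In e (path_edges m) -> In (fst e) m /\ In (snd e) m).
  { intros [u v] I. now apply path_edges_in. }
  assert (Up : forall e, (In (fst e) m \/ In (snd e) m \/ fst e = d) -> is_upper p q e).
  { intros e [I|[I|I]]; unfold is_upper.
    - destruct (Hv _ I). lia.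
    - destruct (Hv _ I). lia.
    - rewrite I, A2. lia. }
  assert (Hcr : forall e f, (In (fst e) m \/ In (snd e) m \/ fst e = d) ->
     (In (fst f) m \/ In (snd f) m \/ fst f = d) ->
     in_range (p + q + 1) e -> in_range (p + q + 1) f ->
     interleaved (elo X) (ehi X) e f -> H e <> H f).
  { intros e f Ue Uf Re Rf I. apply height_crossing; auto.
    pose proof (Up e Ue). pose proof (Up f Uf). tauto. }
  assert (Re : forall e, In e (path_edges m) -> in_range (p + q + 1) e).
  { intros e I. destruct (Pe e I). split; auto. }
  assert (Lev : forall v, In v m -> (1 <= level (p + q + 1) v <= p)%nat /\
     level (p + q + 1) v <> (p - 1)%nat).
  { intros v I. destruct (Hv v I) as [V1 [V2 V3]].
    pose proof (level_bounds _ _ V1). lia. }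
  assert (Lyz : level (p + q + 1) y <> level (p + q + 1) z).
  { intros E. apply Nyz. apply (level_inj (p + q + 1)); auto. }
  (* Both chords will end at [c'], where only different heights keep them apart. Their levels could
     agree only if [y] and [z] had the same level. *)
  assert (H12 : H (c, y) <> H (z, d)).
  { unfold H. rewrite !height_upper by (apply Up; simpl; auto). unfold natural_level; simpl.
    rewrite B2, A2. intros E. assert (E' : edge_level (p + 1) (level (p + q + 1) y) =
      edge_level (level (p + q + 1) z) (p - 1)) by (apply INR_eq; lra).
    destruct (Lev y Iy), (Lev z Iz).
    destruct (edge_level_cases (p + 1) (level (p + q + 1) y)) as [[i [P F]]|[i [P F]]];
    destruct (edge_level_cases (level (p + q + 1) z) (p - 1)) as [[j [P' F']]|[j [P' F']]];
    rewrite F, F' in E'; lia. }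
  assert (H13 : H (d, c') <> H (c, y)).
  { unfold H. rewrite !height_upper by (apply Up; simpl; auto). unfold natural_level; simpl.
    rewrite A2, B2, C2. intros E. assert (E' : edge_level (p - 1) (p + 3) =
      edge_level (p + 1) (level (p + q + 1) y)) by (apply INR_eq; lra).
    destruct (Lev y Iy).
    destruct (edge_level_cases (p + 1) (level (p + q + 1) y)) as [[i [P F]]|[i [P F]]];
    destruct (edge_level_cases (p - 1) (p + 3)) as [[j [P' F']]|[j [P' F']]];
    rewrite F, F' in E'; lia. }
  assert (Hzd : in_range (p + q + 1) (z, d)) by (split; simpl; auto).
  assert (Hcy : in_range (p + q + 1) (c, y)) by (split; simpl; auto).
  assert (Nd : NoDup (d :: m)).
  { constructor; auto. intros I. destruct (Jm d I) as [N _]. now apply N. }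
  assert (F : chord_family (path_edges m ++ [(z, d)]) (elo X) (ehi X)).
  { apply chord_family_incl with (l := cycle_edges (d :: m)).
    - rewrite cycle_edges_cons by exact Hm0. now apply incl_tl, incl_refl.
    - apply cycle_family; [exact Nd|simpl; lia|].
      intros u v [<-|Iu] [<-|Iv]; apply Xinj; auto. }
  apply ambient_isotopic_ext with
    (A := chord_set ((X c, X c', H (c, c')) :: (X y, X c, H (c, y)) :: (X d, X c', H (d, c'))
            :: map (lift_chord X H) (path_edges m ++ [(z, d)])))
    (B := chord_set ((X z, X c', H (z, d)) :: (X y, X c', H (c, y))
            :: map (lift_chord X H) (path_edges m))); [|reflexivity|].
  { intros pp. apply chord_set_ext. intros x. unfold upper_edges. fold c c' d y z. simpl map.
    rewrite !map_app. simpl map.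
    rewrite (lift_chord_lt X H c c'), (lift_chord_gt X H c y), (lift_chord_lt X H d c') by lra.
    simpl. rewrite !in_app_iff. simpl. tauto. }
  (* Removal of [c], the last vertex before [c']. *)
  apply ambient_isotopic_trans with (B := chord_set ((X y, X c', H (c, y)) :: (X d, X c', H (d, c'))
            :: map (lift_chord X H) (path_edges m ++ [(z, d)]))).
  { assert (Ze : forall e, In e (path_edges m ++ [(z, d)]) -> in_range (p + q + 1) e /\
       (In (fst e) m \/ In (snd e) m \/ fst e = d) /\ X (fst e) < X c /\ X (snd e) < X c).
    { intros e I. apply in_app_iff in I. destruct I as [I|[<-|[]]].
      - destruct (Pe e I) as [I1 I2]. pose proof (Xm _ I1). pose proof (Xm _ I2).
        repeat split; auto; try apply Re; auto; lra.
      - simpl. split; [exact Hzd|]. split; [auto|]. lra. }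
    apply contract_before_end; auto; try lra.
    - intros e I. apply (Ze e I).
    - intros e I [L1 [L2 L3]]. exfalso. destruct (elo_lt X d c O1) as [G1 G2]. rewrite G1 in *.
      apply in_app_iff in I. destruct I as [I|[<-|[]]].
      + destruct (Pe e I) as [I1 I2]. pose proof (Xm _ I1). pose proof (Xm _ I2).
        destruct (ehi_bound X e (X d)); auto. lra.
      + destruct (elo_lt X z d Xz). lra.
    - intros e I L. destruct (Ze e I) as [Ie [Ue _]].
      replace (H (c, y)) with (H (y, c)) by (unfold H; now rewrite height_sym).
      apply (Hcr e (y, c)); simpl; auto. split; simpl; auto.
    - intros e f Ie If. destruct (Ze e Ie), (Ze f If). apply Hcr; tauto. }
  (* Now [d] is the last vertex before [c'], and it is removed in the same way. *)
  apply ambient_isotopic_ext with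
    (A := chord_set ((X d, X c', H (d, c')) :: (X z, X d, H (z, d)) :: (X y, X c', H (c, y))
            :: map (lift_chord X H) (path_edges m)))
    (B := chord_set ((X z, X c', H (z, d)) :: (X y, X c', H (c, y))
            :: map (lift_chord X H) (path_edges m))); [|reflexivity|].
  { intros pp. apply chord_set_ext. intros x. rewrite !map_app. simpl map.
    rewrite (lift_chord_lt X H z d) by lra. simpl. rewrite !in_app_iff. simpl. tauto. }
  apply contract_before_end; auto; try lra.
  - intros e I. destruct (Pe e I). auto.
  - refine (chord_family_incl _ _ _ _ _ _ F). apply incl_appl, incl_refl.
  - intros e I [L1 [L2 L3]]. destruct (Pe e I) as [I1 I2].
    destruct (elo_lt X y d Xy) as [G1 G2]. rewrite G1, G2 in *.
    apply (Hcr e (c, y)); simpl; auto. unfold interleaved.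
    destruct (elo_gt X c y ltac:(lra)) as [-> ->]. lra.
  - intros e I L. destruct (Pe e I). apply (Hcr e (z, d)); simpl; auto.
  - intros e f Ie If. destruct (Pe e Ie), (Pe f If). apply Hcr; auto.
Qed.

Lemma lower_contract (p q : nat) (m : list nat) :
  (3 <= p)%nat -> (3 <= q)%nat -> NoDup m -> (2 <= length m)%nat ->
  (forall v, In v m -> lower_vertex p q v) ->
  ambient_isotopic
    (chord_set (map (lift_chord (place p q) (height p q))
       ((join2 p q, join3 p q) :: lower_edges p q m)))
    (chord_set ((place p q (last m 0%nat), place p q (join3 p q),
                   height p q (last m 0%nat, join2 p q))
       :: (place p q (hd 0%nat m), place p q (join3 p q), height p q (join3 p q, hd 0%nat m))
       :: map (lift_chord (place p q) (height p q)) (path_edges m))).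
Proof.
  intros Hp Hq Hn Hm Hv.
  destruct (join_levels p q Hp Hq) as [_ [[B1 B2] [C1 C2]]].
  destruct (place_join p q Hp Hq) as [O1 O2].
  assert (Hm0 : m <> []) by (intros ->; simpl in Hm; lia).
  set (X := place p q) in *. set (H := height p q) in *.
  set (c := join2 p q) in *. set (c' := join3 p q) in *.
  assert (Xm : forall v, In v m -> X v < X c).
  { intros v I. pose proof (place_summand p q v Hp Hq (lower_vertex_summand _ _ _ (Hv v I))).
    fold X in H0. lra. }
  assert (Rm : forall v, In v m -> (1 <= v <= p + q + 1)%nat) by (intros v I; apply (Hv v I)).
  assert (Jm : forall v, In v m -> v <> c /\ v <> c').
  { intros v I. pose proof (Xm v I). split; intros ->; lra. }
  assert (Jd : c <> c') by (intros E; rewrite E in *; lia).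
  set (y := hd 0%nat m) in *. set (z := last m 0%nat) in *.
  assert (Iy : In y m) by now apply hd_in. assert (Iz : In z m) by now apply last_in.
  assert (Nyz : y <> z) by now apply hd_neq_last.
  pose proof (Xm y Iy) as Xy. pose proof (Xm z Iz) as Xz.
  assert (Xinj : forall u v, (1 <= u <= p + q + 1)%nat -> (1 <= v <= p + q + 1)%nat ->
     X u = X v -> u = v) by (intros u v; exact (place_inj p q u v Hp Hq)).
  assert (Pe : forall e, In e (path_edges m) -> In (fst e) m /\ In (snd e) m).
  { intros [u v] I. now apply path_edges_in. }
  assert (Low : forall e, (In (fst e) m \/ fst e = c') -> (In (snd e) m \/ snd e = c) ->
     ~ is_upper p q e /\ in_range (p + q + 1) e).
  { intros e I1 I2. unfold is_upper, in_range.
    assert (L1 : (p < level (p + q + 1) (fst e) /\ 1 <= fst e <= p + q + 1)%nat).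
    { destruct I1 as [I|E]; [destruct (Hv _ I); lia|rewrite E, C2; lia]. }
    assert (L2 : (p < level (p + q + 1) (snd e) /\ 1 <= snd e <= p + q + 1)%nat).
    { destruct I2 as [I|E]; [destruct (Hv _ I); lia|rewrite E, B2; lia]. }
    lia. }
  assert (Hcr : forall e f, (In (fst e) m \/ fst e = c') -> (In (snd e) m \/ snd e = c) ->
     (In (fst f) m \/ fst f = c') -> (In (snd f) m \/ snd f = c) ->
     interleaved (elo X) (ehi X) e f -> H e <> H f).
  { intros e f Ue Ue' Uf Uf' I. destruct (Low e Ue Ue'), (Low f Uf Uf').
    apply height_crossing; tauto. }
  assert (Lev : forall v, In v m -> (p + 2 <= level (p + q + 1) v)%nat /\
     level (p + q + 1) v <> (p + 3)%nat).
  { intros v I. destruct (Hv v I) as [V1 [V2 V3]]. lia. }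
  assert (Lyz : level (p + q + 1) y <> level (p + q + 1) z).
  { intros E. apply Nyz. apply (level_inj (p + q + 1)); auto. }
  assert (H12 : H (c', y) <> H (z, c)).
  { unfold H. rewrite !height_lower by (apply Low; simpl; auto). unfold natural_level; simpl.
    rewrite B2, C2. intros E. assert (E' : edge_level (p + 3) (level (p + q + 1) y) =
      edge_level (level (p + q + 1) z) (p + 1)) by (apply INR_eq; lra).
    destruct (Lev y Iy), (Lev z Iz).
    destruct (edge_level_cases (p + 3) (level (p + q + 1) y)) as [[i [P F]]|[i [P F]]];
    destruct (edge_level_cases (level (p + q + 1) z) (p + 1)) as [[j [P' F']]|[j [P' F']]];
    rewrite F, F' in E'; lia. }
  apply ambient_isotopic_ext with
    (A := chord_set ((X c, X c', H (c, c')) :: (X z, X c, H (z, c)) :: (X y, X c', H (c', y))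
            :: map (lift_chord X H) (path_edges m)))
    (B := chord_set ((X z, X c', H (z, c)) :: (X y, X c', H (c', y))
            :: map (lift_chord X H) (path_edges m))); [|reflexivity|].
  { intros pp. apply chord_set_ext. intros x. unfold lower_edges. fold c c' y z. simpl map.
    rewrite map_app. simpl map.
    rewrite (lift_chord_lt X H c c'), (lift_chord_gt X H c' y), (lift_chord_lt X H z c) by lra.
    simpl. rewrite in_app_iff. simpl. tauto. }
  apply contract_before_end; auto.
  - intros e I. destruct (Pe e I). auto.
  - apply chord_family_incl with (l := cycle_edges (c :: m)).
    + rewrite cycle_edges_cons by exact Hm0. now apply incl_tl, incl_appl, incl_refl.
    + apply cycle_family; [|simpl; lia|].
      * constructor; auto. intros I. destruct (Jm c I) as [N _]. now apply N.
      * intros u v [<-|Iu] [<-|Iv]; apply Xinj; auto.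
  - intros e I [L1 [L2 L3]]. destruct (Pe e I) as [I1 I2].
    destruct (elo_lt X y c Xy) as [G1 G2]. rewrite G1, G2 in *.
    apply (Hcr e (c', y)); simpl; auto. unfold interleaved.
    destruct (elo_gt X c' y ltac:(lra)) as [-> ->]. lra.
  - intros e I L. destruct (Pe e I). apply (Hcr e (z, c)); simpl; auto.
  - intros e f Ie If. destruct (Pe e Ie), (Pe f If). apply Hcr; auto.
Qed.


(** * The two given knots, placed at the positions of the joined book *)

Lemma hd_map (f : nat -> nat) (l : list nat) : l <> [] ->
  hd 0%nat (map f l) = f (hd 0%nat l).
Proof. destruct l; [congruence|reflexivity]. Qed.

Lemma last_map (f : nat -> nat) (l : list nat) : l <> [] ->
  last (map f l) 0%nat = f (last l 0%nat).
Proof.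
  intros H. destruct (exists_last H) as [l' [x ->]].
  rewrite map_app. simpl. now rewrite !last_last.
Qed.

Definition up_label (p q u : nat) : nat := label (p + q + 1) (upper_level p (level p u)).
Definition down_label (p q u : nat) : nat := label (p + q + 1) (lower_level p (level q u)).

Lemma up_cut (p q : nat) : (3 <= p)%nat -> up_label p q (label p (p - 1)) = join3 p q.
Proof.
  intros Hp. unfold up_label, join3. rewrite level_label by lia. unfold upper_level.
  now rewrite Nat.eqb_refl.
Qed.

Lemma down_cut (p q : nat) : (3 <= q)%nat -> down_label p q (label q 2) = join3 p q.
Proof.
  intros Hq. unfold down_label, join3, lower_level. rewrite level_label by lia. f_equal. lia.
Qed.

Lemma up_level (p q u : nat) : (3 <= p)%nat -> (3 <= q)%nat -> (1 <= u <= p)%nat ->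
  (1 <= up_label p q u <= p + q + 1 /\
   level (p + q + 1) (up_label p q u) = upper_level p (level p u))%nat.
Proof.
  intros Hp Hq Hu. pose proof (level_bounds p u Hu).
  assert (B : (1 <= upper_level p (level p u) <= p + q + 1)%nat).
  { destruct (upper_level_cases p (level p u)) as [[? ->]|[? ->]]; lia. }
  split; [now apply label_bounds|now apply level_label].
Qed.

Lemma down_level (p q u : nat) : (3 <= p)%nat -> (3 <= q)%nat -> (1 <= u <= q)%nat ->
  (1 <= down_label p q u <= p + q + 1 /\
   level (p + q + 1) (down_label p q u) = p + 1 + level q u)%nat.
Proof.
  intros Hp Hq Hu. pose proof (level_bounds q u Hu). unfold down_label, lower_level.
  split; [apply label_bounds; lia|apply level_label; lia].
Qed.

Lemma up_lt (p q u v : nat) : (3 <= p)%nat -> (3 <= q)%nat ->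
  (1 <= u <= p)%nat -> (1 <= v <= p)%nat ->
  abscissa p (p - 1) u < abscissa p (p - 1) v -> place p q (up_label p q u) < place p q (up_label p q v).
Proof.
  intros Hp Hq Hu Hv H. apply abscissa_lt_key in H; try lia.
  destruct (up_level p q u Hp Hq Hu) as [U1 U2]. destruct (up_level p q v Hp Hq Hv) as [V1 V2].
  apply abscissa_lt_key; try lia. rewrite U2, V2.
  apply upper_level_key; auto using level_bounds.
Qed.

Lemma down_lt (p q u v : nat) : (3 <= p)%nat -> (3 <= q)%nat ->
  (1 <= u <= q)%nat -> (1 <= v <= q)%nat ->
  abscissa q 2 u < abscissa q 2 v -> place p q (down_label p q u) < place p q (down_label p q v).
Proof.
  intros Hp Hq Hu Hv H. apply abscissa_lt_key in H; try lia.
  destruct (down_level p q u Hp Hq Hu) as [U1 U2].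
  destruct (down_level p q v Hp Hq Hv) as [V1 V2].
  apply abscissa_lt_key; try lia. rewrite U2, V2.
  apply lower_level_key; auto using level_bounds.
Qed.

Lemma edge_level_shift (s k l : nat) : edge_level (s + k) (s + l) = (s + edge_level k l)%nat.
Proof.
  destruct (edge_level_cases (s + k) (s + l)) as [[i [P ->]]|[i [P ->]]];
  destruct (edge_level_cases k l) as [[j [P' ->]]|[j [P' ->]]]; lia.
Qed.

Lemma cycle_knot_isotopic (n r : nat) (l : list nat) (h : nat * nat -> R) :
  (3 <= n)%nat -> (1 <= r <= n)%nat -> NoDup l -> (3 <= length l)%nat ->
  (forall u, In u l -> (1 <= u <= n)%nat) ->
  (forall e f, In e (cycle_edges l) -> In f (cycle_edges l) ->
     interleaved (elo (abscissa n r)) (ehi (abscissa n r)) e f ->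
     same_sign (INR (n - sheet n e) - INR (n - sheet n f)) (h e - h f)) ->
  ambient_isotopic (cycle_knot n l)
    (chords (cycle_edges l) (elo (abscissa n r)) (ehi (abscissa n r)) h).
Proof.
  intros Hn Hr Hnd Hlen Hl Hh. pose proof (label_bounds n r Hr).
  assert (Re : forall e, In e (cycle_edges l) -> (1 <= fst e <= n /\ 1 <= snd e <= n)%nat).
  { intros [u v] I. apply cycle_edges_in in I. split; apply Hl; tauto. }
  apply (circle_chords_isotopic n (label n r) (cycle_edges l) (sheet n) h); auto.
  - lia.
  - intros [u v] a I. destruct (Re _ I) as [R1 R2].
    apply inSheet_iff_sheet; auto; [lia|].
    now apply (cycle_edges_simple l u v).
  - apply cycle_family; auto. intros u v Iu Iv. apply (abscissa_inj n r u v); auto.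
Qed.

(** Common to both summands: the vertex [a] to be split comes first in the cycle and last on the
    line. Its two chords are listed separately, so that the outcome has the shape of a completed
    contraction. *)
Lemma summand_isotopic (n r a : nat) (l : list nat) (X : nat -> R) (g : nat -> nat)
  (h : nat * nat -> R) :
  (3 <= n)%nat -> (1 <= r <= n)%nat -> NoDup (a :: l) -> (2 <= length l)%nat ->
  (forall u, In u (a :: l) -> (1 <= u <= n)%nat) ->
  (forall u v, In u (a :: l) -> In v (a :: l) ->
     abscissa n r u < abscissa n r v -> X (g u) < X (g v)) ->
  (forall u, In u l -> X (g u) < X (g a)) ->
  (forall e f, in_range n e -> in_range n f ->
     interleaved (elo (abscissa n r)) (ehi (abscissa n r)) e f ->
     same_sign (INR (n - sheet n e) - INR (n - sheet n f)) (h e - h f)) ->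
  ambient_isotopic (cycle_knot n (a :: l))
    (chord_set ((X (g (last l 0%nat)), X (g a), h (last l 0%nat, a))
       :: (X (g (hd 0%nat l)), X (g a), h (a, hd 0%nat l))
       :: map (lift_chord (fun u => X (g u)) h) (path_edges l))).
Proof.
  intros Hn Hr Hnd Hlen Hal Hlt Hmax Hcr.
  assert (Hl0 : l <> []) by (intros ->; simpl in Hlen; lia).
  assert (Hinj : forall u v, In u (a :: l) -> In v (a :: l) ->
      abscissa n r u = abscissa n r v -> u = v).
  { intros u v Iu Iv. apply abscissa_inj; auto. }
  assert (Re : forall e, In e (cycle_edges (a :: l)) -> in_range n e).
  { intros [u v] I. apply cycle_edges_in in I. split; apply Hal; tauto. }
  assert (Hcr' : forall e f, In e (cycle_edges (a :: l)) -> In f (cycle_edges (a :: l)) ->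
     interleaved (elo (abscissa n r)) (ehi (abscissa n r)) e f ->
     same_sign (INR (n - sheet n e) - INR (n - sheet n f)) (h e - h f)) by auto.
  apply ambient_isotopic_trans with (1 := cycle_knot_isotopic n r (a :: l) h
    Hn Hr Hnd ltac:(simpl; lia) Hal Hcr').
  assert (Hne : cycle_edges (a :: l) <> []).
  { rewrite cycle_edges_cons by exact Hl0. discriminate. }
  refine (ambient_isotopic_ext _ _ _ _ (fun z => iff_refl _) _
    (chords_relabel (a :: l) (cycle_edges (a :: l)) (abscissa n r)
      (fun u => X (g u)) h h Hne _ Hlt Hinj _ _)).
  - intros pp. rewrite <- chord_set_map. apply chord_set_ext. intros x.
    rewrite cycle_edges_cons by exact Hl0. simpl map. rewrite map_app. simpl map.
    rewrite (lift_chord_gt _ h a), (lift_chord_lt _ h (last l 0%nat) a)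
      by auto using hd_in, last_in.
    simpl. rewrite in_app_iff. simpl. tauto.
  - intros [u v] I. now apply cycle_edges_in.
  - apply cycle_family; auto. simpl. lia.
  - intros e f Ie If I. pose proof (Hcr' e f Ie If I) as S. apply same_sign_refl.
    destruct S; lra.
Qed.

(** The chord set reached here is the one at which [upper_contract] ends, so that alpha and the
    closed first arc meet in the middle. *)
Lemma upper_summand (p q : nat) (l : list nat) :
  (3 <= p)%nat -> (3 <= q)%nat ->
  let a := label p (p - 1) in let m := map (up_label p q) l in
  NoDup (a :: l) -> (2 <= length l)%nat -> (forall u, In u l -> (1 <= u <= p)%nat) ->
  NoDup m /\ (forall v, In v m -> upper_vertex p q v) /\
  ambient_isotopic (cycle_knot p (a :: l))
    (chord_set ((place p q (last m 0%nat), place p q (join3 p q),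
                   height p q (last m 0%nat, join1 p q))
       :: (place p q (hd 0%nat m), place p q (join3 p q), height p q (join2 p q, hd 0%nat m))
       :: map (lift_chord (place p q) (height p q)) (path_edges m))).
Proof.
  intros Hp Hq a m Hn Hlen Hl.
  assert (Ha : (1 <= a <= p)%nat) by (apply label_bounds; lia).
  assert (La : level p a = (p - 1)%nat) by (apply level_label; lia).
  assert (Hl0 : l <> []) by (intros ->; simpl in Hlen; lia).
  assert (Hal : forall u, In u (a :: l) -> (1 <= u <= p)%nat).
  { intros u [<-|I]; auto. }
  assert (Hna : forall u, In u l -> u <> a).
  { intros u I ->. now apply NoDup_cons_iff in Hn. }
  assert (Hna' : forall u, In u l -> level p u <> (p - 1)%nat).
  { intros u I E. apply (Hna u I). apply (level_inj p); auto. congruence. }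
  assert (Lup : forall u, In u l -> level (p + q + 1) (up_label p q u) = level p u).
  { intros u I. rewrite (proj2 (up_level p q u Hp Hq (Hl u I))).
    destruct (upper_level_cases p (level p u)) as [[E _]|[_ E]]; [|exact E].
    now elim (Hna' u I). }
  assert (Huv : forall v, In v m -> upper_vertex p q v).
  { intros v I. apply in_map_iff in I. destruct I as [u [<- I]].
    destruct (up_level p q u Hp Hq (Hl u I)) as [U1 _]. pose proof (Lup u I).
    pose proof (level_bounds p u (Hl u I)). pose proof (Hna' u I).
    unfold upper_vertex. lia. }
  split; [|split; [exact Huv|]].
  { apply NoDup_map_NoDup_ForallPairs; [|now apply NoDup_cons_iff in Hn].
    intros u v Iu Iv E. apply (level_inj p); auto. rewrite <- !Lup by assumption. now rewrite E. }
  destruct (place_join p q Hp Hq) as [O1 O2].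
  destruct (join_levels p q Hp Hq) as [[A1 A2] [[B1 B2] _]].
  pose proof (hd_in l Hl0) as Ih. pose proof (last_in l Hl0) as Il.
  set (h := fun e => INR (p + q + 1) + 1 - INR (upper_edge_level p e)).
  assert (Hh : forall u v, u <> a -> h (u, v) = INR (p + q + 1) + 1 -
      INR (edge_level (level p u) (level p v))).
  { intros u v N. unfold h, upper_edge_level. simpl. fold a.
    destruct (Nat.eqb_spec u a); [contradiction|reflexivity]. }
  assert (Hup : forall u, In u l -> (level (p + q + 1) (up_label p q u) <= p)%nat).
  { intros u I. rewrite (Lup u I). apply (level_bounds p u (Hl u I)). }
  refine (ambient_isotopic_ext _ _ _ _ (fun z => iff_refl _) _
    (summand_isotopic p (p - 1) a l (place p q) (up_label p q) h Hp _ Hn Hlen Hal _ _ _)).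
  - assert (Ea : up_label p q a = join3 p q) by now apply up_cut.
    assert (E1 : h (a, hd 0%nat l) = height p q (join2 p q, hd 0%nat m)).
    { unfold m. rewrite hd_map, height_upper by (auto; unfold is_upper; simpl; specialize (Hup _ Ih); lia).
      unfold h, upper_edge_level, natural_level. simpl. fold a.
      now rewrite Nat.eqb_refl, B2, Lup. }
    assert (E2 : h (last l 0%nat, a) = height p q (last m 0%nat, join1 p q)).
    { unfold m. rewrite last_map, height_upper by (auto; unfold is_upper; simpl; specialize (Hup _ Il); lia).
      rewrite Hh by auto. unfold natural_level; simpl. now rewrite La, A2, Lup. }
    assert (E3 : map (lift_chord (fun u => place p q (up_label p q u)) h) (path_edges l) =
      map (lift_chord (place p q) (height p q)) (path_edges m)).
    { unfold m. rewrite map_path_edges, map_map. apply map_ext_in. intros [u v] I.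
      apply path_edges_in in I. destruct I as [Iu Iv]. unfold lift_chord; simpl. f_equal.
      rewrite height_upper by (unfold is_upper; simpl; specialize (Hup u Iu); lia).
      rewrite Hh by auto. unfold natural_level; simpl. now rewrite !Lup. }
    intros z. rewrite Ea, E1, E2, E3, <- hd_map, <- last_map by exact Hl0. reflexivity.
  - lia.
  - intros u v Iu Iv. apply up_lt; auto.
  - intros u I. unfold a. rewrite up_cut by exact Hp.
    pose proof (place_summand p q (up_label p q u) Hp Hq
      (upper_vertex_summand _ _ _ (Huv _ (in_map _ _ _ I)))). lra.
  - intros e f Ie If I. apply height_sign; auto using sheet_le. now apply upper_crossing.
Qed.

Lemma lower_summand (p q : nat) (l : list nat) :
  (3 <= p)%nat -> (3 <= q)%nat ->
  let b := label q 2 in let m := map (down_label p q) l in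
  NoDup (b :: l) -> (2 <= length l)%nat -> (forall u, In u l -> (1 <= u <= q)%nat) ->
  NoDup m /\ (forall v, In v m -> lower_vertex p q v) /\
  ambient_isotopic (cycle_knot q (b :: l))
    (chord_set ((place p q (last m 0%nat), place p q (join3 p q),
                   height p q (last m 0%nat, join2 p q))
       :: (place p q (hd 0%nat m), place p q (join3 p q), height p q (join3 p q, hd 0%nat m))
       :: map (lift_chord (place p q) (height p q)) (path_edges m))).
Proof.
  intros Hp Hq b m Hn Hlen Hl.
  assert (Hb : (1 <= b <= q)%nat) by (apply label_bounds; lia).
  assert (Lb : level q b = 2%nat) by (apply level_label; lia).
  assert (Hl0 : l <> []) by (intros ->; simpl in Hlen; lia).
  assert (Hbl : forall u, In u (b :: l) -> (1 <= u <= q)%nat).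
  { intros u [<-|I]; auto. }
  assert (Hnb : forall u, In u l -> u <> b).
  { intros u I ->. now apply NoDup_cons_iff in Hn. }
  assert (Hnb' : forall u, In u l -> level q u <> 2%nat).
  { intros u I E. apply (Hnb u I). apply (level_inj q); auto. congruence. }
  assert (Ldn : forall u, In u l -> level (p + q + 1) (down_label p q u) = (p + 1 + level q u)%nat).
  { intros u I. apply (down_level p q u Hp Hq (Hl u I)). }
  assert (Huv : forall v, In v m -> lower_vertex p q v).
  { intros v I. apply in_map_iff in I. destruct I as [u [<- I]].
    destruct (down_level p q u Hp Hq (Hl u I)) as [U1 _]. pose proof (Ldn u I).
    pose proof (level_bounds q u (Hl u I)). pose proof (Hnb' u I).
    unfold lower_vertex. lia. }
  split; [|split; [exact Huv|]].
  { apply NoDup_map_NoDup_ForallPairs; [|now apply NoDup_cons_iff in Hn].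
    intros u v Iu Iv E. apply (level_inj q); auto.
    pose proof (Ldn u Iu). pose proof (Ldn v Iv). rewrite E in *. lia. }
  destruct (place_join p q Hp Hq) as [O1 O2].
  destruct (join_levels p q Hp Hq) as [_ [[B1 B2] [C1 C2]]].
  pose proof (hd_in l Hl0) as Ih. pose proof (last_in l Hl0) as Il.
  (* In the joined book the levels of beta are shifted by [p + 1], so the level 0 of the split end
     becomes that of [c]. *)
  set (h := fun e => - INR (p + 1) - INR (lower_edge_level q e)).
  assert (Hh : forall u v, v <> b -> h (u, v) = - INR (edge_level (p + 1 + level q u) (p + 1 + level q v))).
  { intros u v N. unfold h, lower_edge_level. simpl. fold b.
    destruct (Nat.eqb_spec v b); [contradiction|].
    rewrite edge_level_shift, (plus_INR (p + 1)). unfold natural_level; simpl. ring. }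
  assert (Hdn : forall u, In u l -> (p < level (p + q + 1) (down_label p q u))%nat).
  { intros u I. rewrite (Ldn u I). lia. }
  refine (ambient_isotopic_ext _ _ _ _ (fun z => iff_refl _) _
    (summand_isotopic q 2 b l (place p q) (down_label p q) h Hq _ Hn Hlen Hbl _ _ _)).
  - assert (Eb : down_label p q b = join3 p q) by now apply down_cut.
    assert (E1 : h (b, hd 0%nat l) = height p q (join3 p q, hd 0%nat m)).
    { unfold m. rewrite hd_map, height_lower by (auto; unfold is_upper; simpl; specialize (Hdn _ Ih); lia).
      rewrite Hh by auto. unfold natural_level; simpl. rewrite C2, Lb, (Ldn _ Ih).
      do 3 f_equal. lia. }
    assert (E2 : h (last l 0%nat, b) = height p q (last m 0%nat, join2 p q)).
    { unfold m. rewrite last_map, height_lower by (auto; unfold is_upper; simpl; specialize (Hdn _ Il); lia).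
      unfold h, lower_edge_level, natural_level. simpl. fold b. rewrite Nat.eqb_refl, B2, (Ldn _ Il).
      rewrite <- (Nat.add_0_r (p + 1)) at 3. rewrite edge_level_shift, (plus_INR (p + 1)). ring. }
    assert (E3 : map (lift_chord (fun u => place p q (down_label p q u)) h) (path_edges l) =
      map (lift_chord (place p q) (height p q)) (path_edges m)).
    { unfold m. rewrite map_path_edges, map_map. apply map_ext_in. intros [u v] I.
      apply path_edges_in in I. destruct I as [Iu Iv]. unfold lift_chord; simpl. f_equal.
      rewrite height_lower by (unfold is_upper; simpl; pose proof (Hdn u Iu); pose proof (Hdn v Iv); lia).
      rewrite Hh by auto. unfold natural_level; simpl. now rewrite !Ldn. }
    intros z. rewrite Eb, E1, E2, E3, <- hd_map, <- last_map by exact Hl0. reflexivity.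
  - lia.
  - intros u v Iu Iv. apply down_lt; auto.
  - intros u I. unfold b. rewrite down_cut by exact Hq.
    pose proof (place_summand p q (down_label p q u) Hp Hq
      (lower_vertex_summand _ _ _ (Huv _ (in_map _ _ _ I)))). lra.
  - intros e f Ie If I. apply height_sign; auto using sheet_le. now apply lower_crossing.
Qed.


(** * Separating the two summands *)

Definition is_join (p q : nat) (e : nat * nat) : Prop :=
  e = (join2 p q, join3 p q) \/ e = (join3 p q, join2 p q).

Definition joinb (p q : nat) (e : nat * nat) : bool :=
  (Nat.eqb (fst e) (join2 p q) && Nat.eqb (snd e) (join3 p q)) ||
  (Nat.eqb (fst e) (join3 p q) && Nat.eqb (snd e) (join2 p q)).

Lemma joinb_spec (p q : nat) (e : nat * nat) : joinb p q e = true <-> is_join p q e.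
Proof.
  unfold joinb, is_join. destruct e as [u v]; simpl.
  rewrite Bool.orb_true_iff, !Bool.andb_true_iff, !Nat.eqb_eq.
  split; intros [H|H]; [left|right|left|right]; try (destruct H; congruence);
    injection H; auto.
Qed.

(** To the left of [c'] it is nonnegative and vanishes only at [c]; it also vanishes at [c'] itself.
    The square is there because chords run on both sides of [c]. *)
Definition tent (p q : nat) (x : R) : R :=
  (place p q (join3 p q) - x) *
  ((x - place p q (join2 p q)) * (x - place p q (join2 p q))).

(* The lift separating the two summands: the chords of the upper summand run
   above the level 0, those of the lower one below it, and both meet it only at
   the vertices [join2] and [join3]. *)
Definition split_lift (p q : nat) (e : nat * nat) (x : R) : R :=
  if joinb p q e then 0
  else if Nat.leb (Nat.min (level (p + q + 1) (fst e)) (level (p + q + 1) (snd e))) p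
  then height p q e * cap (elo (place p q) e) (ehi (place p q) e) x + tent p q x
  else height p q e * cap (elo (place p q) e) (ehi (place p q) e) x - tent p q x.

Lemma split_lift_join (p q : nat) (e : nat * nat) (x : R) :
  is_join p q e -> split_lift p q e x = 0.
Proof. intros H. apply joinb_spec in H. unfold split_lift. now rewrite H. Qed.

Lemma split_lift_upper (p q : nat) (e : nat * nat) (x : R) :
  ~ is_join p q e -> is_upper p q e -> split_lift p q e x =
  height p q e * cap (elo (place p q) e) (ehi (place p q) e) x + tent p q x.
Proof.
  intros N H. unfold split_lift. destruct (joinb p q e) eqn:J; [apply joinb_spec in J; tauto|].
  apply Nat.leb_le in H. now rewrite H.
Qed.

Lemma split_lift_lower (p q : nat) (e : nat * nat) (x : R) :
  ~ is_join p q e -> ~ is_upper p q e -> split_lift p q e x =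
  height p q e * cap (elo (place p q) e) (ehi (place p q) e) x - tent p q x.
Proof.
  intros N H. unfold split_lift. destruct (joinb p q e) eqn:J; [apply joinb_spec in J; tauto|].
  destruct (Nat.leb_spec (Nat.min (level (p + q + 1) (fst e)) (level (p + q + 1) (snd e))) p);
    [contradiction|reflexivity].
Qed.

Lemma height_upper_pos (p q : nat) (e : nat * nat) :
  in_range (p + q + 1) e -> is_upper p q e -> 0 < height p q e.
Proof.
  intros [R1 R2] U. rewrite height_upper by exact U.
  pose proof (edge_level_bounds _ _ _ (level_bounds _ _ R1) (level_bounds _ _ R2)) as B.
  fold (natural_level (p + q + 1) e) in B. destruct B as [_ B]. apply le_INR in B. lra.
Qed.

Lemma height_lower_neg (p q : nat) (e : nat * nat) :
  in_range (p + q + 1) e -> ~ is_upper p q e -> height p q e < 0.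
Proof.
  intros [R1 R2] U. rewrite height_lower by exact U.
  pose proof (edge_level_bounds _ _ _ (level_bounds _ _ R1) (level_bounds _ _ R2)) as B.
  fold (natural_level (p + q + 1) e) in B. destruct B as [B _]. apply le_INR in B.
  simpl in B. lra.
Qed.

(* Each end [u] of [e] lies in the region of the summands, and unless it is one of
   the two common vertices [e] belongs to the summand of [u]. *)
Definition joined_edge (p q : nat) (e : nat * nat) : Prop :=
  in_range (p + q + 1) e /\
  forall u, u = fst e \/ u = snd e ->
    (u = join3 p q \/ place p q u <= place p q (join2 p q)) /\
    (u <> join2 p q -> u <> join3 p q ->
       (is_upper p q e <-> (level (p + q + 1) u <= p)%nat)).

Lemma end_vertex (X : nat -> R) (e : nat * nat) (x : R) :
  is_end (elo X) (ehi X) e x -> exists u, (u = fst e \/ u = snd e) /\ x = X u.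
Proof.
  unfold is_end, elo, ehi, Rmin, Rmax.
  destruct (Rle_dec (X (fst e)) (X (snd e))); intros [E|E]; eauto.
Qed.

Lemma tent_nonneg (p q : nat) (x : R) : x <= place p q (join3 p q) -> 0 <= tent p q x.
Proof.
  intros H. unfold tent. apply Rmult_le_pos; [lra|]. apply Rle_0_sqr.
Qed.

Lemma ehi_le_join (p q : nat) (e : nat * nat) : (3 <= p)%nat -> (3 <= q)%nat ->
  joined_edge p q e -> ehi (place p q) e <= place p q (join3 p q).
Proof.
  intros Hp Hq [_ He]. destruct (place_join p q Hp Hq) as [O1 O2].
  assert (K : forall u, u = fst e \/ u = snd e -> place p q u <= place p q (join3 p q)).
  { intros u Hu. destruct (He u Hu) as [[->|L] _]; lra. }
  unfold ehi. apply Rmax_lub; apply K; auto.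
Qed.

(** The tent depends on the abscissa alone: it cancels between chords of one summand and widens the
    gap between chords of different summands. At vertices the caps vanish, and either the tent
    vanishes too or all edges there belong to one summand, so the lifts still fit together. *)
Lemma split_lift_isotopic (p q : nat) (E : list (nat * nat)) :
  (3 <= p)%nat -> (3 <= q)%nat ->
  (forall e, In e E -> joined_edge p q e) ->
  chord_family E (elo (place p q)) (ehi (place p q)) ->
  ambient_isotopic (chords E (elo (place p q)) (ehi (place p q)) (height p q))
    (gset E (elo (place p q)) (ehi (place p q)) (lines (elo (place p q)) (ehi (place p q)))
       (split_lift p q)).
Proof.
  intros Hp Hq HE Hfam. destruct (place_join p q Hp Hq) as [O1 O2].
  destruct (join_levels p q Hp Hq) as [_ [[B1 B2] [C1 C2]]].
  set (X := place p q) in *. set (c := join2 p q) in *. set (c' := join3 p q) in *.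
  assert (Lt : forall u v, lip_on u v (tent p q)).
  { intros u v. unfold tent. repeat apply lip_on_mult; apply lip_on_minus;
      auto using lip_on_id, lip_on_const. }
  apply chords_relift; auto.
  - intros e He. unfold split_lift. destruct (joinb p q e); [apply lip_on_const|].
    destruct (Nat.leb _ _).
    + apply lip_on_plus; [|auto]. apply lip_on_mult; [apply lip_on_const|apply lip_cap].
    + apply lip_on_minus; [|auto]. apply lip_on_mult; [apply lip_on_const|apply lip_cap].
  - assert (Hz : forall e x, is_end (elo X) (ehi X) e x ->
      cap (elo (place p q) e) (ehi (place p q) e) x = 0).
    { intros e x H. fold X. unfold cap. destruct H; subst; ring. }
    assert (T0 : tent p q (X c) = 0 /\ tent p q (X c') = 0).
    { unfold tent. fold c c' X. split; ring. }
    intros e f x He Hf Ee Ef.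
    destruct (end_vertex X e x Ee) as [u [Hu Eu]]. destruct (end_vertex X f x Ef) as [v [Hv Ev]].
    destruct (HE e He) as [Re Je]. destruct (HE f Hf) as [Rf Jf].
    assert (Euv : u = v).
    { apply (place_inj p q u v Hp Hq); [| |fold X; congruence].
      - destruct Re, Hu as [-> | ->]; assumption.
      - destruct Rf, Hv as [-> | ->]; assumption. }
    subst v.
    destruct (Nat.eq_dec u c) as [Nc|Nc]; [|destruct (Nat.eq_dec u c') as [Nc'|Nc']].
    + unfold split_lift. rewrite !Hz by assumption. rewrite Eu, Nc, (proj1 T0).
      repeat match goal with |- context [if ?b then _ else _] => destruct b end; ring.
    + unfold split_lift. rewrite !Hz by assumption. rewrite Eu, Nc', (proj2 T0).
      repeat match goal with |- context [if ?b then _ else _] => destruct b end; ring.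
    + destruct (Je u Hu) as [_ Je']. destruct (Jf u Hv) as [_ Jf'].
      specialize (Je' Nc Nc'). specialize (Jf' Nc Nc').
      assert (NJ : forall e, u = fst e \/ u = snd e -> ~ is_join p q e).
      { intros g Hg [E'|E']; rewrite E' in Hg; simpl in Hg; fold c c' in Hg; tauto. }
      destruct (classic (is_upper p q e)).
      * rewrite !split_lift_upper by (auto || tauto). rewrite !Hz by assumption. ring.
      * rewrite !split_lift_lower by (auto || tauto). rewrite !Hz by assumption. ring.
  - intros e f He Hf I. pose proof (HE e He) as Je. pose proof (HE f Hf) as Jf.
    pose proof (ehi_le_join p q e Hp Hq Je) as Me. pose proof (ehi_le_join p q f Hp Hq Jf) as Mf.
    fold X c' in Me, Mf. pose proof I as [I1 [I2 I3]].
    pose proof (cross_pt_between _ _ _ _ I1 I2 I3) as Hw.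
    destruct (cross_common _ _ _ _ I1 I2 I3) as [_ [Ec Pc]].
    change (cross_pt (elo X e) (ehi X e) (elo X f) (ehi X f)) with (cross (elo X) (ehi X) e f) in *.
    set (w := cross (elo X) (ehi X) e f) in *.
    assert (Gw : 0 <= tent p q w) by (apply tent_nonneg; fold X c'; lra).
    assert (NJf : forall g, is_join p q g -> elo X g = X c /\ ehi X g = X c').
    { intros g [-> | ->]; [apply elo_lt|apply elo_gt]; exact O2. }
    assert (Ne : ~ is_join p q e).
    { intros J. destruct (NJf e J). lra. }
    (* No end of an edge lies strictly between [c] and [c'], so the closing chord is crossed by
       nothing. *)
    assert (Nf : ~ is_join p q f).
    { intros J. destruct (NJf f J) as [E1 E2].
      destruct (end_vertex X e (ehi X e)) as [u [Hu Eu]]; [now right|].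
      destruct Je as [_ Je]. destruct (Je u Hu) as [[Ej|L] _].
      - rewrite Ej in Eu. fold c' in Eu. lra.
      - fold X c in L. lra. }
    destruct Je as [Re _], Jf as [Rf _].
    destruct (classic (is_upper p q e)) as [Ue|Ue], (classic (is_upper p q f)) as [Uf|Uf].
    + rewrite !split_lift_upper by assumption. fold X. rewrite <- Ec.
      replace (height p q e * cap (elo X e) (ehi X e) w + tent p q w -
        (height p q f * cap (elo X e) (ehi X e) w + tent p q w))
        with (cap (elo X e) (ehi X e) w * (height p q e - height p q f)) by ring.
      apply same_sign_sym, same_sign_scale; [exact Pc|]. apply same_sign_refl.
      assert (height p q e <> height p q f); [|lra].
      apply height_crossing; auto; tauto.
    + rewrite split_lift_upper, split_lift_lower by assumption. fold X. rewrite <- Ec.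
      pose proof (height_upper_pos p q e Re Ue). pose proof (height_lower_neg p q f Rf Uf).
      left. split; [lra|]. nra.
    + rewrite split_lift_lower, split_lift_upper by assumption. fold X. rewrite <- Ec.
      pose proof (height_upper_pos p q f Rf Uf). pose proof (height_lower_neg p q e Re Ue).
      right. split; [lra|]. nra.
    + rewrite !split_lift_lower by assumption. fold X. rewrite <- Ec.
      replace (height p q e * cap (elo X e) (ehi X e) w - tent p q w -
        (height p q f * cap (elo X e) (ehi X e) w - tent p q w))
        with (cap (elo X e) (ehi X e) w * (height p q e - height p q f)) by ring.
      apply same_sign_sym, same_sign_scale; [exact Pc|]. apply same_sign_refl.
      assert (height p q e <> height p q f); [|lra].
      apply height_crossing; auto; tauto.
Qed.

(** The two terms of the lift have the same weak sign, so the sum vanishes only where both do; zeros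
    of the tent are at [c] and [c'], and zeros of the cap are on the parabola. *)
Lemma split_lift_sign (p q : nat) (e : nat * nat) (x : R) :
  (3 <= p)%nat -> (3 <= q)%nat -> joined_edge p q e -> ~ is_join p q e ->
  elo (place p q) e <= x <= ehi (place p q) e ->
  (is_upper p q e -> 0 <= split_lift p q e x) /\
  (~ is_upper p q e -> split_lift p q e x <= 0) /\
  (split_lift p q e x = 0 ->
     lines (elo (place p q)) (ehi (place p q)) e x = x * x /\
     (x = place p q (join2 p q) \/ x = place p q (join3 p q))).
Proof.
  intros Hp Hq Je Nj Hx. pose proof (ehi_le_join p q e Hp Hq Je) as Me.
  destruct Je as [Re _]. pose proof (cap_pos _ _ _ Hx) as Pc.
  pose proof (tent_nonneg p q x ltac:(lra)) as Pt.
  unfold lines. rewrite line_cap.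
  set (k := cap _ _ x) in *.
  assert (Z : k = 0 -> tent p q x = 0 ->
     x * x + k = x * x /\ (x = place p q (join2 p q) \/ x = place p q (join3 p q))).
  { intros -> T. split; [ring|]. unfold tent in T.
    apply Rmult_integral in T. destruct T as [T|T]; [right; lra|].
    apply Rmult_integral in T. left. destruct T; lra. }
  destruct (classic (is_upper p q e)) as [U|U].
  - pose proof (height_upper_pos p q e Re U) as Hh. rewrite split_lift_upper by assumption.
    fold k. assert (0 <= height p q e * k) by nra.
    split; [lra|]. split; [tauto|]. intros S. apply Z; [|lra]. nra.
  - pose proof (height_lower_neg p q e Re U) as Hh. rewrite split_lift_lower by assumption.
    fold k. assert (height p q e * k <= 0) by nra.
    split; [tauto|]. split; [lra|]. intros S. apply Z; [|lra]. nra.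
Qed.


(** * Assembly of the connected sum *)

Lemma place_summand_le (p q v : nat) : (3 <= p)%nat -> (3 <= q)%nat ->
  summand_vertex p q v -> place p q v <= place p q (join2 p q).
Proof.
  intros Hp Hq H. pose proof (place_summand p q v Hp Hq H).
  destruct (place_join p q Hp Hq). lra.
Qed.

Lemma upper_edge_spec (p q : nat) (m : list nat) (e : nat * nat) :
  (3 <= p)%nat -> (3 <= q)%nat -> m <> [] ->
  (forall v, In v m -> upper_vertex p q v) -> In e (upper_edges p q m) ->
  joined_edge p q e /\ ~ is_join p q e /\ is_upper p q e /\
  (natural_level (p + q + 1) e <= p + 1)%nat.
Proof.
  intros Hp Hq Hm Hv He.
  destruct (join_levels p q Hp Hq) as [[A1 A2] [[B1 B2] [C1 C2]]].
  destruct (place_join p q Hp Hq) as [O1 O2].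
  assert (Lm : forall v, In v m -> (1 <= v <= p + q + 1)%nat /\
    (1 <= level (p + q + 1) v <= p)%nat /\ v <> join2 p q /\ v <> join3 p q /\
    place p q v <= place p q (join2 p q)).
  { intros v I. destruct (Hv v I) as [V1 [V2 V3]]. pose proof (level_bounds _ _ V1).
    pose proof (place_summand_le p q v Hp Hq (upper_vertex_summand _ _ _ (Hv v I))).
    repeat split; try lia; try assumption; intros ->; lia. }
  assert (N : forall k l, (1 <= k <= p + 1)%nat -> (1 <= l <= p + 1)%nat ->
    (edge_level k l <= p + 1)%nat) by (intros; apply edge_level_bounds; assumption).
  assert (Nd : (edge_level (p - 1) (p + 3) <= p + 1)%nat).
  { destruct (edge_level_cases (p - 1) (p + 3)) as [[i [P ->]]|[i [P ->]]]; lia. }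
  assert (Dn : join1 p q <> join2 p q /\ join1 p q <> join3 p q /\ join2 p q <> join3 p q).
  { repeat split; intros E; rewrite E in *; lia. }
  unfold upper_edges in He. destruct He as [<-|He];
    [|apply in_app_iff in He; destruct He as [He|[<-|[<-|[]]]]].
  - destruct (Lm _ (hd_in m Hm)) as [V1 [V2 [V3 [V4 V5]]]].
    unfold joined_edge, in_range, is_join, is_upper, natural_level; simpl. rewrite B2.
    split; [split; [lia|]|split; [intros [E|E]; injection E; intros; congruence|split; [lia|]]].
    + intros u [->| ->]; (split; [right; lra|]); intros; [congruence|lia].
    + apply N; lia.
  - destruct e as [u v]. apply path_edges_in in He. destruct He as [Iu Iv].
    destruct (Lm u Iu) as [U1 [U2 [U3 [U4 U5]]]]. destruct (Lm v Iv) as [V1 [V2 [V3 [V4 V5]]]].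
    unfold joined_edge, in_range, is_join, is_upper, natural_level; simpl.
    split; [split; [lia|]|split; [intros [E|E]; injection E; intros; congruence|split; [lia|]]].
    + intros w [->| ->]; (split; [right; lra|]); intros; lia.
    + apply N; lia.
  - destruct (Lm _ (last_in m Hm)) as [V1 [V2 [V3 [V4 V5]]]].
    unfold joined_edge, in_range, is_join, is_upper, natural_level; simpl. rewrite A2.
    split; [split; [lia|]|split; [intros [E|E]; injection E; intros; congruence|split; [lia|]]].
    + intros u [->| ->]; (split; [right; lra|]); intros; lia.
    + apply N; lia.
  - unfold joined_edge, in_range, is_join, is_upper, natural_level; simpl. rewrite A2, C2.
    split; [split; [lia|]|split; [intros [E|E]; injection E; intros; intuition|split; [lia|exact Nd]]].
    intros u [->| ->]; (split; [auto; right; lra|]); intros; [lia|congruence].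
Qed.

Lemma lower_edge_spec (p q : nat) (m : list nat) (e : nat * nat) :
  (3 <= p)%nat -> (3 <= q)%nat -> m <> [] ->
  (forall v, In v m -> lower_vertex p q v) -> In e (lower_edges p q m) ->
  joined_edge p q e /\ ~ is_join p q e /\ ~ is_upper p q e /\
  (p + 1 <= natural_level (p + q + 1) e)%nat.
Proof.
  intros Hp Hq Hm Hv He.
  destruct (join_levels p q Hp Hq) as [_ [[B1 B2] [C1 C2]]].
  destruct (place_join p q Hp Hq) as [O1 O2].
  assert (Lm : forall v, In v m -> (1 <= v <= p + q + 1)%nat /\
    (p + 2 <= level (p + q + 1) v)%nat /\ v <> join2 p q /\ v <> join3 p q /\
    place p q v <= place p q (join2 p q)).
  { intros v I. destruct (Hv v I) as [V1 [V2 V3]].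
    pose proof (place_summand_le p q v Hp Hq (lower_vertex_summand _ _ _ (Hv v I))).
    repeat split; try lia; try assumption; intros ->; lia. }
  assert (N : forall k l, (p + 1 <= k)%nat -> (p + 1 <= l)%nat ->
    (p + 1 <= edge_level k l)%nat).
  { intros k l ? ?. destruct (edge_level_cases k l) as [[i [P ->]]|[i [P ->]]]; lia. }
  assert (Dn : join2 p q <> join3 p q) by (intros E; rewrite E in *; lia).
  unfold lower_edges in He. destruct He as [<-|He];
    [|apply in_app_iff in He; destruct He as [He|[<-|[]]]].
  - destruct (Lm _ (hd_in m Hm)) as [V1 [V2 [V3 [V4 V5]]]].
    unfold joined_edge, in_range, is_join, is_upper, natural_level; simpl. rewrite C2.
    split; [split; [lia|]|split; [intros [E|E]; injection E; intros; congruence|split; [lia|]]].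
    + intros u [->| ->]; (split; [auto; right; lra|]); intros; [congruence|lia].
    + apply N; lia.
  - destruct e as [u v]. apply path_edges_in in He. destruct He as [Iu Iv].
    destruct (Lm u Iu) as [U1 [U2 [U3 [U4 U5]]]]. destruct (Lm v Iv) as [V1 [V2 [V3 [V4 V5]]]].
    unfold joined_edge, in_range, is_join, is_upper, natural_level; simpl.
    split; [split; [lia|]|split; [intros [E|E]; injection E; intros; congruence|split; [lia|]]].
    + intros w [->| ->]; (split; [right; lra|]); intros; lia.
    + apply N; lia.
  - destruct (Lm _ (last_in m Hm)) as [V1 [V2 [V3 [V4 V5]]]].
    unfold joined_edge, in_range, is_join, is_upper, natural_level; simpl. rewrite B2.
    split; [split; [lia|]|split; [intros [E|E]; injection E; intros; congruence|split; [lia|]]].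
    + intros u [->| ->]; (split; [right; lra|]); intros; [lia|congruence].
    + apply N; lia.
Qed.

Lemma join_edge_joined (p q : nat) (e : nat * nat) : (3 <= p)%nat -> (3 <= q)%nat ->
  is_join p q e -> joined_edge p q e.
Proof.
  intros Hp Hq H. destruct (join_levels p q Hp Hq) as [_ [[B1 _] [C1 _]]].
  destruct H as [-> | ->]; (split; [split; assumption|]); simpl; intros u [->| ->];
    (split; [auto; right; lra|]); intros; congruence.
Qed.

Lemma gset_sub (I : Type) (l : list I) (a b : I -> R) (Y Z : I -> R -> R) (i : I) (x : R) :
  In i l -> a i <= x <= b i -> gset l a b Y Z (x, Y i x, Z i x).
Proof. intros. exists i, x. auto. Qed.

(** The closing chord has lift 0 and a straight projection, so in space it is the segment between
    the points over [c] and [c']. *)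
Lemma gset_join (p q : nat) (E : list (nat * nat)) (j : nat * nat) (z : pt) :
  (3 <= p)%nat -> (3 <= q)%nat -> is_join p q j ->
  gset (j :: E) (elo (place p q)) (ehi (place p q))
    (lines (elo (place p q)) (ehi (place p q))) (split_lift p q) z <->
  gset E (elo (place p q)) (ehi (place p q))
    (lines (elo (place p q)) (ehi (place p q))) (split_lift p q) z \/
  seg (place p q (join2 p q), place p q (join2 p q) * place p q (join2 p q), 0)
      (place p q (join3 p q), place p q (join3 p q) * place p q (join3 p q), 0) z.
Proof.
  intros Hp Hq Hj. destruct (place_join p q Hp Hq) as [_ O].
  set (X := place p q) in *. set (u := X (join2 p q)) in *. set (v := X (join3 p q)) in *.
  assert (Ej : elo X j = u /\ ehi X j = v).
  { destruct Hj as [-> | ->]; [apply elo_lt|apply elo_gt]; exact O. }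
  destruct Ej as [E1 E2].
  assert (L : forall t, line u v ((1 - t) * u + t * v) = (1 - t) * (u * u) + t * (v * v)).
  { intros t. unfold line. ring. }
  split.
  - intros [e [x [[<-|He] [Hx ->]]]]; [right|left; now apply gset_sub].
    rewrite split_lift_join by exact Hj. unfold lines. rewrite E1, E2 in *.
    exists ((x - u) / (v - u)). split.
    + split.
      * apply Rmult_le_pos; [lra|]. left; apply Rinv_0_lt_compat; lra.
      * apply Rmult_le_reg_r with (v - u); [lra|].
        unfold Rdiv. rewrite Rmult_assoc, Rinv_l by lra. lra.
    + assert (Ex : x = (1 - (x - u) / (v - u)) * u + (x - u) / (v - u) * v) by (field; lra).
      unfold lerp, px, py, pz; simpl. rewrite <- L, <- Ex. f_equal. ring.
  - intros [[e [x [He [Hx ->]]]]|[t [Ht ->]]].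
    + exists e, x. split; [now right|]. auto.
    + exists j, ((1 - t) * u + t * v). split; [now left|]. rewrite E1, E2.
      split; [nra|]. rewrite split_lift_join by exact Hj. unfold lines.
      rewrite E1, E2, L. unfold lerp, px, py, pz; simpl. f_equal. ring.
Qed.

Lemma gset_join_vertex (p q : nat) (E : list (nat * nat)) (u v : nat) :
  In (u, v) E \/ In (v, u) E -> place p q u < place p q v ->
  ~ is_join p q (u, v) -> ~ is_join p q (v, u) -> v = join2 p q \/ v = join3 p q ->
  gset E (elo (place p q)) (ehi (place p q))
    (lines (elo (place p q)) (ehi (place p q))) (split_lift p q)
    (place p q v, place p q v * place p q v, 0).
Proof.
  intros He Huv N1 N2 Hv. set (X := place p q) in *.
  assert (T : tent p q (X v) = 0).
  { unfold tent. fold X. destruct Hv as [-> | ->]; ring. }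
  assert (K : exists e, In e E /\ ~ is_join p q e /\ elo X e = X u /\ ehi X e = X v).
  { destruct He as [He|He]; [exists (u, v)|exists (v, u)]; repeat split; auto;
      now first [apply elo_lt|apply elo_gt]. }
  destruct K as [e [Ie [Ne [E1 E2]]]]. exists e, (X v). rewrite E1, E2.
  split; [exact Ie|]. split; [lra|].
  assert (Z : split_lift p q e (X v) = 0).
  { destruct (Nat.le_gt_cases
      (Nat.min (level (p + q + 1) (fst e)) (level (p + q + 1) (snd e))) p) as [L|L].
    - rewrite split_lift_upper, T by assumption. fold X. rewrite E2. unfold cap. ring.
    - rewrite split_lift_lower, T by (unfold is_upper; assumption || lia).
      fold X. rewrite E2. unfold cap. ring. }
  rewrite Z. unfold lines. now rewrite E1, E2, line_right.
Qed.

(** A duplicate-free list of [n] labels between 1 and [n] contains them all, and rotating a cycle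
    keeps its set of edges. *)
Lemma rotate_to (n a : nat) (l : list nat) : hamiltonian n l -> (1 <= a <= n)%nat ->
  exists l', NoDup (a :: l') /\ S (length l') = n /\
    (forall u, In u l' -> (1 <= u <= n)%nat) /\
    (forall z, cycle_knot n (a :: l') z <-> cycle_knot n l z).
Proof.
  intros [Hn [Hl Hr]] Ha.
  assert (Ia : In a l).
  { apply (NoDup_length_incl (l := l) (l' := seq 1 n) Hn).
    - rewrite length_seq. lia.
    - intros u I. apply in_seq. specialize (Hr u I). lia.
    - apply in_seq. lia. }
  destruct (in_split a l Ia) as [l1 [l2 ->]]. exists (l2 ++ l1).
  split; [|split; [|split]].
  - exact (Permutation_NoDup (Permutation_app_comm l1 (a :: l2)) Hn).
  - rewrite <- Hl, !length_app. simpl. lia.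
  - intros u I. apply Hr. rewrite in_app_iff in *. simpl. tauto.
  - intros z. unfold cycle_knot. split; intros [e [He K]]; exists e; (split; [|exact K]).
    + now apply (cycle_edges_rotate l1 (a :: l2)).
    + now apply (cycle_edges_rotate l1 (a :: l2)) in He.
Qed.

Lemma sum_cycle_edges (p q : nat) (m m' : list nat) (e : nat * nat) :
  m <> [] -> m' <> [] ->
  In e (cycle_edges (join2 p q :: m ++ join1 p q :: join3 p q :: m')) <->
  In e (upper_edges p q m) \/ In e (lower_edges p q m').
Proof.
  intros Hm Hm'. rewrite cycle_edges_path.
  replace (join2 p q :: (m ++ join1 p q :: join3 p q :: m') ++ [join2 p q])
    with ((join2 p q :: m) ++ join1 p q :: join3 p q :: m' ++ [join2 p q])
    by (simpl; now rewrite <- app_assoc).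
  rewrite path_edges_app.
  change ((join2 p q :: m) ++ [join1 p q]) with (join2 p q :: m ++ [join1 p q]).
  rewrite path_edges_wrap by exact Hm.
  change (path_edges (join1 p q :: join3 p q :: m' ++ [join2 p q]))
    with ((join1 p q, join3 p q) :: path_edges (join3 p q :: m' ++ [join2 p q])).
  rewrite path_edges_wrap by exact Hm'.
  unfold upper_edges, lower_edges. simpl. rewrite !in_app_iff. simpl.
  rewrite !in_app_iff. simpl. tauto.
Qed.

Lemma upper_cycle_edges (p q : nat) (m : list nat) (e : nat * nat) :
  m <> [] ->
  In e (cycle_edges (join2 p q :: m ++ [join1 p q; join3 p q])) <->
  In e ((join3 p q, join2 p q) :: upper_edges p q m).
Proof.
  intros Hm. rewrite cycle_edges_path.
  replace (join2 p q :: (m ++ [join1 p q; join3 p q]) ++ [join2 p q])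
    with ((join2 p q :: m) ++ join1 p q :: [join3 p q; join2 p q])
    by (simpl; now rewrite <- app_assoc).
  rewrite path_edges_app.
  change ((join2 p q :: m) ++ [join1 p q]) with (join2 p q :: m ++ [join1 p q]).
  rewrite path_edges_wrap by exact Hm.
  unfold upper_edges. simpl. rewrite ?in_app_iff. simpl. rewrite ?in_app_iff. simpl. tauto.
Qed.

Lemma lower_cycle_edges (p q : nat) (m : list nat) (e : nat * nat) :
  m <> [] ->
  In e (cycle_edges (join2 p q :: join3 p q :: m)) <->
  In e ((join2 p q, join3 p q) :: lower_edges p q m).
Proof.
  intros Hm. rewrite cycle_edges_path.
  change (path_edges (join2 p q :: (join3 p q :: m) ++ [join2 p q]))
    with ((join2 p q, join3 p q) :: path_edges (join3 p q :: m ++ [join2 p q])).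
  rewrite path_edges_wrap by exact Hm. reflexivity.
Qed.

Lemma gset_list_ext (I : Type) (l l' : list I) (a b : I -> R) (Y Z : I -> R -> R) (z : pt) :
  (forall i, In i l <-> In i l') -> gset l a b Y Z z <-> gset l' a b Y Z z.
Proof.
  intros H. split; intros [i [x [Hi K]]]; exists i, x; (split; [now apply H|exact K]).
Qed.

Theorem mainTheorem12 (p q : nat) (alpha beta : list nat) :
  (3 <= p)%nat -> (3 <= q)%nat ->
  hamiltonian p alpha -> hamiltonian q beta ->
  exists (gamma : list nat) (K : pset),
    hamiltonian (p + q + 1) gamma /\
    conn_sum (cycle_knot p alpha) (cycle_knot q beta) K /\
    ambient_isotopic (cycle_knot (p + q + 1) gamma) K.
Proof.
  intros Hp Hq Halpha Hbeta.
  destruct (rotate_to p (label p (p - 1)) alpha Halpha (label_bounds p (p - 1) ltac:(lia)))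
    as [l [Nl [Ll [Rl Kl]]]].
  destruct (rotate_to q (label q 2) beta Hbeta (label_bounds q 2 ltac:(lia)))
    as [l' [Nl' [Ll' [Rl' Kl']]]].
  destruct (upper_summand p q l Hp Hq Nl ltac:(lia) Rl) as [Nm [Um Im]].
  destruct (lower_summand p q l' Hp Hq Nl' ltac:(lia) Rl') as [Nm' [Um' Im']].
  assert (Lm : length (map (up_label p q) l) = (p - 1)%nat) by (rewrite length_map; lia).
  assert (Lm' : length (map (down_label p q) l') = (q - 1)%nat) by (rewrite length_map; lia).
  set (m := map (up_label p q) l) in *. set (m' := map (down_label p q) l') in *. clearbody m m'.
  assert (Hm : m <> []) by (intros ->; simpl in Lm; lia).
  assert (Hm' : m' <> []) by (intros ->; simpl in Lm'; lia).
  pose proof (upper_contract p q m Hp Hq Nm ltac:(lia) Um) as Cm.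
  pose proof (lower_contract p q m' Hp Hq Nm' ltac:(lia) Um') as Cm'.
  destruct (join_levels p q Hp Hq) as [[A1 A2] [[B1 B2] [C1 C2]]].
  destruct (place_join p q Hp Hq) as [O1 O2].
  (* From [c] along alpha to [d], on to [c'], and back along beta to [c]: [(p - 1) + (q - 1) + 3]
     vertices. *)
  set (gamma := join2 p q :: m ++ join1 p q :: join3 p q :: m').
  set (X := place p q) in *.
  assert (Jm : forall v, In v m -> v <> join1 p q /\ v <> join2 p q /\ v <> join3 p q).
  { intros v I. destruct (Um v I) as [V1 [V2 V3]]. repeat split; intros ->; lia. }
  assert (Jm' : forall v, In v m' -> v <> join1 p q /\ v <> join2 p q /\ v <> join3 p q).
  { intros v I. destruct (Um' v I) as [V1 [V2 V3]]. repeat split; intros ->; lia. }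
  assert (Jd : join1 p q <> join2 p q /\ join1 p q <> join3 p q /\ join2 p q <> join3 p q).
  { repeat split; intros E; rewrite E in *; lia. }
  assert (Ng : NoDup gamma).
  { unfold gamma. constructor.
    - rewrite in_app_iff. simpl. intros [I|[I|[I|I]]]; try congruence; try (now elim (proj1 (proj2 Jd)));
        try (destruct (Jm _ I); tauto); try (destruct (Jm' _ I); tauto); intuition.
    - apply NoDup_app; auto.
      + constructor; [simpl; intros [I|I]; [intuition|destruct (Jm' _ I); tauto]|].
        constructor; [intros I; destruct (Jm' _ I); tauto|exact Nm'].
      + intros v I [<-|[<-|I']].
        * destruct (Jm _ I); tauto.
        * destruct (Jm _ I); tauto.
        * destruct (Um v I) as [V1 [V2 V3]], (Um' v I') as [W1 [W2 W3]]. lia. }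
  assert (Rg : forall u, In u gamma -> (1 <= u <= p + q + 1)%nat).
  { unfold gamma. intros u [<-|I]; [exact B1|]. apply in_app_iff in I.
    destruct I as [I|[<-|[<-|I]]]; [apply (Um u I)|exact A1|exact C1|apply (Um' u I)]. }
  assert (Lg : length gamma = (p + q + 1)%nat).
  { unfold gamma. simpl. rewrite length_app. simpl. lia. }
  assert (Eg : forall e, In e (cycle_edges gamma) <->
     In e (upper_edges p q m ++ lower_edges p q m')).
  { intros e. unfold gamma. rewrite in_app_iff. now apply sum_cycle_edges. }
  assert (Su := fun e => upper_edge_spec p q m e Hp Hq Hm Um).
  assert (Sl := fun e => lower_edge_spec p q m' e Hp Hq Hm' Um').
  set (lifted := fun E => gset E (elo X) (ehi X) (lines (elo X) (ehi X)) (split_lift p q)).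
  set (P := (X (join2 p q), X (join2 p q) * X (join2 p q), 0) : pt).
  set (Q := (X (join3 p q), X (join3 p q) * X (join3 p q), 0) : pt).
  assert (Fam : forall t, NoDup t -> (3 <= length t)%nat ->
     (forall u, In u t -> (1 <= u <= p + q + 1)%nat) ->
     chord_family (cycle_edges t) (elo X) (ehi X)).
  { intros t Nt Lt Rt. apply cycle_family; auto.
    intros u v Iu Iv. apply (place_inj p q u v Hp Hq); auto. }
  assert (Jj : forall j, is_join p q j -> joined_edge p q j)
    by (intros; now apply join_edge_joined).
  (* The two lifted arcs, turned so that the separating surface becomes the plane [x = 0] and the
     arc of alpha lies in [x <= 0]. *)
  exists gamma, (fun z => lifted (upper_edges p q m) (tilt z) \/ lifted (lower_edges p q m') (tilt z)).
  split; [exact (conj Ng (conj Lg Rg))|]. split.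
  - apply (conn_sum_of_lifts _ _ _ _ P Q).
    + exact O2.
    + reflexivity.
    + reflexivity.
    + pose proof (place_summand p q _ Hp Hq
        (upper_vertex_summand _ _ _ (Um _ (hd_in m Hm)))) as L. fold X in L.
      destruct (Jm _ (hd_in m Hm)) as [? [? ?]].
      apply (gset_join_vertex p q _ (hd 0%nat m)); auto; fold X; try lra;
        [right; now left| |]; intros [E|E]; injection E; congruence.
    + apply (gset_join_vertex p q _ (join1 p q)); auto; fold X; try lra;
        [left; right; apply in_app_iff; right; right; now left| |];
        intros [E|E]; injection E; intuition congruence.
    + pose proof (place_summand p q _ Hp Hq
        (lower_vertex_summand _ _ _ (Um' _ (last_in m' Hm')))) as L. fold X in L.
      destruct (Jm' _ (last_in m' Hm')) as [? [? ?]].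
      apply (gset_join_vertex p q _ (last m' 0%nat)); auto; fold X; try lra;
        [left; right; apply in_app_iff; right; now left| |];
        intros [E|E]; injection E; congruence.
    + pose proof (place_summand p q _ Hp Hq
        (lower_vertex_summand _ _ _ (Um' _ (hd_in m' Hm')))) as L. fold X in L.
      destruct (Jm' _ (hd_in m' Hm')) as [? [? ?]].
      apply (gset_join_vertex p q _ (hd 0%nat m')); auto; fold X; try lra;
        [right; now left| |]; intros [E|E]; injection E; congruence.
    + intros z [e [x [He [Hx ->]]]]. destruct (Su e He) as [Je [Nj [Ue _]]].
      destruct (split_lift_sign p q e x Hp Hq Je Nj Hx) as [S1 [_ S3]].
      split; [now apply S1|]. intros S. unfold pz in S; simpl in S.
      destruct (S3 S) as [Ey Ex]. fold X in Ey, Ex. rewrite S, Ey.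
      destruct Ex as [-> | ->]; [left|right]; reflexivity.
    + intros z [e [x [He [Hx ->]]]]. destruct (Sl e He) as [Je [Nj [Ue _]]].
      destruct (split_lift_sign p q e x Hp Hq Je Nj Hx) as [_ [S2 S3]].
      split; [now apply S2|]. intros S. unfold pz in S; simpl in S.
      destruct (S3 S) as [Ey Ex]. fold X in Ey, Ex. rewrite S, Ey.
      destruct Ex as [-> | ->]; [left|right]; reflexivity.
    + apply ambient_isotopic_ext with (A := cycle_knot p (label p (p - 1) :: l))
        (B := lifted ((join3 p q, join2 p q) :: upper_edges p q m)).
      { exact Kl. }
      { intros z. apply gset_join; auto. now right. }
      (* Alpha and the first arc closed by the chord from [c] to [c'] reduce to one chord set: alpha
         by moving its vertices, the closed arc by the contractions, here run backwards. *)
      apply ambient_isotopic_trans with (1 := Im).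
      apply ambient_isotopic_trans with (1 := ambient_isotopic_sym _ _ Cm).
      apply ambient_isotopic_ext with
        (A := chords ((join3 p q, join2 p q) :: upper_edges p q m) (elo X) (ehi X) (height p q))
        (B := lifted ((join3 p q, join2 p q) :: upper_edges p q m)); [|reflexivity|].
      { intros z. rewrite <- chord_set_map. apply chord_set_ext. intros x. simpl.
        rewrite (lift_chord_lt X _ (join2 p q) (join3 p q)),
          (lift_chord_gt X _ (join3 p q) (join2 p q)) by exact O2.
        now rewrite height_sym. }
      apply split_lift_isotopic; auto.
      * intros e [<-|He]; [apply Jj; now right|]. apply (Su e He).
      * apply chord_family_incl with (l := cycle_edges (join2 p q :: m ++ [join1 p q; join3 p q])).
        { intros e. now apply upper_cycle_edges. }
        apply Fam.
        -- unfold gamma in Ng. replace (join2 p q :: m ++ join1 p q :: join3 p q :: m')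
             with ((join2 p q :: m ++ [join1 p q; join3 p q]) ++ m') in Ng
             by (simpl; now rewrite <- app_assoc).
           now apply NoDup_app_remove_r in Ng.
        -- simpl. rewrite length_app. simpl. lia.
        -- intros u Iu. apply Rg. unfold gamma. simpl in *. rewrite in_app_iff in *. simpl in *.
           tauto.
    + apply ambient_isotopic_ext with (A := cycle_knot q (label q 2 :: l'))
        (B := lifted ((join2 p q, join3 p q) :: lower_edges p q m')).
      { exact Kl'. }
      { intros z. apply gset_join; auto. now left. }
      apply ambient_isotopic_trans with (1 := Im').
      apply ambient_isotopic_trans with (1 := ambient_isotopic_sym _ _ Cm').
      apply ambient_isotopic_ext with
        (A := chords ((join2 p q, join3 p q) :: lower_edges p q m') (elo X) (ehi X) (height p q))
        (B := lifted ((join2 p q, join3 p q) :: lower_edges p q m')); [|reflexivity|].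
      { intros z. now rewrite <- chord_set_map. }
      apply split_lift_isotopic; auto.
      * intros e [<-|He]; [apply Jj; now left|]. apply (Sl e He).
      * apply chord_family_incl with (l := cycle_edges (join2 p q :: join3 p q :: m')).
        { intros e. now apply lower_cycle_edges. }
        apply Fam.
        -- constructor; [simpl; intros [I|I]; [intuition|destruct (Jm' _ I); tauto]|].
           constructor; [intros I; destruct (Jm' _ I); tauto|exact Nm'].
        -- simpl. lia.
        -- intros u Iu. apply Rg. unfold gamma. simpl in *. rewrite in_app_iff. simpl. tauto.
  - apply ambient_isotopic_trans with (B := lifted (cycle_edges gamma)).
    + apply ambient_isotopic_trans with
        (B := chords (cycle_edges gamma) (elo X) (ehi X) (height p q)).
      * apply (cycle_knot_isotopic (p + q + 1) (p + 3) gamma (height p q)); auto; try lia.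
        intros e f He Hf I. apply Eg in He, Hf. rewrite in_app_iff in He, Hf.
        assert (Re : in_range (p + q + 1) e).
        { destruct He as [He|He]; [apply (Su e He)|apply (Sl e He)]. }
        assert (Rf : in_range (p + q + 1) f).
        { destruct Hf as [Hf|Hf]; [apply (Su f Hf)|apply (Sl f Hf)]. }
        pose proof (crossing_levels (p + q + 1) (p + 3) e f ltac:(lia) Re Rf I) as C.
        pose proof (sheet_le _ _ Re) as Le. pose proof (sheet_le _ _ Rf) as Lf.
        destruct He as [He|He], Hf as [Hf|Hf].
        -- destruct (Su e He) as [_ [_ [Ue _]]], (Su f Hf) as [_ [_ [Uf _]]].
           rewrite !height_upper by assumption. now apply height_sign.
        (* Here the two summands cross. Levels are at most [p + 1] on the upper edge, at least
           [p + 1] on the lower one, and different at a crossing, so the upper edge lies in the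
           higher sheet. *)
        -- destruct (Su e He) as [_ [_ [Ue Ve]]], (Sl f Hf) as [_ [_ [Uf Vf]]].
           pose proof (height_upper_pos p q e Re Ue). pose proof (height_lower_neg p q f Rf Uf).
           left. split; [|lra]. apply Rlt_0_minus. apply lt_INR. lia.
        -- destruct (Sl e He) as [_ [_ [Ue Ve]]], (Su f Hf) as [_ [_ [Uf Vf]]].
           pose proof (height_upper_pos p q f Rf Uf). pose proof (height_lower_neg p q e Re Ue).
           right. split; [|lra]. apply Rlt_minus. apply lt_INR. lia.
        -- destruct (Sl e He) as [_ [_ [Ue _]]], (Sl f Hf) as [_ [_ [Uf _]]].
           rewrite !height_lower by assumption.
           replace (- INR (natural_level (p + q + 1) e)) with (0 - INR (natural_level (p + q + 1) e))
             by ring.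
           replace (- INR (natural_level (p + q + 1) f)) with (0 - INR (natural_level (p + q + 1) f))
             by ring.
           now apply height_sign.
      * apply split_lift_isotopic; auto.
        -- intros e He. apply Eg, in_app_iff in He.
           destruct He as [He|He]; [apply (Su e He)|apply (Sl e He)].
        -- apply Fam; auto. lia.
    + refine (ambient_isotopic_ext _ _ _ _ (fun z => iff_refl _) _ (tilt_isotopic _)).
      intros z. unfold lifted. rewrite (gset_list_ext _ _ _ _ _ _ _ _ Eg). split.
      * intros [e [x [He K]]]. apply in_app_iff in He.
        destruct He as [He|He]; [left|right]; exists e, x; auto.
      * intros [[e [x [He K]]]|[e [x [He K]]]]; exists e, x;
          (split; [apply in_app_iff; auto|exact K]).
Qed.
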